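(* $E(\mathbb{R}^3)\subset L^p(\mathbb{R}^3)$ for every $p\in[3,6)$, and the inclusion does not hold for $1\le p<3$.
   Context: $D^{1,2}(\mathbb{R}^3)=\{u\in L^{6}(\mathbb{R}^3):\ |\nabla u|\in L^2(\mathbb{R}^3)\}$. The space $E(\mathbb{R}^3)$ is the set of (not necessarily radial) functions $u\in D^{1,2}(\mathbb{R}^3)$ with $\int_{\mathbb{R}^3}\int_{\mathbb{R}^3}\frac{u^2(x)u^2(y)}{|x-y|}\,dx\,dy<+\infty$. *)

(* Defs.v *)
From HB Require Import structures.
From mathcomp Require Import all_boot all_order all_algebra.
From mathcomp Require Import all_classical all_reals all_analysis.
Set Implicit Arguments.
Unset Strict Implicit.
Unset Printing Implicit Defensive.
Import Order.TTheory GRing.Theory Num.Theory.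
Import numFieldNormedType.Exports.
Local Open Scope classical_set_scope.
Local Open Scope ring_scope.

(* The norm that the library puts on a product is the sup norm. It is used below
   only through its topology; [enorm] is the Euclidean norm. *)
Notation R3 R := (R * R * R)%type (only parsing).

(* Lebesgue measure on the Borel sigma-algebra of R^3. It is not completed:
   "measurable" means Borel, which changes no almost-everywhere class. *)
Definition leb3 (R : realType) :
    set (measurableTypeR R * measurableTypeR R * measurableTypeR R)%type ->
    \bar R :=
  ((@lebesgue_measure R \x @lebesgue_measure R) \x @lebesgue_measure R)%E.
Arguments leb3 R _ : clear implicits.
HB.instance Definition _ (R : realType) := Measure.on (leb3 R).

Definition enorm (R : realType) (x : R3 R) : R :=
  Num.sqrt (x.1.1 ^+ 2 + x.1.2 ^+ 2 + x.2 ^+ 2).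

Definition evec (R : realType) (i : 'I_3) : R3 R :=
  ((i == 0%N :> nat)%:R, (i == 1%N :> nat)%:R, (i == 2%N :> nat)%:R).

Definition partial (R : realType) (i : 'I_3) (f : R3 R -> R) : R3 R -> R :=
  fun x => 'D_(evec R i) f x.

(* [s] is a multi-index, written as the list of the successive directions. *)
Definition smooth (R : realType) (f : R3 R -> R) : Prop :=
  forall s : seq 'I_3,
    continuous (foldr (@partial R) f s) /\
    (forall (i : 'I_3) (x : R3 R),
      derivable (foldr (@partial R) f s) x (evec R i)).

Definition test_function (R : realType) (f : R3 R -> R) : Prop :=
  smooth f /\ compact (closure [set x | f x != 0]).

(* The library's [locally_integrable] is only available on the real line. *)
Definition locally_integrable3 (R : realType) (f : R3 R -> R) : Prop :=
  forall K : set (R3 R), compact K -> (leb3 R).-integrable K (EFin \o f).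

Definition weak_gradient (R : realType)
    (u : R3 R -> R) (g : 'I_3 -> R3 R -> R) : Prop :=
  [/\ locally_integrable3 u,
      forall i, locally_integrable3 (g i) &
      forall (i : 'I_3) (phi : R3 R -> R), test_function phi ->
        \int[leb3 R]_x (u x * partial i phi x) =
        - \int[leb3 R]_x (g i x * phi x)].

Definition Lp3 (R : realType) (p : R) : set (R3 R -> R) :=
  [set u | u \in Lfun (leb3 R) p%:E].

Definition D12 (R : realType) : set (R3 R -> R) :=
  [set u | Lp3 6 u /\
    exists2 g : 'I_3 -> R3 R -> R, weak_gradient u g &
      Lp3 2 (fun x => Num.sqrt (\sum_(i < 3) g i x ^+ 2))].

(* On the diagonal [x = y] the quotient is 0 by convention, on a null set. *)
Definition coulomb_energy (R : realType) (u : R3 R -> R) : \bar R :=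
  (\int[leb3 R]_x \int[leb3 R]_y
    (u x ^+ 2 * u y ^+ 2 / enorm (x - y))%:E)%E.

Definition Espace (R : realType) : set (R3 R -> R) :=
  [set u | D12 u /\ (coulomb_energy u < +oo)%E].
Arguments Espace R _ : clear implicits.

(* Main.v *)
Require Import Defs.
From HB Require Import structures.
From mathcomp Require Import all_boot all_order all_algebra.
From mathcomp Require Import all_classical all_reals all_analysis.
From mathcomp Require Import measurable_realfun.
From mathcomp Require Import ring lra.
Set Implicit Arguments.
Unset Strict Implicit.
Unset Printing Implicit Defensive.
Import Order.TTheory GRing.Theory Num.Theory.
Import numFieldNormedType.Exports.
Local Open Scope classical_set_scope.
Local Open Scope ring_scope.

(** Write E for the energy space. For p in [3,6), finiteness of the energy
    gives u in L^3; as u is in L^6, interpolation gives the rest.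
    Put v = |u|, b_j = 4^-j, A_j = {b_j <= v < 4 b_j}, and let w_j
    be the part of v between the levels b_(j+1) and b_j. If x is in A_j, then
    for every y either v(y) is comparable to b_j, or w_j changes by a fixed
    fraction of b_j between x and y ([wband_dichotomy]). Take y = x + 2^j s and
    average over s in the unit cube. The first alternative costs at most the
    Coulomb energy of u on A_j, because |x - y| <= 2 * 2^j ([cube_near_le]). The
    second costs b_j times the translation energy of w_j at 2^j s, where the
    translation energy at z is the integral of |w(x + z) - w(x)|^2. That energy
    at most quadruples when z doubles, so b_j = 4^-j absorbs the dilation
    exactly ([cube_far_le]): this balance is what singles out the exponent 3.
    The translation energies of the w_j add up to at most that of u
    ([sum_shift_energy_band]), so the bounds can be summed over j
    ([integral_cube_lty]). Finally the translation energy of u at s e_i, for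
    s <= 1, is at most the integral of |d_i u|^2 ([shift_energy_neg_le]). For a
    weak gradient this is obtained by testing against smooth bumps that converge
    to indicators of boxes, which gives
    u(x - s e_i) - u(x) = - \int_0^s d_i u (x - t e_i) dt
    for almost every x, boxes being a pi-system.

    For 1 <= p < 3, a counterexample is a sum of bumps of height l_k^-2 on cubes
    of side l_k = (k+1)^(1/p) whose corners (4^(k+1), 0, 0) move away
    exponentially ([sparse]). The integrals of u^6 and |grad u|^2, and the
    Coulomb energy of each bump with itself, are controlled by the sum of
    l_k^-3 = (k+1)^(-3/p), which converges ([sum_powRN]). The mutual Coulomb
    energies are summable because the j-th and k-th cubes are at distance at
    least 2^(j+k) ([site_gap]). The integral of u^p is at least a constant times
    the sum of l_k^(3-2p) >= 1/(k+1), which diverges ([sparse_not_Lp]). The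
    bumps are only Lipschitz; their weak gradient is computed by passing to the
    limit in difference quotients ([weak_gradient_quotient]). *)

(** * Affine changes of variables *)

Notation M2 R := (measurableTypeR R * measurableTypeR R)%type.
Notation M3 R := (measurableTypeR R * measurableTypeR R * measurableTypeR R)%type.
Notation mfun3 f := (measurable_fun [set: M3 _] (f : M3 _ -> _)).

Lemma sigma_finite_prod d1 d2 (T1 : measurableType d1) (T2 : measurableType d2)
    (R : realType) (m1 : {sigma_finite_measure set T1 -> \bar R})
    (m2 : {sigma_finite_measure set T2 -> \bar R}) :
  sigma_finite setT (m1 \x m2)%E.
Proof.
have /sigma_finiteP[F [TF ndF Foo]] := sigma_finiteT m1.
have /sigma_finiteP[G [TG ndG Goo]] := sigma_finiteT m2.
exists (fun n => F n `*` G n).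
  rewrite -setXTT TF TG predeqE => -[x y]; split.
    move=> [/= [n _ Fnx] [k _ Gky]]; exists (maxn n k) => //; split.
    - by move: x Fnx; exact/subsetPset/ndF/leq_maxl.
    - by move: y Gky; exact/subsetPset/ndG/leq_maxr.
  by move=> [n _ []/= ? ?]; split; exists n.
move=> k; have [? ?] := Foo k; have [? ?] := Goo k.
split; first exact: measurableX.
by rewrite product_measure1E// lte_mul_pinfty// ge0_fin_numE.
Qed.

Definition leb2 (R : realType) : set (M2 R) -> \bar R :=
  (@lebesgue_measure R \x @lebesgue_measure R)%E.
Arguments leb2 R _ : clear implicits.
HB.instance Definition _ (R : realType) := Measure.on (leb2 R).
HB.instance Definition _ (R : realType) :=
  Measure_isSigmaFinite.Build _ _ _ (leb2 R) (sigma_finite_prod lebesgue_measure lebesgue_measure).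
HB.instance Definition _ (R : realType) :=
  Measure_isSigmaFinite.Build _ _ _ (leb3 R) (sigma_finite_prod (leb2 R) lebesgue_measure).

Lemma ge0_integral_comb d (T : measurableType d) (R : realType)
    (mu : {measure set T -> \bar R}) (D : set T) (k1 k2 : R) (f1 f2 : T -> \bar R) :
  measurable D -> 0 <= k1 -> 0 <= k2 ->
  measurable_fun setT f1 -> measurable_fun setT f2 ->
  (forall x, 0 <= f1 x)%E -> (forall x, 0 <= f2 x)%E ->
  (\int[mu]_(x in D) (k1%:E * f1 x + k2%:E * f2 x) =
   k1%:E * \int[mu]_(x in D) f1 x + k2%:E * \int[mu]_(x in D) f2 x)%E.
Proof.
move=> mD k10 k20 m1 m2 p1 p2.
have n1 : measurable_fun D f1 by apply: measurable_funTS.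
have n2 : measurable_fun D f2 by apply: measurable_funTS.
rewrite ge0_integralD//; last 4 first.
- by move=> x _; rewrite mule_ge0.
- exact: measurable_funeM.
- by move=> x _; rewrite mule_ge0.
- exact: measurable_funeM.
by rewrite !ge0_integralZl_EFin.
Qed.

(** Used to check the scaling of a product measure factor by factor, where a
    factor may have infinite measure. *)
Lemma mule_scale2 (R : realType) (c r s : R) (x y : \bar R) :
  c * (r * s) = 1 -> (c%:E * ((r%:E * x) * (s%:E * y)) = x * y)%E.
Proof. move=> h; have h' : (c%:E * (r%:E * s%:E) = 1)%E by rewrite -!EFinM h.
by rewrite (muleACA r%:E) (muleA c%:E) h' mul1e. Qed.

Lemma nneseries_comb (R : realType) (k1 k2 : R) (f1 f2 : nat -> \bar R) :
  0 <= k1 -> 0 <= k2 -> (forall j, 0 <= f1 j)%E -> (forall j, 0 <= f2 j)%E ->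
  (\sum_(0 <= j <oo) (k1%:E * f1 j + k2%:E * f2 j) =
   k1%:E * \sum_(0 <= j <oo) f1 j + k2%:E * \sum_(0 <= j <oo) f2 j)%E.
Proof.
move=> k10 k20 p1 p2.
by rewrite nneseriesD ?nneseriesZl// => j _ _; rewrite mule_ge0.
Qed.

Definition aff1 (R : realType) (a b : R) : measurableTypeR R -> measurableTypeR R :=
  fun x : R => a * x + b.

Lemma measurable_aff1 (R : realType) (a b : R) : measurable_fun setT (aff1 a b).
Proof.
by apply: measurable_funD => //; apply: measurable_funM.
Qed.

(** Both sides, suitably rescaled, are measures of A agreeing on half-open
    intervals. The same scheme, with product sets in place of intervals, lifts
    the formula to the plane and to the space. *)
Lemma lebesgue_measure_aff1 (R : realType) (a b : R) (A : set (measurableTypeR R)) :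
  0 < a -> measurable A ->
  lebesgue_measure (aff1 a b @^-1` A) = (a^-1%:E * lebesgue_measure A)%E.
Proof.
move=> a0 mA.
have ma := measurable_aff1 a b.
pose fm : {measure set (measurableTypeR R) -> \bar R} := measure_function_pushforward__canonical__measure_function_Measure (@lebesgue_measure R) ma.
pose m := mscale (NngNum (ltW a0)) fm.
have -> : (lebesgue_measure A = m A)%E.
  apply: lebesgue_measure_unique => //= _ [[c d]] _ <-.
  rewrite /m /mscale /= /fm /pushforward /=.
  have -> : aff1 a b @^-1` `]c, d]%classic = `](c - b) / a, (d - b) / a]%classic.
    apply/seteqP; split => x /=; rewrite !in_itv /= /aff1 ltr_pdivrMr// ler_pdivlMr// ltrBlDr lerBrDr mulrC //.
  rewrite !lebesgue_measure_itv /= !lte_fin ltr_pM2r ?invr_gt0// ltrD2r.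
  case: ifPn => _; last by rewrite mule0.
  rewrite -!EFinD -EFinM; congr EFin; field; exact: lt0r_neq0.
by rewrite /m /mscale /= muleA -EFinM mulVf ?mul1e// gt_eqF.
Qed.

Definition aff2 (R : realType) (a b1 b2 : R) : M2 R -> M2 R :=
  fun x => (aff1 a b1 x.1, aff1 a b2 x.2).

Definition aff3 (R : realType) (a : R) (b : R3 R) : M3 R -> M3 R :=
  fun x => (aff2 a b.1.1 b.1.2 x.1, aff1 a b.2 x.2).

Lemma measurable_aff2 (R : realType) (a b1 b2 : R) : measurable_fun setT (aff2 a b1 b2).
Proof.
apply/measurable_fun_pair => /=.
  exact: (measurableT_comp (measurable_aff1 a b1) measurable_fst).
exact: (measurableT_comp (measurable_aff1 a b2) measurable_snd).
Qed.

Lemma measurable_aff3 (R : realType) (a : R) (b : R3 R) :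
  measurable_fun setT (aff3 a b).
Proof.
apply/measurable_fun_pair => /=.
  exact: (measurableT_comp (measurable_aff2 a b.1.1 b.1.2) measurable_fst).
exact: (measurableT_comp (measurable_aff1 a b.2) measurable_snd).
Qed.

Lemma leb2_aff2 (R : realType) (a b1 b2 : R) (A : set (M2 R)) :
  0 < a -> measurable A ->
  leb2 R (aff2 a b1 b2 @^-1` A) = ((a ^- 2)%:E * leb2 R A)%E.
Proof.
move=> a0 mA.
have ma := measurable_aff2 a b1 b2.
pose fm : {measure set (M2 R) -> \bar R} := measure_function_pushforward__canonical__measure_function_Measure (leb2 R) ma.
have ap : 0 <= a ^+ 2 by rewrite exprn_ge0 // ltW.
pose m := mscale (NngNum ap) fm.
have -> : (leb2 R A = m A)%E.
  apply: (@product_measure_unique _ _ _ _ R lebesgue_measure lebesgue_measure) => // B C mB mC.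
  transitivity ((a ^+ 2)%:E * leb2 R (aff2 a b1 b2 @^-1` (B `*` C)))%E; first by [].
  have -> : aff2 a b1 b2 @^-1` (B `*` C) = (aff1 a b1 @^-1` B) `*` (aff1 a b2 @^-1` C) by [].
  have -> : leb2 R ((aff1 a b1 @^-1` B) `*` (aff1 a b2 @^-1` C)) = (lebesgue_measure (aff1 a b1 @^-1` B) * lebesgue_measure (aff1 a b2 @^-1` C))%E.
    apply: (product_measure1E lebesgue_measure).
    - by rewrite -[X in measurable X]setTI; exact: measurable_aff1.
    - by rewrite -[X in measurable X]setTI; exact: measurable_aff1.
  rewrite !lebesgue_measure_aff1// mule_scale2//.
  by field; exact: lt0r_neq0.
by rewrite /m /mscale /= muleA -EFinM mulVf ?mul1e// gt_eqF// exprn_gt0.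
Qed.

Lemma leb3_aff3 (R : realType) (a : R) (b : R3 R) (A : set (M3 R)) :
  0 < a -> measurable A ->
  leb3 R (aff3 a b @^-1` A) = ((a ^- 3)%:E * leb3 R A)%E.
Proof.
move=> a0 mA.
have ma := measurable_aff3 a b.
pose fm : {measure set (M3 R) -> \bar R} := measure_function_pushforward__canonical__measure_function_Measure (leb3 R) ma.
have a30 : 0 <= a ^+ 3 by rewrite exprn_ge0 // ltW.
pose m := mscale (NngNum a30) fm.
have -> : (leb3 R A = m A)%E.
  apply: (@product_measure_unique _ _ _ _ R (leb2 R) lebesgue_measure) => // B C mB mC.
  transitivity ((a ^+ 3)%:E * leb3 R (aff3 a b @^-1` (B `*` C)))%E; first by [].
  have -> : aff3 a b @^-1` (B `*` C) = (aff2 a b.1.1 b.1.2 @^-1` B) `*` (aff1 a b.2 @^-1` C) by [].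
  have -> : leb3 R ((aff2 a b.1.1 b.1.2 @^-1` B) `*` (aff1 a b.2 @^-1` C)) = (leb2 R (aff2 a b.1.1 b.1.2 @^-1` B) * lebesgue_measure (aff1 a b.2 @^-1` C))%E.
    apply: (product_measure1E (leb2 R)).
    - by rewrite -[X in measurable X]setTI; exact: measurable_aff2.
    - by rewrite -[X in measurable X]setTI; exact: measurable_aff1.
  rewrite lebesgue_measure_aff1// leb2_aff2// mule_scale2//.
  by field; exact: lt0r_neq0.
by rewrite /m /mscale /= muleA -EFinM mulVf ?mul1e// gt_eqF// exprn_gt0.
Qed.

Lemma ge0_integral_aff3 (R : realType) (a : R) (b : R3 R) (f : M3 R -> \bar R) :
  0 < a -> measurable_fun setT f -> (forall x, (0 <= f x)%E) ->
  (\int[leb3 R]_x f (aff3 a b x) = (a ^- 3)%:E * \int[leb3 R]_x f x)%E.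
Proof.
move=> a0 mf f0.
have ma := measurable_aff3 a b.
have := @ge0_integral_pushforward _ _ _ _ R _ ma (leb3 R) setT f measurableT mf (fun y _ => f0 y).
rewrite preimage_setT => <-.
have a30 : 0 <= a ^- 3 by rewrite invr_ge0 exprn_ge0 // ltW.
rewrite (eq_measure_integral (mscale (NngNum a30) (leb3 R))) => [|A mA _].
  by rewrite ge0_integral_mscale.
exact: (leb3_aff3 b a0 mA).
Qed.

Lemma aff3_1 (R : realType) (b x : R3 R) : aff3 1 b x = x + b.
Proof. by case: x => [[? ?] ?]; rewrite /aff3 /aff2 /aff1 !mul1r. Qed.

Lemma ge0_integral_shift (R : realType) (b : R3 R) (f : R3 R -> \bar R) :
  mfun3 f -> (forall x, (0 <= f x)%E) ->
  (\int[leb3 R]_x f (x + b)%R = \int[leb3 R]_x f x)%E.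
Proof.
move=> mf f0.
under eq_integral do rewrite -aff3_1.
by rewrite ge0_integral_aff3// expr1n invr1 mul1e.
Qed.

Lemma measurable_shift (R : realType) (b : R3 R) :
  measurable_fun [set: M3 R] ((fun x : R3 R => x + b) : M3 R -> M3 R).
Proof. by under eq_fun do rewrite -aff3_1; exact: measurable_aff3. Qed.

Lemma integral_shift (R : realType) (b : R3 R) (f : R3 R -> \bar R) :
  mfun3 f ->
  (\int[leb3 R]_x f (x + b)%R = \int[leb3 R]_x f x)%E.
Proof.
move=> mf; rewrite integralE [in RHS]integralE.
have mf' : measurable_fun setT (f : M3 R -> \bar R) := mf.
congr (_ - _)%E.
  rewrite -(@ge0_integral_shift R b (f^\+)%E (measurable_funepos mf') (funepos_ge0 f)).
  by apply: eq_integral => x _; rewrite ?funeposE ?funenegE.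
rewrite -(@ge0_integral_shift R b (f^\-)%E (measurable_funeneg mf') (funeneg_ge0 f)).
by apply: eq_integral => x _; rewrite ?funeposE ?funenegE.
Qed.

(** * Dyadic bands of values *)

Lemma Lp3P (R : realType) (p : R) (u : R3 R -> R) : 1 <= p ->
  Lp3 p u <-> mfun3 u /\ (\int[leb3 R]_x (`|u x| `^ p)%:E < +oo)%E.
Proof.
move=> p1; split.
  move=> up; split.
    by move: (up); rewrite /Lp3 /= inE => /andP[/[!inE]].
  have /integrableP[_] := Lfun_integrable p1 up.
  by under eq_integral do rewrite gee0_abs ?lee_fin ?powR_ge0//.
move=> [mu fin]; rewrite /Lp3 /= inE; apply/andP; split; rewrite inE//=.
by rewrite /finite_norm unlock /Lnorm poweR_lty.
Qed.

(** Up to an additive constant, the truncation of t to the levels between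
    4^-(j+1) and 4^-j. *)
Definition wband (R : realType) (j : nat) (t : R) : R :=
  Num.max t (4^-1 ^+ j.+1) - Num.max t (4^-1 ^+ j).

(** For c <= a, the increments of the truncations are nonnegative and their sum
    telescopes to at most a - c; the sum of squares of nonnegative numbers is at
    most the square of their sum. *)
Lemma sum_sqr_wband (R : realType) (n : nat) (a c : R) :
  \sum_(j < n) (wband j a - wband j c) ^+ 2 <= (a - c) ^+ 2.
Proof.
wlog ca : a c / c <= a.
  move=> H; have [ca|ac] := leP c a; first exact: H.
  rewrite -(sqrrN (a - c)) opprB.
  under eq_bigr do rewrite -sqrrN opprB.
  exact/H/ltW.
have max_mono (r : R) : Num.max c r <= Num.max a r.
  by rewrite ge_max !le_max ca lexx orbT.
have max_lip (r : R) : Num.max a r - Num.max c r <= a - c.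
  by have [h|h] := leP a r; have [h'|h'] := leP c r; lra.
have qle j : 4^-1 ^+ j.+1 <= 4^-1 ^+ j :> R.
  by rewrite exprS ler_piMl ?exprn_ge0 ?invf_le1//; lra.
pose d j := wband j a - wband j c.
have d0 j : 0 <= d j.
  rewrite /d /wband; move: ca (qle j).
  move: (4^-1 ^+ j.+1) (4^-1 ^+ j) => r s.
  by have [?|?] := leP a r; have [?|?] := leP c r; have [?|?] := leP a s; have [?|?] := leP c s; lra.
have sumE m : \sum_(j < m) d j = (Num.max a (4^-1 ^+ m) - Num.max c (4^-1 ^+ m))
    - (Num.max a 1 - Num.max c 1).
  elim: m => [|m IH]; first by rewrite big_ord0 expr0 subrr.
  by rewrite big_ord_recr /= IH /d /wband; lra.
have sq m : \sum_(j < m) d j ^+ 2 <= (\sum_(j < m) d j) ^+ 2.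
  elim: m => [|m IH]; first by rewrite !big_ord0 expr0n.
  rewrite !big_ord_recr /= [X in _ <= X]sqrrD.
  have := sumr_ge0 (index_enum 'I_m) (fun j _ => d0 (nat_of_ord j)) : 0 <= \sum_(j < m) d j.
  move=> s0; have := mulr_ge0 s0 (d0 m); lra.
apply: (le_trans (sq n)).
rewrite ler_sqr ?nnegrE ?subr_ge0//; last by apply: sumr_ge0 => j _.
by rewrite sumE lerBlDr (le_trans (max_lip _))// lerDl subr_ge0.
Qed.

(** If s >= 4^-j / 4 the first square suffices; otherwise s lies below the whole
    band and t above it, so the truncation changes by 3/4 of 4^-j. *)
Lemma wband_dichotomy (R : realType) (j : nat) (s t : R) :
  4^-1 ^+ j <= t -> 0 <= s ->
  (4^-1 ^+ j) ^+ 2 <= 16 * (s ^+ 2 + (wband j s - wband j t) ^+ 2).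
Proof.
have : 0 <= (4^-1 ^+ j : R) by rewrite exprn_ge0.
rewrite /wband (exprS _ j); move: (4^-1 ^+ j) => b b0 bt s0.
rewrite (max_l bt) (_ : Num.max t (4^-1 * b) = t); last by apply/max_idPl; lra.
rewrite subrr subr0.
have [h|h] := leP (4^-1 * b) s.
  have : (4^-1 * b) ^+ 2 <= s ^+ 2 by rewrite ler_sqr// nnegrE; lra.
  have := sqr_ge0 (s - Num.max s b); lra.
rewrite (_ : Num.max s b = b); last by apply/max_idPr; lra.
have := sqr_ge0 s; have := sqr_ge0 b; nra.
Qed.

(** The dichotomy multiplied by 4^-j; in its first term,
    4^-j = 4^j (4^-j)^2 <= 4^j t^2. *)
Lemma band_cube_le (R : realType) : exists2 c : R, 0 <= c &
  forall (j : nat) (s t : R), 4^-1 ^+ j <= t -> t < 4 * 4^-1 ^+ j -> 0 <= s ->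
  t ^+ 3 <= c * (4 ^+ j * (t ^+ 2 * s ^+ 2) + 4^-1 ^+ j * (wband j s - wband j t) ^+ 2).
Proof.
exists 1024 => [|j s t bt tb s0]; first by rewrite ler0n.
have := wband_dichotomy bt s0.
have b0 : 0 < (4^-1 ^+ j : R) by rewrite exprn_gt0.
have : (4 ^+ j : R) * 4^-1 ^+ j = 1 by rewrite -exprMn divff ?expr1n.
have : 0 < (4 ^+ j : R) by rewrite exprn_gt0.
move: bt tb b0; move: (4 ^+ j) (4^-1 ^+ j) (wband j s - wband j t) => c b w bt tb b0 c0 cb h.
have h1 : t ^+ 3 <= 64 * b ^+ 3.
  have -> : 64 * b ^+ 3 = (4 * b) ^+ 3 by ring.
  by rewrite lerXn2r// ?nnegrE; lra.
have h2 : b ^+ 3 <= 16 * (b * s ^+ 2 + b * w ^+ 2).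
  have -> : b ^+ 3 = b * b ^+ 2 by ring.
  have -> : 16 * (b * s ^+ 2 + b * w ^+ 2) = b * (16 * (s ^+ 2 + w ^+ 2)) by ring.
  by rewrite ler_pM2l.
have h3 : b * s ^+ 2 <= c * (t ^+ 2 * s ^+ 2).
  rewrite mulrA ler_wpM2r ?sqr_ge0//.
  have -> : b = c * b ^+ 2 by rewrite expr2 mulrA cb mul1r.
  by rewrite ler_pM2l// ler_sqr// nnegrE; lra.
have := mulr_ge0 (ltW b0) (sqr_ge0 w); lra.
Qed.

(** * The Coulomb integrand *)

Lemma measurable_sqrt (R : realType) d (T : measurableType d) (D : set T) (f : T -> R) :
  measurable_fun D f -> measurable_fun D (fun x => Num.sqrt (f x)).
Proof.
move=> mf; apply: (@measurableT_comp _ _ _ _ _ _ (Num.sqrt : R -> R)) => //.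
by apply: continuous_measurable_fun; exact: sqrt_continuous.
Qed.

Lemma measurable_invr (R : realType) d (T : measurableType d) (D : set T) (f : T -> R) :
  (forall x, 0 <= f x) -> measurable_fun D f -> measurable_fun D (fun x => (f x)^-1).
Proof.
move=> f0 mf; under eq_fun do rewrite -powR_inv1//.
exact: (measurableT_comp (measurable_powR _)).
Qed.

Lemma enorm_ge0 (R : realType) (x : R3 R) : 0 <= enorm x.
Proof. exact: sqrtr_ge0. Qed.

Lemma enormN (R : realType) (x : R3 R) : enorm (- x) = enorm x.
Proof. by rewrite /enorm !sqrrN. Qed.

Lemma measurable_fun_coord1 (R : realType) d (T : measurableType d) (f : T -> M3 R) :
  measurable_fun setT f -> measurable_fun setT (fun x => (f x).1.1 : R).
Proof. by move=> mf; do 2 apply: (measurableT_comp measurable_fst). Qed.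
Lemma measurable_fun_coord2 (R : realType) d (T : measurableType d) (f : T -> M3 R) :
  measurable_fun setT f -> measurable_fun setT (fun x => (f x).1.2 : R).
Proof. by move=> mf; apply: (measurableT_comp measurable_snd); exact: (measurableT_comp measurable_fst). Qed.
Lemma measurable_fun_coord3 (R : realType) d (T : measurableType d) (f : T -> M3 R) :
  measurable_fun setT f -> measurable_fun setT (fun x => (f x).2 : R).
Proof. by move=> mf; exact: (measurableT_comp measurable_snd). Qed.

Lemma measurable_enorm (R : realType) : measurable_fun [set: M3 R] (@enorm R : M3 R -> R).
Proof.
apply: measurable_sqrt; apply: measurable_funD; [apply: measurable_funD|]; apply: measurable_funX.
- exact: (@measurable_fun_coord1 R _ _ id (@measurable_id _ _ setT)).
- exact: (@measurable_fun_coord2 R _ _ id (@measurable_id _ _ setT)).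
- exact: (@measurable_fun_coord3 R _ _ id (@measurable_id _ _ setT)).
Qed.

Lemma measurable_add3 (R : realType) d (T : measurableType d) (f g : T -> M3 R) :
  measurable_fun setT f -> measurable_fun setT g ->
  measurable_fun setT (fun x => (f x : R3 R) + (g x : R3 R) : M3 R).
Proof.
move=> mf mg; apply/measurable_fun_pair => /=; [apply/measurable_fun_pair => /=|].
- by apply: measurable_funD; [exact: measurable_fun_coord1 mf|exact: measurable_fun_coord1 mg].
- by apply: measurable_funD; [exact: measurable_fun_coord2 mf|exact: measurable_fun_coord2 mg].
- by apply: measurable_funD; [exact: measurable_fun_coord3 mf|exact: measurable_fun_coord3 mg].
Qed.

Lemma measurable_opp3 (R : realType) d (T : measurableType d) (f : T -> M3 R) :
  measurable_fun setT f -> measurable_fun setT (fun x => - (f x : R3 R) : M3 R).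
Proof.
move=> mf; apply/measurable_fun_pair => /=; [apply/measurable_fun_pair => /=|].
- by apply: measurable_funN; exact: measurable_fun_coord1 mf.
- by apply: measurable_funN; exact: measurable_fun_coord2 mf.
- by apply: measurable_funN; exact: measurable_fun_coord3 mf.
Qed.

Definition coulomb_integrand (R : realType) (u : R3 R -> R) (z : M3 R * M3 R) : \bar R :=
  (u z.1 ^+ 2 * u z.2 ^+ 2 / enorm (z.1 - z.2))%:E.

Lemma measurable_coulomb_integrand (R : realType) (u : R3 R -> R) :
  mfun3 u -> measurable_fun setT (coulomb_integrand u).
Proof.
move=> mu; apply/measurable_EFinP; apply: measurable_funM.
  apply: measurable_funM; apply: measurable_funX.
    exact: (measurableT_comp mu measurable_fst).
  exact: (measurableT_comp mu measurable_snd).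
apply: measurable_invr => [x|]; first exact: enorm_ge0.
apply: (measurableT_comp (@measurable_enorm R)).
apply: measurable_add3; first exact: measurable_fst.
by apply: measurable_opp3; exact: measurable_snd.
Qed.

Lemma coulomb_integrand_ge0 (R : realType) (u : R3 R -> R) z :
  (0 <= coulomb_integrand u z)%E.
Proof.
by rewrite lee_fin; apply: mulr_ge0; [rewrite mulr_ge0 ?sqr_ge0|rewrite invr_ge0 enorm_ge0].
Qed.

(** The Coulomb potential of u^2 at x, weighted by u(x)^2. *)
Definition potential (R : realType) (u : R3 R -> R) (x : R3 R) : \bar R :=
  (\int[leb3 R]_y (u x ^+ 2 * u y ^+ 2 / enorm (x - y))%:E)%E.

Lemma potential_ge0 (R : realType) (u : R3 R -> R) x : (0 <= potential u x)%E.
Proof. by apply: integral_ge0 => y _; exact: (coulomb_integrand_ge0 u (x, y)). Qed.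

Lemma measurable_potential (R : realType) (u : R3 R -> R) : mfun3 u -> mfun3 (potential u).
Proof.
move=> mu.
exact: (@measurable_fun_fubini_tonelli_F _ _ _ _ R (leb3 R) _ (measurable_coulomb_integrand mu) (coulomb_integrand_ge0 u)).
Qed.

Definition ucube (R : realType) : set (M3 R) :=
  (`]0%R, 1%R]%classic `*` `]0%R, 1%R]%classic) `*` `]0%R, 1%R]%classic.
Arguments ucube R : clear implicits.

Lemma measurable_ucube (R : realType) : measurable (ucube R).
Proof. by apply: measurableX => //; apply: measurableX. Qed.

Lemma leb3_box (R : realType) (A B C : set (measurableTypeR R)) :
  measurable A -> measurable B -> measurable C ->
  leb3 R ((A `*` B) `*` C) = (lebesgue_measure A * lebesgue_measure B * lebesgue_measure C)%E.
Proof.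
move=> mA mB mC; rewrite -[(lebesgue_measure A * _)%E](product_measure1E lebesgue_measure)//.
by apply: (product_measure1E (leb2 R)) => //; exact: measurableX.
Qed.

Lemma leb3_ucube (R : realType) : leb3 R (ucube R) = 1%E.
Proof.
rewrite leb3_box// lebesgue_measure_itv/= lte01 ?oppr0 /= ?adde0 ?sube0 !mule1//.
Qed.

(** * From translation bounds to a cubic bound *)

Definition band (R : realType) (u : R3 R -> R) (j : nat) : set (M3 R) :=
  [set x : M3 R | 4^-1 ^+ j <= `|u x| < 4 * 4^-1 ^+ j].

Lemma measurable_band (R : realType) (u : R3 R -> R) (j : nat) :
  mfun3 u -> measurable (band u j).
Proof.
move=> mu; have mn : measurable_fun [set: M3 R] (fun x : M3 R => `|u x|).
  exact: (measurableT_comp (@normr_measurable R setT) mu).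
rewrite (_ : band u j = (fun x : M3 R => `|u x|) @^-1` `[4^-1 ^+ j, 4 * 4^-1 ^+ j[%classic).
  by rewrite -[X in measurable X]setTI; exact: mn.
by apply/seteqP; split => x; rewrite /band /= in_itv.
Qed.

Lemma trivIset_band (R : realType) (u : R3 R -> R) : trivIset setT (band u).
Proof.
apply/trivIsetP => i j _ _; wlog : i j / (i < j)%N => [H|ij _].
  by rewrite neq_ltn => /orP[ij|ji]; [|rewrite setIC]; apply: H; rewrite // ltn_eqF.
rewrite -subset0 => x [] /= /andP[ix _] /andP[_ xj].
have := le_lt_trans ix xj; rewrite ltNge => /negP; apply.
rewrite -(subnKC ij) exprD exprS !mulrA mulfV ?mul1r//.
by rewrite ler_piMr// ?exprn_ge0// exprn_ile1// invf_le1// ler1n.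
Qed.

Lemma bigcup_band (R : realType) (u : R3 R -> R) :
  [set x : M3 R | 0 < `|u x| < 4] `<=` \bigcup_j band u j.
Proof.
move=> x /= /andP[v0 v4].
have [m hm] : exists m, 4^-1 ^+ m <= `|u x|.
  have /cvgrPdist_lt /(_ _ v0) [m _ hm] : (4^-1 ^+ n : R) @[n --> \oo] --> (0:R).
    by apply: cvg_expr; rewrite ger0_norm// invf_lt1// ltr1n.
  exists m; apply/ltW; move: (hm m (leqnn m)) => /=.
  by rewrite sub0r normrN ger0_norm// exprn_ge0.
have ex : exists m, (4^-1 ^+ m <= `|u x|) by exists m.
case: (ex_minnP ex) => -[|k] hk kmin; [exists 0%N => //|exists k.+1 => //].
  by rewrite /band /= hk expr0 mulr1.
rewrite /band /= hk /= exprS mulrA mulfV// mul1r ltNge; apply/negP => /kmin.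
by rewrite ltnn.
Qed.

Lemma measurable_comp3 (R : realType) d (T : measurableType d) (f : T -> M3 R) (u : R3 R -> R) :
  mfun3 u -> measurable_fun setT f -> measurable_fun setT (fun x => u (f x)).
Proof. by move=> mu mf; exact: (measurableT_comp mu mf). Qed.

Lemma measurable_fun_aff3 (R : realType) d (T : measurableType d) (l : R) (f g : T -> M3 R) :
  measurable_fun setT f -> measurable_fun setT g ->
  measurable_fun setT (fun x => aff3 l (f x) (g x)).
Proof.
move=> mf mg; apply/measurable_fun_pair => /=; [apply/measurable_fun_pair => /=|].
- by apply: measurable_funD; [apply: measurable_funM; [exact: measurable_cst|exact: measurable_fun_coord1 mg]|exact: measurable_fun_coord1 mf].
- by apply: measurable_funD; [apply: measurable_funM; [exact: measurable_cst|exact: measurable_fun_coord2 mg]|exact: measurable_fun_coord2 mf].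
- by apply: measurable_funD; [apply: measurable_funM; [exact: measurable_cst|exact: measurable_fun_coord3 mg]|exact: measurable_fun_coord3 mf].
Qed.

Definition shift_energy (R : realType) (w : R3 R -> R) (z : R3 R) : \bar R :=
  (\int[leb3 R]_x ((w (x + z) - w x) ^+ 2)%:E)%E.

Lemma shift_energy_ge0 (R : realType) (w : R3 R -> R) z : (0 <= shift_energy w z)%E.
Proof. by apply: integral_ge0 => x _; rewrite lee_fin sqr_ge0. Qed.

Lemma measurable_sqr_diff (R : realType) d (T : measurableType d) (w : R3 R -> R) (f g : T -> M3 R) :
  mfun3 w -> measurable_fun setT f -> measurable_fun setT g ->
  measurable_fun setT (fun x => ((w (f x) - w (g x)) ^+ 2)%:E).
Proof.
move=> mw mf mg; apply/measurable_EFinP/measurable_funX/measurable_funB; exact: measurable_comp3.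
Qed.

(** Translate the second difference, then use (a + b)^2 <= 2 a^2 + 2 b^2. *)
Lemma shift_energyD (R : realType) (w : R3 R -> R) (y z : R3 R) : mfun3 w ->
  (shift_energy w (y + z)%R <= 2%:E * shift_energy w y + 2%:E * shift_energy w z)%E.
Proof.
move=> mw.
have ms (b : R3 R) : measurable_fun [set: M3 R] ((fun x : R3 R => x + b) : M3 R -> M3 R).
  exact: measurable_shift.
have m1 : mfun3 (fun x : R3 R => ((w (x + y) - w x) ^+ 2)%:E).
  by apply: measurable_sqr_diff => //; exact: measurable_id.
have m2 : mfun3 (fun x : R3 R => ((w (x + z) - w x) ^+ 2)%:E).
  by apply: measurable_sqr_diff => //; exact: measurable_id.
have m3 : mfun3 (fun x : R3 R => ((w (x + y + z) - w (x + y)) ^+ 2)%:E).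
  by apply: measurable_sqr_diff => //; exact: (measurableT_comp (ms z) (ms y)).
have m4 : mfun3 (fun x : R3 R => ((w (x + (y + z)) - w x) ^+ 2)%:E).
  by apply: measurable_sqr_diff => //; exact: measurable_id.
have -> : shift_energy w z = (\int[leb3 R]_x ((w (x + y + z)%R - w (x + y)%R) ^+ 2)%:E)%E.
  by apply/esym/(@ge0_integral_shift R y (fun x : R3 R => ((w (x + z) - w x) ^+ 2)%:E)) => // x; rewrite lee_fin sqr_ge0.
rewrite -(@ge0_integral_comb _ _ _ (leb3 R) setT 2 2 _ _ measurableT (ler0n _ _) (ler0n _ _) m1 m3); last 2 first.
- by move=> x; rewrite lee_fin sqr_ge0.
- by move=> x; rewrite lee_fin sqr_ge0.
apply: ge0_le_integral => //.
- by move=> x _; rewrite lee_fin sqr_ge0.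
- by apply: emeasurable_funD; exact: measurable_funeM.
move=> x _; rewrite addrA -!EFinM -EFinD lee_fin.
move: (w (x + y + z)) (w (x + y)) (w x) => a b c.
by have := sqr_ge0 (a - b - (b - c)); lra.
Qed.

Lemma shift_energy_pow2 (R : realType) (w : R3 R -> R) (j : nat) (s : R3 R) : mfun3 w ->
  (shift_energy w (aff3 (2 ^+ j)%R 0%R s) <= (4 ^+ j)%:E * shift_energy w s)%E.
Proof.
move=> mw; elim: j => [|j IH]; first by rewrite !expr0 aff3_1 addr0 mul1e.
have -> : aff3 (2 ^+ j.+1) 0 s = (aff3 (2 ^+ j) 0 s : R3 R) + aff3 (2 ^+ j) 0 s.
  rewrite /aff3 /aff2 /aff1 /= exprS !addr0.
  by congr (_, _, _) => /=; rewrite mulrDl mul1r mulrDl.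
apply: (le_trans (shift_energyD _ _ mw)).
rewrite -ge0_muleDl// -EFinD (_ : 2 + 2 = 4); last by ring.
rewrite exprS EFinM -muleA lee_pmul2l//.
Qed.

Lemma enorm_aff3 (R : realType) (l : R) (x s : R3 R) : 0 <= l ->
  enorm (x - aff3 l x s) = l * enorm s.
Proof.
move=> l0; rewrite /enorm (_ : _ + _ = l ^+ 2 * (s.1.1 ^+ 2 + s.1.2 ^+ 2 + s.2 ^+ 2)).
  by rewrite sqrtrM ?sqr_ge0// sqrtr_sqr ger0_norm.
by rewrite /aff3 /aff2 /aff1 /=; ring.
Qed.

Lemma enorm_ucube (R : realType) (s : R3 R) : ucube R s -> 0 < enorm s <= 2.
Proof.
case: s => [[a b] c] [[]] /=; rewrite !in_itv/= => /andP[a0 a1] /andP[b0 b1] /andP[c0 c1].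
rewrite /enorm /= sqrtr_gt0; apply/andP; split.
  by rewrite !addr_gt0// exprn_gt0.
rewrite -[leRHS]ger0_norm// -sqrtr_sqr ler_sqrt ?sqr_ge0//.
have sq1 (t : R) : 0 < t -> t <= 1 -> t ^+ 2 <= 1 by move=> t0 t1; rewrite exprn_ile1// ltW.
by have := sq1 _ a0 a1; have := sq1 _ b0 b1; have := sq1 _ c0 c1; lra.
Qed.

Lemma measurable_wband (R : realType) (j : nat) (u : R3 R -> R) :
  mfun3 u -> mfun3 (fun x => wband j `|u x|).
Proof.
move=> mu; have mn : mfun3 (fun x => `|u x|).
  exact: (measurableT_comp (@normr_measurable R setT) mu).
by apply: measurable_funB; apply: measurable_maxr.
Qed.

(** Change of variables y = x + 2^j s. The Jacobian 2^(3j) against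
    1 / |x - y| >= 1 / (2 * 2^j) leaves the factor 4^j. *)
Lemma cube_near_le (R : realType) (j : nat) (u : R3 R -> R) (x : R3 R) : mfun3 u ->
  (\int[leb3 R]_(s in ucube R) (4 ^+ j * (u x ^+ 2 * u (aff3 (2 ^+ j) x s) ^+ 2))%:E
    <= 2%:E * potential u x)%E.
Proof.
move=> mu.
have l0 : 0 < (2 ^+ j : R) by rewrite exprn_gt0.
have mK : mfun3 (fun y : R3 R => coulomb_integrand u (x, y)).
  by apply: (measurableT_comp (measurable_coulomb_integrand mu)); exact: measurable_pair1.
have md : measurable_fun [set: M3 R] (aff3 (2 ^+ j : R) x) by exact: measurable_aff3.
have c0 : 0 <= 2 * (2 ^+ j) ^+ 3 :> R by rewrite mulr_ge0// exprn_ge0// ltW.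
have -> : (2%:E * potential u x = \int[leb3 R]_s ((2 * (2 ^+ j) ^+ 3)%:E * coulomb_integrand u (x, aff3 (2 ^+ j) x s)))%E.
  rewrite ge0_integralZl_EFin//; last 2 first.
  - by move=> s _; exact: coulomb_integrand_ge0.
  - exact: (measurableT_comp mK md).
  rewrite (@ge0_integral_aff3 R _ x (fun y : M3 R => coulomb_integrand u (x, y)))//; last first.
    by move=> y; exact: coulomb_integrand_ge0.
  by rewrite muleA -EFinM -mulrA mulfV ?mulr1// gt_eqF// exprn_gt0.
have mG : mfun3 (fun s : R3 R => ((2 * (2 ^+ j) ^+ 3)%:E * coulomb_integrand u (x, aff3 (2 ^+ j) x s))%E).
  by apply: measurable_funeM; exact: (measurableT_comp mK md).
have G0 s : (0 <= (2 * (2 ^+ j) ^+ 3)%:E * coulomb_integrand u (x, aff3 (2 ^+ j) x s))%E.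
  by rewrite mule_ge0// coulomb_integrand_ge0.
apply: (le_trans _ (ge0_subset_integral (leb3 R) (@measurable_ucube R) measurableT mG (fun s _ => G0 s) (@subsetT _ _))).
apply: ge0_le_integral => //.
- exact: measurable_ucube.
- by move=> s _; rewrite lee_fin; apply: mulr_ge0; [rewrite exprn_ge0|rewrite mulr_ge0 ?sqr_ge0].
- apply: measurable_funTS; apply/measurable_EFinP.
  apply: measurable_funM; first exact: measurable_cst.
  apply: measurable_funM; first exact: measurable_cst.
  by apply: measurable_funX; exact: (measurableT_comp mu md).
- by apply: measurable_funTS.
move=> s /enorm_ucube /andP[s0 s2].
rewrite /coulomb_integrand -EFinM lee_fin /= (enorm_aff3 _ _ (ltW l0)).
(* 4^j = (2^j)^2 <= 2 (2^j)^3 / (2^j |s|), since |s| <= 2 on the unit cube *)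
set K := u x ^+ 2 * _; have K0 : 0 <= K by rewrite mulr_ge0 ?sqr_ge0.
rewrite [X in _ <= X](_ : _ = K * (4 ^+ j * (2 / enorm s))); last first.
  rewrite (_ : (4 ^+ j : R) = (2 ^+ j) ^+ 2); last by rewrite -exprM mulnC exprM; congr (_ ^+ _); ring.
  by field; rewrite !gt_eqF.
rewrite mulrC ler_wpM2l// ler_peMr ?exprn_ge0//.
by rewrite ler_pdivlMr// mul1r.
Qed.

Lemma measurable_shift_energy (R : realType) (w : R3 R -> R) :
  mfun3 w -> mfun3 (shift_energy w).
Proof.
move=> mw.
apply: (@measurable_fun_fubini_tonelli_F _ _ _ _ R (leb3 R) (fun z : M3 R * M3 R => ((w ((z.2 : R3 R) + z.1) - w z.2) ^+ 2)%:E)).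
  apply: (@measurable_sqr_diff R _ _ w (fun z : M3 R * M3 R => (z.2 : R3 R) + z.1) (fun z => z.2)) => //.
    by apply: measurable_add3; [exact: measurable_snd|exact: measurable_fst].
  exact: measurable_snd.
by move=> z; rewrite lee_fin sqr_ge0.
Qed.

(** After Fubini, the dilation by 2^j costs 4^j by [shift_energy_pow2], which the
    prefactor 4^-j cancels. *)
Lemma cube_far_le (R : realType) (j : nat) (w : R3 R -> R) : mfun3 w ->
  (\int[leb3 R]_x \int[leb3 R]_(s in ucube R) (4^-1 ^+ j * (w (aff3 (2 ^+ j) x s) - w x) ^+ 2)%:E
    <= \int[leb3 R]_(s in ucube R) shift_energy w s)%E.
Proof.
move=> mw.
have q0 : 0 <= (4^-1 ^+ j : R) by rewrite exprn_ge0.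
pose F (z : M3 R * M3 R) : \bar R := (4^-1 ^+ j * (w (aff3 (2 ^+ j) z.1 z.2) - w z.1) ^+ 2 * \1_(ucube R) z.2)%:E.
have F0 z : (0 <= F z)%E.
  by rewrite lee_fin indicE; apply: mulr_ge0 => //; apply: mulr_ge0 => //; exact: sqr_ge0.
have mF : measurable_fun setT F.
  apply/measurable_EFinP; apply: measurable_funM; last first.
    apply: (measurableT_comp _ measurable_snd).
    by apply: measurable_indic; exact: measurable_ucube.
  apply: measurable_funM; first exact: measurable_cst.
  apply: measurable_funX; apply: measurable_funB; apply: (measurable_comp3 mw).
    by apply: measurable_fun_aff3; [exact: measurable_fst|exact: measurable_snd].
  exact: measurable_fst.
have mS := measurable_shift_energy mw.
have -> : (\int[leb3 R]_x \int[leb3 R]_(s in ucube R) (4^-1 ^+ j * (w (aff3 (2 ^+ j) x s) - w x) ^+ 2)%:E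
   = \int[leb3 R]_x \int[leb3 R]_s F (x, s))%E.
  by apply: eq_integral => x _; rewrite integral_mkcond epatch_indic; apply: eq_integral => s _; rewrite /F -EFinM.
rewrite (@fubini_tonelli _ _ _ _ R (leb3 R) (leb3 R) F mF F0).
rewrite [leRHS]integral_mkcond epatch_indic.
apply: ge0_le_integral => //.
- by move=> s _; apply: integral_ge0 => x _.
- exact: (@measurable_fun_fubini_tonelli_G _ _ _ _ R (leb3 R) _ mF F0).
- apply: emeasurable_funM; first exact: mS.
  by apply/measurable_EFinP; apply: measurable_indic; exact: measurable_ucube.
move=> s _; rewrite /F /= indicE.
have [sC|sC] := boolP (s \in ucube R); last first.
  by rewrite mule0; under eq_integral do rewrite mulr0; rewrite integral0.
rewrite mule1; under eq_integral do rewrite mulr1 EFinM.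
rewrite ge0_integralZl_EFin//; last 2 first.
- by move=> x _; rewrite lee_fin sqr_ge0.
- apply: (@measurable_sqr_diff R _ _ w (fun x : M3 R => aff3 (2 ^+ j) x s) id) => //.
  by apply: measurable_fun_aff3; [exact: measurable_id|exact: measurable_cst].
have -> : (\int[leb3 R]_x ((w (aff3 (2 ^+ j) x s) - w x) ^+ 2)%:E = shift_energy w (aff3 (2 ^+ j) 0%R s))%E.
  apply: eq_integral => x _; congr ((w _ - _) ^+ 2)%:E.
  by rewrite /aff3 /aff2 /aff1 /= !addr0; case: x => [[x1 x2] x3]; congr (_, _, _); rewrite addrC.
apply: (le_trans (lee_wpmul2l _ (shift_energy_pow2 j s mw))); first by rewrite lee_fin.
by rewrite muleA -EFinM -exprMn mulVf ?expr1n ?mul1e.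
Qed.

Lemma sum_shift_energy_band (R : realType) (u : R3 R -> R) (s : R3 R) : mfun3 u ->
  (\sum_(0 <= j <oo) shift_energy (fun x => wband j `|u x|) s <= shift_energy u s)%E.
Proof.
move=> mu.
have mg : measurable_fun [set: M3 R] ((fun x : R3 R => x + s) : M3 R -> M3 R) by exact: measurable_shift.
rewrite -integral_nneseries//; last 2 first.
- move=> j; apply: (@measurable_sqr_diff R _ _ (fun x => wband j `|u x|) (fun x : M3 R => (x : R3 R) + s) id) => //.
  exact: measurable_wband.
- by move=> j x _; rewrite lee_fin sqr_ge0.
apply: ge0_le_integral => //.
- by move=> x _; apply: nneseries_ge0 => j _ _; rewrite lee_fin sqr_ge0.
- apply: ge0_emeasurable_sum => [j x _ _|j _]; first by rewrite lee_fin sqr_ge0.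
  apply: (@measurable_sqr_diff R _ _ (fun x => wband j `|u x|) (fun x : M3 R => (x : R3 R) + s) id) => //.
  exact: measurable_wband.
- by apply: measurable_sqr_diff => //; exact: measurable_id.
move=> x _; apply: lime_le.
  by apply: is_cvg_nneseries => j _ _; rewrite lee_fin sqr_ge0.
apply: nearW => n; rewrite sumEFin lee_fin big_mkord.
apply: (le_trans (sum_sqr_wband _ _ _)).
rewrite -real_normK ?num_real// -[leRHS]real_normK ?num_real//.
by rewrite ler_sqr ?nnegrE// ler_dist_dist.
Qed.

(** [band_cube_le] integrated in x over the band and in s over the unit cube. *)
Lemma integral_band_cube (R : realType) : exists2 c : R, 0 <= c &
  forall (j : nat) (u : R3 R -> R), mfun3 u ->
  (\int[leb3 R]_(x in band u j) (`|u x| ^+ 3)%:E <=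
    (c * 2)%:E * \int[leb3 R]_(x in band u j) potential u x +
    c%:E * \int[leb3 R]_(s in ucube R) shift_energy (fun x => wband j `|u x|) s)%E.
Proof.
have [c c0 hc] := band_cube_le R; exists c => // j u mu.
have k0 : 0 <= c * 2 by rewrite mulr_ge0.
have mn : mfun3 (fun x => `|u x|) by exact: (measurableT_comp (@normr_measurable R setT) mu).
pose w (x : R3 R) := wband j `|u x|.
have mw : mfun3 w by exact: measurable_wband.
have q0 : 0 <= (4^-1 ^+ j : R) by rewrite exprn_ge0.
have mP := measurable_potential mu.
pose T2 (x : R3 R) := (\int[leb3 R]_(s in ucube R) (4^-1 ^+ j * (w (aff3 (2 ^+ j) x s) - w x) ^+ 2)%:E)%E.
have T20 x : (0 <= T2 x)%E by apply: integral_ge0 => s _; rewrite lee_fin mulr_ge0// sqr_ge0.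
have mT2 : mfun3 T2.
  pose F (z : M3 R * M3 R) : \bar R := (4^-1 ^+ j * (w (aff3 (2 ^+ j) z.1 z.2) - w z.1) ^+ 2 * \1_(ucube R) z.2)%:E.
  have F0 z : (0 <= F z)%E.
    by rewrite lee_fin indicE; apply: mulr_ge0 => //; apply: mulr_ge0 => //; exact: sqr_ge0.
  have mF : measurable_fun setT F.
    apply/measurable_EFinP; apply: measurable_funM; last first.
      apply: (measurableT_comp _ measurable_snd).
      by apply: measurable_indic; exact: measurable_ucube.
    apply: measurable_funM; first exact: measurable_cst.
    apply: measurable_funX; apply: measurable_funB; apply: (measurable_comp3 mw).
      by apply: measurable_fun_aff3; [exact: measurable_fst|exact: measurable_snd].
    exact: measurable_fst.
  have := @measurable_fun_fubini_tonelli_F _ _ _ _ R (leb3 R) _ mF F0.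
  apply: eq_measurable_fun => x _.
  by rewrite /T2 integral_mkcond epatch_indic; apply: eq_integral => s _; rewrite /F -EFinM.
have pt x : band u j x -> ((`|u x| ^+ 3)%:E <= (c * 2)%:E * potential u x + c%:E * T2 x)%E.
  move=> /andP[bx xb].
  have md : measurable_fun [set: M3 R] (aff3 (2 ^+ j : R) x) by exact: measurable_aff3.
  have m1 : mfun3 (fun s : R3 R => (4 ^+ j * (u x ^+ 2 * u (aff3 (2 ^+ j) x s) ^+ 2))%:E).
    apply/measurable_EFinP; apply: measurable_funM; first exact: measurable_cst.
    apply: measurable_funM; first exact: measurable_cst.
    by apply: measurable_funX; exact: (measurableT_comp mu md).
  have m2 : mfun3 (fun s : R3 R => (4^-1 ^+ j * (w (aff3 (2 ^+ j) x s) - w x) ^+ 2)%:E).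
    apply/measurable_EFinP; apply: measurable_funM; first exact: measurable_cst.
    by apply/measurable_funX/measurable_funB => //; exact: (measurableT_comp mw md).
  have p1 s : (0 <= (4 ^+ j * (u x ^+ 2 * u (aff3 (2 ^+ j) x s) ^+ 2))%:E)%E.
    by rewrite lee_fin; apply: mulr_ge0; [rewrite exprn_ge0|rewrite mulr_ge0 ?sqr_ge0].
  have p2 s : (0 <= (4^-1 ^+ j * (w (aff3 (2 ^+ j) x s) - w x) ^+ 2)%:E)%E.
    by rewrite lee_fin mulr_ge0// sqr_ge0.
  have -> : ((`|u x| ^+ 3)%:E = \int[leb3 R]_(s in ucube R) (`|u x| ^+ 3)%:E)%E.
    by rewrite -[LHS]mule1 -leb3_ucube -integral_cst//; exact: measurable_ucube.
  have := @ge0_integral_comb _ _ _ (leb3 R) (ucube R) c c _ _ (@measurable_ucube R) c0 c0 m1 m2 p1 p2.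
  set f1 := (fun s : R3 R => (4 ^+ j * _)%:E); set f2 := (fun s : R3 R => (4^-1 ^+ j * _)%:E) => E12.
  apply: (@le_trans _ _ (\int[leb3 R]_(s in ucube R) (c%:E * f1 s + c%:E * f2 s))%E).
    apply: ge0_le_integral.
    - exact: measurable_ucube.
    - by move=> s _; rewrite lee_fin exprn_ge0.
    - exact: measurable_cst.
    - by apply: measurable_funTS; apply: emeasurable_funD; apply: measurable_funeM.
    move=> s _; rewrite -!EFinM -EFinD lee_fin -mulrDr.
    rewrite -(real_normK (num_real (u x))) -(real_normK (num_real (u (aff3 _ _ _)))).
    exact: hc.
  rewrite E12.
  apply: leeD => //.
  apply: (le_trans (lee_wpmul2l _ (cube_near_le j x mu))); first by rewrite lee_fin.
  by rewrite muleA -EFinM.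
have mb := measurable_band j mu.
apply: (@le_trans _ _ (\int[leb3 R]_(x in band u j) ((c * 2)%:E * potential u x + c%:E * T2 x))%E).
  apply: ge0_le_integral.
  - exact: mb.
  - by move=> x _; rewrite lee_fin exprn_ge0.
  - by apply: measurable_funTS; apply/measurable_EFinP/measurable_funX.
  - by apply: measurable_funTS; apply: emeasurable_funD; exact: measurable_funeM.
  - exact: pt.
rewrite (ge0_integral_comb _ mb k0 c0 mP mT2 (@potential_ge0 R u) T20).
apply: leeD; first exact: lexx.
apply: lee_wpmul2l; first by rewrite lee_fin.
apply: (le_trans _ (cube_far_le j mw)).
apply: (ge0_subset_integral (leb3 R) mb measurableT mT2); last exact: subsetT.
by move=> x _; exact: T20.
Qed.

(** Summing over the bands covers the points where 0 < |u| < 4; elsewhere |u|^3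
    is at most |u|^6. *)
Lemma integral_cube_lty (R : realType) (u : R3 R -> R) (B : R) : mfun3 u ->
  (coulomb_energy u < +oo)%E ->
  (forall s, ucube R s -> (shift_energy u s <= B%:E)%E) ->
  (\int[leb3 R]_x (`|u x| ^+ 6)%:E < +oo)%E ->
  (\int[leb3 R]_x (`|u x| ^+ 3)%:E < +oo)%E.
Proof.
move=> mu fD hB h6.
have [c c0 hc] := integral_band_cube R.
have c20 : 0 <= c * 2 by rewrite mulr_ge0.
have mn : mfun3 (fun x => `|u x|) by exact: (measurableT_comp (@normr_measurable R setT) mu).
have mX n : mfun3 (fun x => (`|u x| ^+ n)%:E) by apply/measurable_EFinP/measurable_funX.
pose U := \bigcup_j band u j.
have mU : measurable U by apply: bigcup_measurable => j _; exact: measurable_band.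
have mSj j : mfun3 (shift_energy (fun x => wband j `|u x|)).
  by apply: measurable_shift_energy; exact: measurable_wband.
have mS : mfun3 (fun s : R3 R => (\sum_(0 <= j <oo) shift_energy (fun x => wband j `|u x|) s)%E).
  by apply: ge0_emeasurable_sum => [j x _ _|j _]; [exact: shift_energy_ge0|exact: mSj].
have bU : (\int[leb3 R]_(x in U) (`|u x| ^+ 3)%:E <= (c * 2)%:E * coulomb_energy u + c%:E * B%:E)%E.
  rewrite ge0_integral_bigcup//; last 3 first.
  - by move=> j; exact: measurable_band.
  - by apply: measurable_funTS.
  - exact: trivIset_band.
  apply: (@le_trans _ _ (\sum_(0 <= j <oo) ((c * 2)%:E * \int[leb3 R]_(x in band u j) potential u x +
    c%:E * \int[leb3 R]_(s in ucube R) shift_energy (fun x => wband j `|u x|) s))%E).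
    apply: lee_nneseries => [j _ _|j _]; last exact: hc.
    by apply: integral_ge0 => x _; rewrite lee_fin exprn_ge0.
  have p1 j : (0 <= \int[leb3 R]_(x in band u j) potential u x)%E.
    by apply: integral_ge0 => x _; exact: potential_ge0.
  have p2 j : (0 <= \int[leb3 R]_(s in ucube R) shift_energy (fun x => wband j `|u x|) s)%E.
    by apply: integral_ge0 => x _; exact: shift_energy_ge0.
  rewrite (nneseries_comb c20 c0 p1 p2).
  apply: leeD; (apply: lee_wpmul2l; first by rewrite lee_fin).
    rewrite -ge0_integral_bigcup//; last 4 first.
    - by move=> j; exact: measurable_band.
    - by apply: measurable_funTS; exact: measurable_potential.
    - by move=> x _; exact: potential_ge0.
    - exact: trivIset_band.
    apply: ge0_subset_integral => //; first exact: measurable_potential.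
    by move=> x _; exact: potential_ge0.
  rewrite -integral_nneseries; last 3 first.
  - exact: measurable_ucube.
  - by move=> j; apply: measurable_funTS.
  - by move=> j s _; exact: shift_energy_ge0.
  rewrite -[leRHS]mule1 -leb3_ucube -integral_cst; last exact: measurable_ucube.
  apply: ge0_le_integral; first exact: measurable_ucube.
  - by move=> s _; apply: nneseries_ge0 => j _ _; exact: shift_energy_ge0.
  - by apply: measurable_funTS.
  - exact: measurable_cst.
  by move=> s Cs; apply: (le_trans (sum_shift_energy_band s mu)); exact: hB.
apply: (@le_lt_trans _ _ (\int[leb3 R]_(x in U) (`|u x| ^+ 3)%:E + \int[leb3 R]_x (`|u x| ^+ 6)%:E)%E); last first.
  rewrite lte_add_pinfty//; apply: (le_lt_trans bU).
  apply: lte_add_pinfty; last by rewrite -EFinM ltry.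
  by apply: lte_mul_pinfty; rewrite ?lee_fin.
rewrite [X in (_ <= X + _)%E]integral_mkcond -ge0_integralD//; last 2 first.
- by move=> x _; rewrite patchE; case: ifP => // _; rewrite lee_fin exprn_ge0.
- by apply/(measurable_restrictT _ _).1 => //; apply: measurable_funTS.
apply: ge0_le_integral => //.
- apply: emeasurable_funD => //.
  by apply/(measurable_restrictT _ _).1 => //; apply: measurable_funTS.
move=> x _; rewrite patchE; case: ifPn => [_|xU].
  by rewrite leeDl// lee_fin exprn_ge0.
rewrite add0e lee_fin.
have [u0|u0] := eqVneq (u x) 0; first by rewrite u0 normr0 !expr0n.
have v0 : 0 < `|u x| by rewrite normr_gt0.
have [v4|v4] := ltP `|u x| 4.
  move: xU; rewrite notin_setE => xU; exfalso; apply: xU.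
  by apply: bigcup_band => /=; rewrite v0 v4.
rewrite (_ : 6 = 3 + 3)%N// exprD ler_peMr ?exprn_ge0// exprn_ege1//; lra.
Qed.

(** * Smooth bumps *)

Lemma is_derive_cvgP (R : realType) (V W : normedModType R) (f : V -> W) (a v : V) (df : W) :
  is_derive a v f df <->
  (h^-1 *: (f (h *: v + a) - f a) @[h --> (0:R)^'] --> df).
Proof.
split=> [[cf <-]|h]; first exact: cf.
have cf : derivable f a v by apply/cvg_ex; exists df.
apply: (DeriveDef cf); apply/cvg_lim => //; exact: norm_hausdorff.
Qed.

(** The functions x^-k e^(-1/x), extended by 0 to the left: a family whose
    derivatives at 0 vanish and that is stable, up to linear combinations, under
    differentiation. *)
Definition flat (R : realType) (k : nat) (x : R) : R :=
  if 0 < x then x^-1 ^+ k * expR (- x^-1) else 0.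

Lemma flat_ge0 (R : realType) (k : nat) (x : R) : 0 <= flat k x.
Proof.
rewrite /flat; case: ifP => // x0.
by rewrite mulr_ge0 ?expR_ge0// exprn_ge0// invr_ge0 ltW.
Qed.

(** Quadratic vanishing at 0, from the term of order k + 2 of the exponential
    series at 1/x. *)
Lemma flat_le_sqr (R : realType) (k : nat) (x : R) : flat k x <= (k.+2)`!%:R * x ^+ 2.
Proof.
rewrite /flat; case: ifPn => [x0|_]; last by rewrite mulr_ge0 ?sqr_ge0.
have fp : 0 < (k.+2)`!%:R :> R by rewrite ltr0n fact_gt0.
have : x^-1 ^+ k.+2 / (k.+2)`!%:R <= expR x^-1.
  apply: (le_trans _ (expR_ge1Dxn k.+1 _)); last by rewrite invr_ge0 ltW.
  by rewrite lerDr.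
move=> h; rewrite expRN ler_pdivrMr ?expR_gt0//.
apply: (le_trans _ (ler_wpM2l _ h)); last by rewrite mulr_ge0 ?sqr_ge0.
rewrite le_eqVlt; apply/orP; left; apply/eqP.
move: (_`!%:R) fp => F fp.
by rewrite (exprS _ k.+1) (exprS _ k); field; rewrite !gt_eqF.
Qed.

Lemma is_derive_flat (R : realType) (k : nat) (x : R) :
  is_derive x (1:R) (flat k) (flat k.+2 x - k%:R * flat k.+1 x).
Proof.
have [x0|x0|->] := ltgtP x 0.
- rewrite /flat ltNge (ltW x0)/= mulr0 subr0.
  apply: (@near_eq_is_derive _ _ _ (cst 0)).
  near=> y; rewrite /= ltNge ltW//=; near: y; exact: lt_nbhsl.
- rewrite /flat x0.
  apply: (@near_eq_is_derive _ _ _ ((fun y : R => y^-1 ^+ k) * (fun y => expR (- y^-1)))).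
    near=> y; rewrite (_ : 0 < y)//; near: y; exact: lt_nbhsr.
  have xn0 : x != 0 by rewrite gt_eqF.
  have D0 : is_derive x 1 (fun y : R => y^-1) (- x ^- 2).
    have := @is_deriveV R id x 1 1 xn0 (is_derive_id _ _).
    by rewrite /GRing.scale/= mulr1.
  have D1 : is_derive x 1 (fun y : R => y^-1 ^+ k) (k%:R * x^-1 ^+ k.-1 * (- x ^- 2)).
    rewrite (_ : (fun y : R => y^-1 ^+ k) = (fun y : R => y^-1) ^+ k); last by rewrite exprfctE.
    exact: (is_deriveX k D0).
  have D2 : is_derive x 1 (fun y : R => expR (- y^-1)) (expR (- x^-1) * x ^- 2).
    have := @is_derive1_comp R expR (fun y => - y^-1) x _ _ (is_derive_expR (- x^-1)) (is_deriveN D0).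
    by rewrite opprK.
  apply: is_derive_eq; rewrite /GRing.scale/=.
  move: D1 D2 => _ _; rewrite (_ : x ^- 2 = x^-1 ^+ 2); last by rewrite exprVn.
  case: k => [|k] /=; first by rewrite !expr0; ring.
  by rewrite !exprS; ring.
- rewrite /flat ltxx mulr0 subr0; apply/is_derive_cvgP.
  rewrite ltxx; apply/cvgrPdist_le => /= e e0.
  have fp : 0 < (k.+2)`!%:R :> R by rewrite ltr0n fact_gt0.
  near=> h.
  have h0 : h != 0 by near: h; exact: nbhs_dnbhs_neq.
  rewrite sub0r normrN subr0 addr0 /GRing.scale/= mulr1 normrM normfV.
  rewrite ler_pdivrMl ?normr_gt0// -/(flat k h) ger0_norm ?flat_ge0//.
  apply: (le_trans (flat_le_sqr _ _)).
  rewrite -real_normK ?num_real// expr2 mulrA [leRHS]mulrC ler_pM2r ?normr_gt0//.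
  rewrite mulrC -ler_pdivlMr//; near: h.
  apply: dnbhs0_le; exact: divr_gt0.
Unshelve. all: by end_near.
Qed.

(** A syntactic class of smooth functions. Being closed under differentiation, it
    makes a product of three of them smooth by induction on the multi-index. *)
Inductive smooth1 (R : realType) : (R -> R) -> Prop :=
| smooth1_flat k : smooth1 (@flat R k)
| smooth1_add f g : smooth1 f -> smooth1 g -> smooth1 (fun x => f x + g x)
| smooth1_mul f g : smooth1 f -> smooth1 g -> smooth1 (fun x => f x * g x)
| smooth1_scale c f : smooth1 f -> smooth1 (fun x => c * f x)
| smooth1_aff a b f : smooth1 f -> smooth1 (fun x => f (a * x + b)).

Lemma smooth1_derive (R : realType) (f : R -> R) : smooth1 f ->
  exists2 f', smooth1 f' & forall x : R, is_derive x 1 f (f' x).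
Proof.
elim=> [k|{}f g _ [f' sf' df] _ [g' sg' dg]|{}f g sf [f' sf' df] sg [g' sg' dg]
  |c {}f _ [f' sf' df]|a b {}f _ [f' sf' df]].
- exists (fun x => flat k.+2 x + (- k%:R) * flat k.+1 x).
    apply: smooth1_add; first exact: smooth1_flat.
    by apply: smooth1_scale; exact: smooth1_flat.
  by move=> x; rewrite mulNr; exact: is_derive_flat.
- exists (fun x => f' x + g' x); first exact: smooth1_add.
  by move=> x; exact: is_deriveD.
- exists (fun x => f x * g' x + g x * f' x).
    by apply: smooth1_add; apply: smooth1_mul.
  by move=> x; exact: is_deriveM.
- exists (fun x => c * f' x); first exact: smooth1_scale.
  by move=> x; exact: is_deriveZ.
- exists (fun x => a * f' (a * x + b)).
    by apply: smooth1_scale; exact: smooth1_aff.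
  move=> x; rewrite mulrC.
  apply: (@is_derive1_comp R f (fun x => a * x + b)).
  apply/is_derive_cvgP; apply: cvg_near_cst; near=> h.
  rewrite /GRing.scale/= mulr1; field.
  by near: h; exact: nbhs_dnbhs_neq.
Unshelve. all: by end_near.
Qed.

Lemma smooth1_continuous (R : realType) (f : R -> R) : smooth1 f -> continuous f.
Proof.
move=> /smooth1_derive[f' _ df] x.
apply: differentiable_continuous; apply/derivable1_diffP; exact: ex_derive.
Qed.

(** * Tensor products as test functions *)

Definition coord (R : realType) (i : 'I_3) (x : R3 R) : R :=
  if i == 0%N :> nat then x.1.1 else if i == 1%N :> nat then x.1.2 else x.2.

Lemma coord_add_evec (R : realType) (i j : 'I_3) (h : R) (x : R3 R) :
  coord j (h *: evec R i + x) = (if j == i then h else 0) + coord j x.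
Proof.
case: i => [[|[|[|//]]] ?]; case: j => [[|[|[|//]]] ?];
 by rewrite /coord /evec /= /GRing.scale/= ?mulr1 ?mulr0.
Qed.

Lemma coord_continuous (R : realType) (i : 'I_3) : continuous (@coord R i).
Proof.
have c1 : continuous (fun x : R3 R => x.1.1).
  by move=> x; apply: (@cvg_comp _ _ _ fst fst); [exact: cvg_fst|exact: cvg_fst].
have c2 : continuous (fun x : R3 R => x.1.2).
  by move=> x; apply: (@cvg_comp _ _ _ fst snd); [exact: cvg_fst|exact: cvg_snd].
have c3 : continuous (fun x : R3 R => x.2) by move=> x; exact: cvg_snd.
by rewrite /coord; case: i => [[|[|[|//]]] ?].
Qed.

Definition prod3 (R : realType) (F : 'I_3 -> R -> R) (x : R3 R) : R :=
  \prod_i F i (coord i x).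

Definition upd3 (R : realType) (F : 'I_3 -> R -> R) (i : 'I_3) (g : R -> R) : 'I_3 -> R -> R :=
  fun j => if j == i then g else F j.

Lemma prod3_continuous (R : realType) (F : 'I_3 -> R -> R) :
  (forall i, continuous (F i)) -> continuous (prod3 F).
Proof.
move=> cF.
have -> : prod3 F = fun x => F ord0 (coord ord0 x) * (F (lift ord0 ord0) (coord (lift ord0 ord0) x) *
    F (lift ord0 (lift ord0 ord0)) (coord (lift ord0 (lift ord0 ord0)) x)).
  by apply/funext => x; rewrite /prod3 !big_ord_recl big_ord0 mulr1.
have cc i : continuous (fun y : R3 R => F i (coord i y)).
  by move=> y; apply: (@continuous_comp _ _ _ (coord i)); [exact: coord_continuous|exact: cF].
by move=> x; apply: cvgM; [exact: cc|apply: cvgM; exact: cc].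
Qed.

Lemma is_derive_prod3 (R : realType) (F : 'I_3 -> R -> R) (i : 'I_3) (g : R -> R) (x : R3 R) :
  (forall t : R, is_derive t (1:R) (F i) (g t)) ->
  is_derive x (evec R i) (prod3 F) (prod3 (upd3 F i g) x).
Proof.
move=> dF; apply/is_derive_cvgP.
pose P := \prod_(j | j != i) F j (coord j x).
have EP : prod3 (upd3 F i g) x = g (coord i x) * P.
  rewrite /prod3 (bigD1 i)//= /upd3 eqxx; congr (_ * _).
  by apply: eq_bigr => j /negPf ->.
have EF h : prod3 F (h *: evec R i + x) = F i (h + coord i x) * P.
  rewrite /prod3 (bigD1 i)//= coord_add_evec eqxx; congr (_ * _).
  by apply: eq_bigr => j /negPf jn; rewrite coord_add_evec jn add0r.
have EF0 : prod3 F x = F i (coord i x) * P by rewrite /prod3 (bigD1 i).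
have := dF (coord i x) => /is_derive_cvgP dFi.
have cP : P @[h --> (0:R)^'] --> P by exact: cvg_cst.
rewrite EP; apply: (cvg_trans _ (cvgM dFi cP)); apply: near_eq_cvg; near=> h.
by rewrite ?mulrfctE EF EF0 /GRing.scale /= mulr1; ring.
Unshelve. all: by end_near.
Qed.

Lemma smooth_prod3 (R : realType) (F : 'I_3 -> R -> R) :
  (forall i, smooth1 (F i)) -> smooth (prod3 F).
Proof.
move=> sF s.
have [F' sF' ->] : exists2 F', (forall i, smooth1 (F' i)) & foldr (@partial R) (prod3 F) s = prod3 F'.
  elim: s => [|i s [F' sF' IH]] /=; first by exists F.
  have [g sg dg] := smooth1_derive (sF' i).
  exists (upd3 F' i g); first by move=> j; rewrite /upd3; case: ifP.
  rewrite IH; apply/funext => x; rewrite /partial.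
  exact: (derive_val (is_derive := is_derive_prod3 x dg)).
split=> [|i x]; first by apply: prod3_continuous => i; exact: smooth1_continuous.
have [g sg dg] := smooth1_derive (sF' i).
exact: (ex_derive (is_derive := is_derive_prod3 x dg)).
Qed.

Definition cbox (R : realType) (a c : R3 R) : set (R3 R) :=
  (`[a.1.1, c.1.1]%classic `*` `[a.1.2, c.1.2]%classic) `*` `[a.2, c.2]%classic.

Lemma compact_cbox (R : realType) (a c : R3 R) : compact (cbox a c).
Proof. by apply: compact_setX; [apply: compact_setX|]; exact: segment_compact. Qed.

Lemma cboxP (R : realType) (a c x : R3 R) :
  cbox a c x <-> forall i, coord i a <= coord i x <= coord i c.
Proof.
split=> [[[/=]]|h].
  rewrite !in_itv/= => h1 h2 h3; case=> [[|[|[|//]]] ?]; by rewrite /coord.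
split; [split|] => /=; rewrite in_itv/=.
- exact: (h ord0).
- exact: (h (@Ordinal 3 1 isT)).
- exact: (h (@Ordinal 3 2 isT)).
Qed.

Lemma test_prod3 (R : realType) (F : 'I_3 -> R -> R) (a c : R3 R) :
  (forall i, smooth1 (F i)) ->
  (forall i t, F i t != 0 -> coord i a <= t <= coord i c) ->
  test_function (prod3 F).
Proof.
move=> sF suppF; split; first exact: smooth_prod3.
have sub : [set x | prod3 F x != 0] `<=` cbox a c.
  move=> x /= /prodf_neq0 h; apply/cboxP => i; apply: suppF; exact: h.
apply: (subclosed_compact (@closed_closure _ _) (@compact_cbox R a c)).
have cl : closed (cbox a c).
  by apply: compact_closed; [exact: norm_hausdorff|exact: compact_cbox].
by rewrite [X in _ `<=` X](closure_id _).1//; exact: closure_subset.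
Qed.

Lemma FTC_line (R : realType) (f f' : R -> R) (s : R) : 0 < s ->
  (forall x : R, is_derive x (1:R) f (f' x)) -> continuous f' ->
  (\int[lebesgue_measure]_(x in `[0%R, s]) (f' x)%:E = (f s - f 0)%:E)%E.
Proof.
move=> s0 df cf'.
have cf : continuous f.
  by move=> x; apply: differentiable_continuous; apply/derivable1_diffP; exact: (ex_derive (is_derive := df x)).
rewrite (@continuous_FTC2 R f' f 0 s s0)//.
- by apply: continuous_subspaceT.
- split.
  + by move=> x _; exact: (ex_derive (is_derive := df x)).
  + by apply: cvg_at_right_filter; exact: cf.
  + by apply: cvg_at_left_filter; exact: cf.
- by move=> x _; rewrite derive1E; exact: (derive_val (is_derive := df x)).
Qed.

(** * Boxes and the Borel sets of the space *)

(** The sets on which F integrates to 0 form a Dynkin system. *)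
Lemma integral_pi_system_ae0 d (T : measurableType d) (R : realType)
    (mu : {measure set T -> \bar R}) (G : set (set T)) (F : T -> \bar R) :
  measurable = <<s G >> -> setI_closed G -> mu.-integrable setT F ->
  (forall A, G A -> \int[mu]_(x in A) F x = 0)%E ->
  (\int[mu]_x F x = 0)%E -> ae_eq mu setT F (cst 0%E).
Proof.
move=> mG GI iF G0 FT.
have mGm A : G A -> measurable A by rewrite mG => GA; exact: sub_sigma_algebra.
have mF : measurable_fun setT F by exact: (measurable_int mu).
pose H : set (set T) := [set A | measurable A /\ (\int[mu]_(x in A) F x = 0)%E].
have dH : dynkin H.
  split.
  - by split.
  - move=> A [mA A0]; split; first exact: measurableC.
    have : (\int[mu]_(x in A `|` ~` A) F x = 0)%E by rewrite setUCr.
    rewrite integral_setU ?A0 ?add0e//; first exact: measurableC.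
      by apply: measurable_funTS.
    by rewrite disj_set2E setICr eqxx.
  - move=> A tA HA; split; first by apply: bigcup_measurable => k _; have [] := HA k.
    have mA k : measurable (A k) by have [] := HA k.
    rewrite integral_bigcup//; last first.
      by apply: (integrableS measurableT) => //; exact: bigcup_measurable.
    by apply: eseries0 => k _ _; have [] := HA k.
have sub : <<s G >> `<=` H.
  apply: lambda_system_subset => //; first exact/dynkin_lambda_system.
  by move=> A GA; split; [exact: mGm|exact: G0].
apply: integral_ae_eq => //.
move=> E _ mE; rewrite integral0.
by have [] := sub E; rewrite -?mG.
Qed.

Definition obox (R : realType) (a c : R3 R) : set (M3 R) :=
  (`]a.1.1, c.1.1[%classic `*` `]a.1.2, c.1.2[%classic) `*` `]a.2, c.2[%classic.

Definition oboxes (R : realType) : set (set (M3 R)) := [set A | exists a c : R3 R, A = obox a c].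
Arguments oboxes R : clear implicits.

Lemma oboxP (R : realType) (a c x : R3 R) :
  obox a c x <-> forall i, coord i a < coord i x < coord i c.
Proof.
split=> [[[/=]]|h].
  rewrite !in_itv/= => h1 h2 h3; case=> [[|[|[|//]]] ?]; by rewrite /coord.
split; [split|] => /=; rewrite in_itv/=.
- exact: (h ord0).
- exact: (h (@Ordinal 3 1 isT)).
- exact: (h (@Ordinal 3 2 isT)).
Qed.

Lemma measurable_obox (R : realType) (a c : R3 R) : measurable (obox a c).
Proof. by apply: measurableX => //; apply: measurableX. Qed.

Lemma measurable_cbox (R : realType) (a c : R3 R) : measurable (cbox a c : set (M3 R)).
Proof. by apply: measurableX => //; apply: measurableX. Qed.

Definition pmap3 (R : realType) (f : R -> R -> R) (x y : R3 R) : R3 R :=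
  (f x.1.1 y.1.1, f x.1.2 y.1.2, f x.2 y.2).

Lemma coord_pmap3 (R : realType) (f : R -> R -> R) (x y : R3 R) i :
  coord i (pmap3 f x y) = f (coord i x) (coord i y).
Proof. by rewrite /coord; case: i => [[|[|[|//]]] ?]. Qed.

Lemma oboxI (R : realType) (a c a' c' : R3 R) :
  obox a c `&` obox a' c' = obox (pmap3 Num.max a a') (pmap3 Num.min c c').
Proof.
apply/seteqP; split => x.
  move=> [/oboxP h /oboxP h']; apply/oboxP => i; rewrite !coord_pmap3.
  have /andP[h1 h2] := h i; have /andP[h3 h4] := h' i.
  by rewrite gt_max lt_min h1 h2 h3 h4.
move=> /oboxP h; split; apply/oboxP => i; have := h i; rewrite !coord_pmap3 gt_max lt_min.
  by move=> /andP[/andP[-> _] /andP[-> _]].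
by move=> /andP[/andP[_ ->] /andP[_ ->]].
Qed.

Lemma setI_closed_oboxes (R : realType) : setI_closed (oboxes R).
Proof. by move=> _ _ [a [c ->]] [a' [c' ->]]; rewrite oboxI; do 2 eexists. Qed.

Definition cst3 (R : realType) (r : R) : R3 R := (r, r, r).

Lemma coord_cst3 (R : realType) (r : R) i : coord i (cst3 r) = r.
Proof. by rewrite /coord; case: i => [[|[|[|//]]] ?]. Qed.

Lemma bigcup_obox (R : realType) : \bigcup_n obox (cst3 (- n%:R)) (cst3 n%:R) = [set: M3 R].
Proof.
apply/seteqP; split => // x _.
pose r := `|coord ord0 x| + `|coord (lift ord0 ord0) x| + `|coord (lift ord0 (lift ord0 ord0)) x|.
have rx i : `|coord i x| <= r.
  have h j := normr_ge0 (coord j x).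
  have := h ord0; have := h (lift ord0 ord0); have := h (lift ord0 (lift ord0 ord0)).
  rewrite /r; case: i => [[|[|[|//]]] iP] h1 h2 h3.
  - by rewrite (_ : Ordinal iP = ord0); [lra|exact: val_inj].
  - by rewrite (_ : Ordinal iP = lift ord0 ord0); [lra|exact: val_inj].
  - by rewrite (_ : Ordinal iP = lift ord0 (lift ord0 ord0)); [lra|exact: val_inj].
have [n hn] : exists n : nat, r < n%:R.
  by exists (Num.Def.archi_bound r); apply: archi_boundP; rewrite !addr_ge0.
exists n => //; apply/oboxP => i; rewrite !coord_cst3 -ltr_norml.
exact: (le_lt_trans (rx i)).
Qed.

(** A slab, where one coordinate lies in an open interval, is a countable union of
    boxes; the vector [cst3 1 - evec R i] widens the other two sides. *)
Lemma measurable_oboxes (R : realType) : @measurable _ (M3 R) = <<s oboxes R >>.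
Proof.
apply/seteqP; split; last first.
  apply: smallest_sub; first exact: sigma_algebra_measurable.
  by move=> _ [a [c ->]]; exact: measurable_obox.
pose T' := g_sigma_algebraType (oboxes R).
have mc (i : 'I_3) : measurable_fun [set: T'] ((fun x : M3 R => coord i x) : T' -> measurableTypeR R).
  apply: (measurability _ (RGenOpens.measurableE R)) => _ [_ [a [b ->] <-]].
  rewrite setTI (_ : _ @^-1` _ = \bigcup_n obox
    (- n%:R *: (cst3 1 - evec R i) + a *: evec R i) (n%:R *: (cst3 1 - evec R i) + b *: evec R i)).
    apply: bigcup_measurable => n _; apply: sub_sigma_algebra.
    by exists (- n%:R *: (cst3 1 - evec R i) + a *: evec R i), (n%:R *: (cst3 1 - evec R i) + b *: evec R i).
  have E (r s : R) j : coord j (r *: (cst3 1 - evec R i) + s *: evec R i) = if j == i then s else r.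
    rewrite /coord /cst3 /evec /=.
    case: i => [[|[|[|//]]] ?]; case: j => [[|[|[|//]]] ?];
      by rewrite /= /GRing.scale/= ?subrr ?subr0 ?mulr0 ?mulr1 ?add0r ?addr0.
  apply/seteqP; split => x /=.
    rewrite in_itv/= => xab.
    have : [set: M3 R] x by []. rewrite -bigcup_obox => -[n _ /oboxP hx].
    exists n => //; apply/oboxP => j; rewrite !E.
    by have := hx j; rewrite !coord_cst3; case: eqP => // ->.
  by move=> [n _ /oboxP/(_ i)]; rewrite !E eqxx in_itv.
have mid := measurable_fun_pair (measurable_fun_pair (mc ord0) (mc (@Ordinal 3 1 isT))) (mc (@Ordinal 3 2 isT)).
move=> A mA; have := mid measurableT _ mA; rewrite setTI.
by congr (measurable _); apply/seteqP; split => -[[x y] z].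
Qed.

(** * Topology and measurability *)

Lemma nbhs_obox (R : realType) (U : set (R3 R)) (x : R3 R) : nbhs x U ->
  exists2 e : R, 0 < e & forall y, (forall i, `|coord i x - coord i y| < e) -> U y.
Proof.
move=> /nbhs_ballP[e /= e0 he]; exists e => // y hy; apply: he.
split; [split|]; rewrite /= /ball /=.
- exact: (hy ord0).
- exact: (hy (@Ordinal 3 1 isT)).
- exact: (hy (@Ordinal 3 2 isT)).
Qed.

(** An open set is the union of the boxes with rational corners that it contains.
    This links the product topology to the product sigma-algebra. *)
Lemma open_measurable3 (R : realType) (U : set (R3 R)) : open U -> measurable (U : set (M3 R)).
Proof.
move=> oU.
pose B (q : (rat * rat * rat) * (rat * rat * rat)) : set (M3 R) :=
  obox (ratr q.1.1.1, ratr q.1.1.2, ratr q.1.2) (ratr q.2.1.1, ratr q.2.1.2, ratr q.2.2).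
pose V n : set (M3 R) := if unpickle n is Some q then (if `[< B q `<=` U >] then B q else set0) else set0.
rewrite (_ : U = \bigcup_n V n).
  apply: bigcup_measurable => n _; rewrite /V; case: unpickle => [q|//].
  by case: ifP => // _; exact: measurable_obox.
apply/seteqP; split => x; last first.
  by move=> [n _]; rewrite /V; case: unpickle => [q|//]; case: ifPn => // /asboolP; exact.
move=> Ux.
have [e e0 he] : exists2 e : R, 0 < e & forall y, (forall i, `|coord i x - coord i y| < e) -> U y.
  by apply: nbhs_obox; exact: open_nbhs_nbhs.
have lo (i : 'I_3) : exists q : rat, coord i x - e < ratr q < coord i x.
  by have [|q] := @rat_in_itvoo R (coord i x - e) (coord i x); [lra|rewrite in_itv/=; exists q].
have hi (i : 'I_3) : exists q : rat, coord i x < ratr q < coord i x + e.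
  by have [|q] := @rat_in_itvoo R (coord i x) (coord i x + e); [lra|rewrite in_itv/=; exists q].
have [l hl] := choice lo; have [h hh] := choice hi.
pose o0 : 'I_3 := ord0. pose o1 := (@Ordinal 3 1 isT). pose o2 := (@Ordinal 3 2 isT).
pose q := ((l o0, l o1, l o2), (h o0, h o1, h o2)).
have cl i : coord i (ratr q.1.1.1 : R, ratr q.1.1.2 : R, ratr q.1.2 : R) = ratr (l i) :> R.
  by rewrite /q /coord; case: i => [[|[|[|//]]] iP] /=; congr (ratr (l _)); exact: val_inj.
have ch i : coord i (ratr q.2.1.1 : R, ratr q.2.1.2 : R, ratr q.2.2 : R) = ratr (h i) :> R.
  by rewrite /q /coord; case: i => [[|[|[|//]]] iP] /=; congr (ratr (h _)); exact: val_inj.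
exists (pickle q); first exact: I.
rewrite /V pickleK.
have BU : B q `<=` U.
  move=> y /oboxP hy; apply: he => i.
  have := hy i; rewrite cl ch => /andP[y1 y2].
  have /andP[l1 l2] := hl i; have /andP[h1 h2] := hh i.
  by rewrite ltr_norml; apply/andP; split; lra.
rewrite (asboolT BU); apply/oboxP => i; rewrite cl ch.
by have /andP[_ ->] := hl i; have /andP[-> _] := hh i.
Qed.

Lemma continuous_measurable3 (R : realType) (f : R3 R -> R) : continuous f -> mfun3 f.
Proof.
move=> /continuousP cf; apply: (measurability _ (RGenOpens.measurableE R)) => _ [_ [a [b ->] <-]].
by rewrite setTI; apply: open_measurable3; apply: cf; exact: interval_open.
Qed.

Lemma compact_sub_cbox (R : realType) (K : set (R3 R)) : compact K ->
  exists r : R, K `<=` cbox (cst3 (- r)) (cst3 r).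
Proof.
move=> cK.
have [M hM] : exists M : R, forall x i, K x -> `|coord i x| <= M.
  have cKi i : exists M : R, forall x, K x -> `|coord i x| <= M.
    have := continuous_compact (continuous_subspaceT (@coord_continuous R i)) cK.
    move=> /compact_bounded [M [_ hM]]; exists (M + 1) => x Kx.
    by apply: (hM (M + 1)); [rewrite ltrDl|exists x].
  have [M hM] := choice cKi.
  exists (\sum_i `|M i|) => x i Kx; rewrite (bigD1 i)//=.
  apply: (le_trans (hM i x Kx)); apply: (le_trans (ler_norm _)).
  by rewrite lerDl sumr_ge0.
exists M => x Kx; apply/cboxP => i; rewrite !coord_cst3 -ler_norml; exact: hM.
Qed.

Lemma compact_measurable3 (R : realType) (K : set (R3 R)) : compact K -> measurable (K : set (M3 R)).
Proof.
move=> cK; rewrite -[K]setCK; apply: measurableC; apply: open_measurable3.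
by apply: closed_openC; apply: compact_closed => //; exact: norm_hausdorff.
Qed.

(** * Test functions *)

Lemma derive_addl (R : realType) (f : R3 R -> R) (z x v : R3 R) :
  'D_v (fun y => f (z + y)) x = 'D_v f (z + x).
Proof.
rewrite /derive.
rewrite (_ : (fun h => h^-1 *: ((f \o shift (z + x)) (h *: v) - f (z + x))) =
  (fun h => h^-1 *: (((fun y => f (z + y)) \o shift x) (h *: v) - f (z + x))))//.
by apply/funext => h /=; rewrite addrCA.
Qed.

Lemma derivable_addl (R : realType) (f : R3 R -> R) (z x v : R3 R) :
  derivable f (z + x) v -> derivable (fun y => f (z + y)) x v.
Proof.
rewrite /derivable.
rewrite (_ : (fun h => h^-1 *: ((f \o shift (z + x)) (h *: v) - f (z + x))) =
  (fun h => h^-1 *: (((fun y => f (z + y)) \o shift x) (h *: v) - f (z + x))))//.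
by apply/funext => h /=; rewrite addrCA.
Qed.

Lemma foldr_partial_addl (R : realType) (f : R3 R -> R) (z : R3 R) (s : seq 'I_3) :
  foldr (@partial R) (fun x => f (z + x)) s = fun x => foldr (@partial R) f s (z + x).
Proof.
elim: s => [//|i s /= ->]; apply/funext => x; exact: derive_addl.
Qed.

Lemma test_function_addl (R : realType) (f : R3 R -> R) (z : R3 R) :
  test_function f -> test_function (fun x => f (z + x)).
Proof.
move=> [sf cf]; split.
  move=> s; rewrite foldr_partial_addl; have [cs ds] := sf s; split.
    move=> x; apply: (@continuous_comp _ _ _ (fun x : R3 R => z + x)); last exact: cs.
    by apply: cvgD; [exact: cvg_cst|exact: cvg_id].
  by move=> i x; apply: derivable_addl.
pose K : set (R3 R) := [set x | closure [set x | f x != 0] (z + x)].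
have cK : compact K.
  rewrite (_ : K = (fun x => x - z) @` closure [set x | f x != 0]).
    apply: continuous_compact => //; apply: continuous_subspaceT => x.
    by apply: cvgB; [exact: cvg_id|exact: cvg_cst].
  apply/seteqP; split => x; rewrite /K /=; first by move=> h; exists (z + x) => //; rewrite addrAC subrr add0r.
  by move=> [y hy <-]; rewrite addrC subrK.
apply: (subclosed_compact (@closed_closure _ _) cK).
rewrite [X in _ `<=` X](closure_id _).1.
  by apply: closure_subset => x /= fx; exact: subset_closure.
by apply: compact_closed => //; exact: norm_hausdorff.
Qed.

Lemma test_function_bounded (R : realType) (f : R3 R -> R) : test_function f ->
  exists r C : R, [/\ forall x, `|f x| <= C, forall i x, `|partial i f x| <= C &
    forall x, ~ cbox (cst3 (- r)) (cst3 r) x -> f x = 0 /\ forall i, partial i f x = 0].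
Proof.
move=> [sf cf]; have [r hr] := compact_sub_cbox cf.
pose K := closure [set x | f x != 0].
have f0 x : ~ K x -> f x = 0.
  by move=> nK; apply/eqP; apply: contrapT => /negP fx; apply: nK; exact: subset_closure.
have p0 x i : ~ K x -> partial i f x = 0.
  move=> nK; rewrite /partial (@near_eq_derive _ _ _ _ (cst 0)) ?derive_cst//.
  have oK : open (~` K) by apply: closed_openC; exact: closed_closure.
  near=> y; apply: f0; near: y; apply: open_nbhs_nbhs; split => //.
have bnd (g : R3 R -> R) : continuous g -> (forall x, ~ K x -> g x = 0) -> exists C, 0 <= C /\ forall x, `|g x| <= C.
  move=> cg g0.
  have := continuous_compact (continuous_subspaceT cg) cf.
  move=> /compact_bounded [M [_ hM]]; exists (`|M| + 1); split; first by rewrite addr_ge0.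
  move=> x; have [Kx|nKx] := pselect (K x); last by rewrite g0// normr0 addr_ge0.
  by apply: (hM (`|M| + 1)); [have := ler_norm M; lra|exists x].
have [C0 [C00 hC0]] := bnd f (sf [::]).1 f0.
have [C1 hC1] := choice (fun i => bnd (partial i f) (sf [:: i]).1 (p0^~ i)).
exists r, (C0 + \sum_i C1 i); split.
- by move=> x; apply: (le_trans (hC0 x)); rewrite lerDl sumr_ge0// => i _; have [] := hC1 i.
- move=> i x; have [c1 h] := hC1 i; apply: (le_trans (h x)).
  by rewrite (bigD1 i)//= addrCA lerDl addr_ge0// sumr_ge0// => j _; have [] := hC1 j.
by move=> x nx; have nK : ~ K x; [by move=> Kx; exact/nx/hr|split => [|i]; [exact: f0|exact: p0]].
Unshelve. all: by end_near.
Qed.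

Lemma is_derive_line (R : realType) (f : R3 R -> R) (i : 'I_3) (x : R3 R) (t : R) : smooth f ->
  is_derive t (1:R) (fun t => f (t *: evec R i + x)) (partial i f (t *: evec R i + x)).
Proof.
move=> sf; apply/is_derive_cvgP.
have := derivableP ((sf [::]).2 i (t *: evec R i + x)) => /is_derive_cvgP.
apply: cvg_trans; apply: near_eq_cvg; near=> h.
by rewrite [X in (X + t) *: _]/GRing.scale /= mulr1 scalerDl addrA.
Unshelve. all: by end_near.
Qed.

Lemma FTC_smooth (R : realType) (f : R3 R -> R) (i : 'I_3) (k : R) (x : R3 R) (s : R) :
  smooth f -> 0 < s ->
  (\int[lebesgue_measure]_(t in `[0%R, s]) (k * partial i f (t *: evec R i + x)%R)%:E =
   (k * (f (s *: evec R i + x) - f x))%:E)%E.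
Proof.
move=> sf s0.
have C : continuous (fun t : R => partial i f (t *: evec R i + x)).
  move=> t; apply: (@continuous_comp _ _ _ (fun t : R => t *: evec R i + x) (partial i f)).
    by apply: cvgD; [apply: cvgZr_tmp; exact: cvg_id|exact: cvg_cst].
  exact: ((sf [:: i]).1).
have Dk (t : R) : is_derive t (1:R) (fun t => k * f (t *: evec R i + x)) (k * partial i f (t *: evec R i + x)).
  by apply: is_deriveZ; exact: is_derive_line.
have Ck : continuous (fun t : R => k * partial i f (t *: evec R i + x)).
  by move=> t; apply: cvgM; [exact: cvg_cst|exact: C].
by rewrite (FTC_line s0 Dk Ck) scale0r add0r mulrBr.
Qed.

(** * Smooth bumps converging to the indicator of a box *)

Lemma flat0_le1 (R : realType) (x : R) : flat 0 x <= 1.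
Proof.
rewrite /flat; case: ifPn => // x0.
by rewrite expr0 mul1r -expR0 ler_expR oppr_le0 invr_ge0 ltW.
Qed.

Lemma cvg_flat0 (R : realType) (x : R) :
  flat 0 (n.+1%:R * x) @[n --> \oo] --> (((0 < x)%R)%:R : R).
Proof.
have [x0|x0] := ltP 0 x; last first.
  apply: cvg_near_cst; apply: nearW => n.
  by rewrite /flat ltNge mulr_ge0_le0.
have E n : flat 0 (n.+1%:R * x) = expR (- (x^-1 * n.+1%:R^-1)).
  by rewrite /flat mulr_gt0// expr0 mul1r invfM mulrC.
under eq_fun do rewrite E.
rewrite (_ : (true%:R : R) = expR (- (x^-1 * 0))); last by rewrite mulr0 oppr0 expR0.
apply: (@cvg_comp _ _ _ (fun n : nat => - (x^-1 * n.+1%:R^-1)) (@expR R) _ (nbhs (- (x^-1 * 0)))).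
  by apply: cvgN; apply: cvgM; [exact: cvg_cst|exact: cvg_harmonic].
exact: continuous_expR.
Qed.

(** The arguments are kept affine in t, the form that [smooth1_aff] expects. *)
Definition bump (R : realType) (a c : R) (n : nat) (t : R) : R :=
  flat 0 (n.+1%:R * t + (- (n.+1%:R * a))) * flat 0 (- n.+1%:R * t + n.+1%:R * c).

Lemma smooth1_bump (R : realType) (a c : R) n : smooth1 (bump a c n).
Proof. by apply: smooth1_mul; apply: smooth1_aff; exact: smooth1_flat. Qed.

Lemma bumpE (R : realType) (a c : R) n t :
  bump a c n t = flat 0 (n.+1%:R * (t - a)) * flat 0 (n.+1%:R * (c - t)).
Proof. by rewrite /bump; congr (flat 0 _ * flat 0 _); ring. Qed.

Lemma bump_ge0 (R : realType) (a c : R) n t : 0 <= bump a c n t.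
Proof. by rewrite /bump mulr_ge0// flat_ge0. Qed.

Lemma bump_le1 (R : realType) (a c : R) n t : bump a c n t <= 1.
Proof. by rewrite /bump mulr_ile1// ?flat_ge0// flat0_le1. Qed.

Lemma bump_supp (R : realType) (a c : R) n t : bump a c n t != 0 -> a < t < c.
Proof.
rewrite bumpE; apply: contraNT; rewrite negb_and -!leNgt => /orP[h|h].
  by rewrite /flat ltNge mulr_ge0_le0 ?subr_le0//= mul0r.
by rewrite mulrC /flat ltNge mulr_ge0_le0 ?subr_le0//= mul0r.
Qed.

Lemma cvg_bump (R : realType) (a c t : R) :
  bump a c n t @[n --> \oo] --> (((a < t < c)%R)%:R : R).
Proof.
under eq_fun do rewrite bumpE.
have -> : ((a < t < c)%R)%:R = ((0 < t - a)%R)%:R * ((0 < c - t)%R)%:R :> R.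
  by rewrite !subr_gt0 -natrM mulnb.
by apply: cvgM; exact: cvg_flat0.
Qed.

Definition boxbump (R : realType) (a c : R3 R) (n : nat) : R3 R -> R :=
  prod3 (fun i => bump (coord i a) (coord i c) n).

Lemma boxbump_test (R : realType) (a c : R3 R) n : test_function (boxbump a c n).
Proof.
apply: (@test_prod3 _ _ a c) => [i|i t]; first exact: smooth1_bump.
by move=> /bump_supp /andP[/ltW -> /ltW ->].
Qed.

Lemma boxbump_bound (R : realType) (a c : R3 R) n x : `|boxbump a c n x| <= \1_(obox a c) x.
Proof.
rewrite /boxbump /prod3 ger0_norm; last by apply: prodr_ge0 => i _; exact: bump_ge0.
rewrite indicE; have [xI|xI] := boolP (x \in obox a c).
  by apply: prodr_ile1 => i _; rewrite bump_ge0 bump_le1.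
have [i hi] : exists i, bump (coord i a) (coord i c) n (coord i x) = 0.
  apply: contrapT => h; move: xI; rewrite notin_setE; apply.
  apply/oboxP => i; apply: (@bump_supp _ _ _ n); apply/eqP => bi; apply: h; by exists i.
by rewrite (bigD1 i)//= hi mul0r.
Qed.

Lemma cvg_boxbump (R : realType) (a c x : R3 R) :
  boxbump a c n x @[n --> \oo] --> (\1_(obox a c) x : R).
Proof.
rewrite /boxbump /prod3.
have -> : (\1_(obox a c) x : R) = \prod_i ((coord i a < coord i x < coord i c)%R)%:R.
  rewrite indicE; have [/set_mem/oboxP xI|xI] := boolP (x \in obox a c).
    by rewrite big1// => i _; rewrite xI.
  have [i hi] : exists i, (coord i a < coord i x < coord i c) = false.
    apply: contrapT => h; move: xI; rewrite notin_setE; apply; apply/oboxP => i.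
    by apply/negPn/negP => /negbTE hi; apply: h; exists i.
  by rewrite (bigD1 i)//= hi mul0r.
rewrite !big_ord_recl big_ord0 mulr1; under eq_fun do rewrite !big_ord_recl big_ord0 mulr1.
by apply: cvgM; [|apply: cvgM]; exact: cvg_bump.
Qed.

(** * Integrals along segments *)

Lemma weak_gradient_shift (R : realType) (u : R3 R -> R) (g : 'I_3 -> R3 R -> R)
    (f : R3 R -> R) (i : 'I_3) (z : R3 R) :
  weak_gradient u g -> test_function f ->
  \int[leb3 R]_x (u x * partial i f (z + x)) = - \int[leb3 R]_x (g i x * f (z + x)).
Proof.
move=> [_ _ wg] tf; rewrite -wg; last exact: test_function_addl.
apply: eq_Rintegral => x _; congr (_ * _).
by rewrite /partial derive_addl.
Qed.

Lemma locally_integrable_measurable (R : realType) (f : R3 R -> R) :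
  locally_integrable3 f -> mfun3 f.
Proof.
move=> lf.
have : measurable_fun (\bigcup_n (cbox (cst3 (- n%:R)) (cst3 n%:R) : set (M3 R))) f.
  apply/measurable_fun_bigcup => [n|n]; first exact: measurable_cbox.
  apply/measurable_EFinP.
  by have /integrableP[] := lf _ (@compact_cbox R (cst3 (- n%:R)) (cst3 n%:R)).
rewrite (_ : \bigcup_n _ = setT)//; apply/seteqP; split => // x _.
have : [set: M3 R] x by []. rewrite -bigcup_obox => -[n _ /oboxP hx].
by exists n => //; apply/cboxP => i; have /andP[/ltW -> /ltW ->] := hx i.
Qed.

Lemma locally_integrable_indic (R : realType) (f : R3 R -> R) (r : R) :
  locally_integrable3 f ->
  (leb3 R).-integrable setT (fun x : M3 R => (f x * \1_(cbox (cst3 (- r)) (cst3 r)) x)%:E).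
Proof.
move=> lf; have := lf _ (@compact_cbox R (cst3 (- r)) (cst3 r)).
move/(integrable_mkcond _ (@measurable_cbox R _ _)).
by rewrite epatch_indic.
Qed.

Lemma integrable_tensor d1 d2 (T1 : measurableType d1) (T2 : measurableType d2) (R : realType)
    (m1 : {sigma_finite_measure set T1 -> \bar R}) (m2 : {sigma_finite_measure set T2 -> \bar R})
    (a : T1 -> R) (b : T2 -> R) :
  m1.-integrable setT (EFin \o a) -> m2.-integrable setT (EFin \o b) ->
  (m1 \x m2)%E.-integrable setT (fun z : T1 * T2 => (a z.1 * b z.2)%:E).
Proof.
move=> ia ib.
have ma : measurable_fun setT a by apply/measurable_EFinP; exact: (measurable_int m1).
have mb : measurable_fun setT b by apply/measurable_EFinP; exact: (measurable_int m2).
apply/integrable12ltyP.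
  by apply/measurable_EFinP; apply: measurable_funM; [apply: measurableT_comp ma _|apply: measurableT_comp mb _].
have E x : (\int[m2]_y `|(a x * b y)%:E| = `|a x|%:E * \int[m2]_y `|(b y)%:E|)%E.
  rewrite -ge0_integralZl_EFin//.
    by apply: eq_integral => y _; rewrite EFinM abseM.
  by apply: measurableT_comp => //; exact/measurable_EFinP.
have /integrableP[_ fa] := ia; have /integrableP[_ fb] := ib.
under eq_integral do rewrite E.
rewrite (_ : (\int[m2]_y `|(b y)%:E| = (fine (\int[m2]_y `|(b y)%:E|))%:E)%E); last first.
  by rewrite fineK// ge0_fin_numE//; exact: integral_ge0.
rewrite ge0_integralZr//; last 2 first.
- by apply: measurableT_comp => //; apply: measurableT_comp => //; exact/measurable_EFinP.
- by rewrite lee_fin fine_ge0//; exact: integral_ge0.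
rewrite muleC; apply: lte_mul_pinfty => //.
by rewrite lee_fin fine_ge0//; exact: integral_ge0.
Qed.

Lemma measurable_line (R : realType) (i : 'I_3) :
  measurable_fun setT (fun z : M3 R * measurableTypeR R => (z.2 : R) *: evec R i + (z.1 : R3 R) : M3 R).
Proof.
apply: measurable_add3; last exact: measurable_fst.
have mz (k : R) : measurable_fun [set: M3 R * measurableTypeR R] (fun z => (z.2 : R) * k : measurableTypeR R).
  by apply: measurable_funM => //; exact: measurable_snd.
by apply/measurable_fun_pair => /=; [apply/measurable_fun_pair => /=|]; exact: mz.
Qed.

Lemma measurable_lineN (R : realType) (i : 'I_3) :
  measurable_fun setT (fun z : M3 R * measurableTypeR R => (z.1 : R3 R) - (z.2 : R) *: evec R i : M3 R).
Proof.
apply: measurable_add3; first exact: measurable_fst.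
apply: measurable_opp3.
have mz (k : R) : measurable_fun [set: M3 R * measurableTypeR R] (fun z => (z.2 : R) * k : measurableTypeR R).
  by apply: measurable_funM => //; exact: measurable_snd.
by apply/measurable_fun_pair => /=; [apply/measurable_fun_pair => /=|]; exact: mz.
Qed.

(** The common integrability properties of test functions, of their derivatives
    and of indicators of boxes: multiplied by such a function, a locally
    integrable function becomes integrable. *)
Definition tame (R : realType) (f : R3 R -> R) : Prop :=
  mfun3 f /\ exists r C : R, (forall x, `|f x| <= C) /\
    forall x, ~ cbox (cst3 (- r)) (cst3 r) x -> f x = 0.

Lemma tame_test (R : realType) (f : R3 R -> R) : test_function f -> tame f.
Proof.
move=> tf; split; first by apply: continuous_measurable3; exact: (tf.1 [::]).1.
have [r [C [h1 _ h3]]] := test_function_bounded tf.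
by exists r, C; split => // x /h3 [].
Qed.

Lemma tame_partial (R : realType) (f : R3 R -> R) i : test_function f -> tame (partial i f).
Proof.
move=> tf; split; first by apply: continuous_measurable3; exact: (tf.1 [:: i]).1.
have [r [C [_ h2 h3]]] := test_function_bounded tf.
by exists r, C; split => // x /h3 [_].
Qed.

Lemma coord_bounded (R : realType) (x : R3 R) : exists2 r : R, 0 <= r & forall i, `|coord i x| <= r.
Proof.
have : [set: M3 R] x by [].
rewrite -bigcup_obox => -[n _ /oboxP hx]; exists n%:R => // i.
have := hx i; rewrite !coord_cst3 => /andP[h1 h2].
by rewrite ler_norml !ltW.
Qed.

Lemma tame_obox (R : realType) (a c : R3 R) : tame (\1_(obox a c) : R3 R -> R).
Proof.
split; first by apply: measurable_indic; exact: measurable_obox.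
have [r1 _ h1] := coord_bounded a; have [r2 _ h2] := coord_bounded c.
exists (Num.max r1 r2), 1; split=> x.
  by rewrite indicE; case: (x \in _); rewrite ?normr1 ?normr0.
move=> nx; rewrite indicE; case: (boolP (x \in _)) => // /set_mem/oboxP xI.
exfalso; apply: nx; apply/cboxP => i; rewrite !coord_cst3.
have /andP[x1 x2] := xI i; have := h1 i; have := h2 i.
rewrite !ler_norml => /andP[a1 a2] /andP[c1 c2].
have m1 : r1 <= Num.max r1 r2 by rewrite le_max lexx.
have m2 : r2 <= Num.max r1 r2 by rewrite le_max lexx orbT.
by apply/andP; split; lra.
Qed.

Lemma coord_line (R : realType) (i j : 'I_3) (t : R) (x : R3 R) : 0 <= t <= 1 ->
  `|coord j (t *: evec R i + x) - coord j x| <= 1.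
Proof.
move=> /andP[t0 t1]; rewrite coord_add_evec addrK; case: ifP => _; last by rewrite normr0.
by rewrite ger0_norm.
Qed.

(** The integrands of the double integral over x and t in [0, s] that arises when
    f is tested against psi along direction i, before ([line_fwd]) and after
    ([line_bwd]) the substitution x -> x - t e_i. *)
Section line_integrals.
Variables (R : realType) (f psi : R3 R -> R) (i : 'I_3) (s : R).
Hypotheses (lf : locally_integrable3 f) (tpsi : tame psi) (s0 : 0 < s) (s1 : s <= 1).

Let I01 : set (measurableTypeR R) := `[0, s]%classic.
Let mI01 : measurable I01 := measurable_itv _.
Let mf : mfun3 f := locally_integrable_measurable lf.

Definition line_fwd (z : M3 R * measurableTypeR R) : \bar R :=
  (f z.1 * psi ((z.2 : R) *: evec R i + z.1) * \1_I01 z.2)%:E.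
Definition line_bwd (z : M3 R * measurableTypeR R) : \bar R :=
  (f ((z.1 : R3 R) - (z.2 : R) *: evec R i) * psi z.1 * \1_I01 z.2)%:E.

Lemma line_bound : exists a : R3 R -> R, [/\ (leb3 R).-integrable setT (EFin \o a : M3 R -> \bar R),
  forall x, 0 <= a x &
  forall x t, 0 <= t <= 1 -> `|f x * psi (t *: evec R i + x)| <= a x].
Proof.
have [_ [r [C [hC hr]]]] := tpsi.
have C0 : 0 <= C by apply: (le_trans _ (hC 0)).
exists (fun x => C * `|f x * \1_(cbox (cst3 (- (r + 1))) (cst3 (r + 1))) x|); split.
- have il := locally_integrable_indic (r + 1) lf.
  rewrite (_ : EFin \o _ = (fun x => C%:E * `|(f x * \1_(cbox (cst3 (- (r + 1))) (cst3 (r + 1))) x)%:E|)%E).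
    by apply: integrableZl => //; exact: integrable_abse.
  by apply/funext => x /=; rewrite EFinM.
- by move=> x; rewrite mulr_ge0.
move=> x t ht; rewrite normrM [leLHS]mulrC.
have [xK|xK] := pselect (cbox (cst3 (- (r + 1))) (cst3 (r + 1)) x).
  by rewrite indicE mem_set// mulr1; apply: ler_wpM2r.
rewrite hr ?normr0 ?mul0r ?mulr_ge0// => /cboxP h; apply: xK; apply/cboxP => j.
have := h j; have := coord_line i j x ht; rewrite !coord_cst3 ler_norml => /andP[h1 h2] /andP[h3 h4].
by apply/andP; split; lra.
Qed.

Lemma integrable_section t : 0 <= t <= 1 ->
  (leb3 R).-integrable setT (fun x : M3 R => (f x * psi (t *: evec R i + x))%:E).
Proof.
move=> ht; have [a [ia a0 ha]] := line_bound.
apply: (le_integrable _ _ _ ia) => //.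
  apply/measurable_EFinP; apply: measurable_funM => //.
  under eq_fun do rewrite addrC.
  by apply: (measurable_comp3 tpsi.1); exact: measurable_shift.
by move=> x _ /=; rewrite lee_fin [leRHS]ger0_norm// ha.
Qed.

Lemma measurable_line_fwd : measurable_fun setT line_fwd.
Proof.
apply/measurable_EFinP; apply: measurable_funM; last first.
  exact: (measurableT_comp (measurable_indic mI01) measurable_snd).
apply: measurable_funM; first exact: (measurableT_comp mf measurable_fst).
by apply: (measurable_comp3 tpsi.1); exact: measurable_line.
Qed.

Lemma measurable_line_bwd : measurable_fun setT line_bwd.
Proof.
apply/measurable_EFinP; apply: measurable_funM; last first.
  exact: (measurableT_comp (measurable_indic mI01) measurable_snd).
apply: measurable_funM; last exact: (measurableT_comp tpsi.1 measurable_fst).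
by apply: (measurable_comp3 mf); exact: measurable_lineN.
Qed.

Lemma integrable_line_fwd : (leb3 R \x @lebesgue_measure R)%E.-integrable setT line_fwd.
Proof.
have [a [ia a0 ha]] := line_bound.
have ib : (@lebesgue_measure R).-integrable setT (EFin \o (\1_I01 : measurableTypeR R -> R)).
  apply/integrableP; split; first by apply/measurable_EFinP; exact: (measurable_indic mI01).
  rewrite (_ : (\int[_]_x _)%E = (\int[@lebesgue_measure R]_x (\1_I01 x)%:E)%E); last first.
    by apply: eq_integral => t _ /=; rewrite ger0_norm.
  rewrite integral_indic// setIT.
  have lI : (lebesgue_measure I01 = s%:E)%E by rewrite lebesgue_measure_itv/= lte_fin s0 -EFinD subr0.
  by have := ltry s; rewrite -lI; exact.
have := integrable_tensor ia ib.
apply: le_integrable => //; first exact: measurable_line_fwd.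
move=> [x t] _ /=; rewrite lee_fin normrM [leRHS]normrM.
rewrite indicE; have [/set_mem|_] := boolP (t \in I01); last by rewrite !normr0 !mulr0.
rewrite /I01 /= in_itv/= => /andP[t0 ts].
by rewrite normr1 !mulr1 [leRHS]ger0_norm// ha// t0 (le_trans ts).
Qed.

Lemma line_bwd_shift x t : line_bwd (x, t) = line_fwd ((x : R3 R) - (t : R) *: evec R i, t).
Proof. by rewrite /line_bwd /line_fwd /= addrCA subrr addr0. Qed.

Lemma integral_line_bwd t : (\int[leb3 R]_x line_bwd (x, t) = \int[leb3 R]_x line_fwd (x, t))%E.
Proof.
under eq_integral do rewrite line_bwd_shift.
apply: (@integral_shift R (- ((t : R) *: evec R i)) (fun x => line_fwd (x, t))).
by apply: (measurableT_comp measurable_line_fwd); exact: measurable_pair2.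
Qed.

Lemma integrable_line_bwd : (leb3 R \x @lebesgue_measure R)%E.-integrable setT line_bwd.
Proof.
apply/integrable21ltyP; first exact: measurable_line_bwd.
rewrite (_ : (\int[_]_y _)%E = (\int[@lebesgue_measure R]_t \int[leb3 R]_x `|line_fwd (x, t)|)%E).
  have [+ _] := @integrable21ltyP _ _ _ _ R (leb3 R) (@lebesgue_measure R) _ measurable_line_fwd.
  by apply; exact: integrable_line_fwd.
apply: eq_integral => t _.
under [LHS]eq_integral do rewrite line_bwd_shift.
apply: (@integral_shift R (- ((t : R) *: evec R i)) (fun x => `|line_fwd (x, t)|%E)).
by apply: measurableT_comp => //; apply: (measurableT_comp measurable_line_fwd); exact: measurable_pair2.
Qed.

End line_integrals.

(** * Difference quotients of functions with a weak gradient *)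

Lemma Rintegral_eqN d (T : measurableType d) (R : realType) (mu : {measure set T -> \bar R})
  (f g : T -> R) : mu.-integrable setT (EFin \o f) -> mu.-integrable setT (EFin \o g) ->
  \int[mu]_x f x = - (\int[mu]_x g x) ->
  (\int[mu]_x (f x)%:E = - \int[mu]_x (g x)%:E)%E.
Proof.
move=> fi gi; rewrite /Rintegral => h.
rewrite -(fineK (integrable_fin_num measurableT fi)) h EFinN fineK//.
exact: (integrable_fin_num measurableT gi).
Qed.

Lemma dominated_cvg d (T : measurableType d) (R : realType) (mu : {measure set T -> \bar R})
  (f_ : nat -> T -> R) (f : T -> R) (h : T -> \bar R) :
  (forall n, measurable_fun setT (f_ n)) -> measurable_fun setT f ->
  (forall x, f_ n x @[n --> \oo] --> f x) -> mu.-integrable setT h ->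
  (forall x n, (`|(f_ n x)%:E| <= h x)%E) ->
  (\int[mu]_x (f_ n x)%:E)%E @[n --> \oo] --> (\int[mu]_x (f x)%:E)%E.
Proof.
move=> mf_ mf cf ih fh.
have [] // := @dominated_convergence _ _ R mu setT measurableT (fun n => EFin \o f_ n) (EFin \o f) h.
- by move=> n; exact/measurable_EFinP.
- exact/measurable_EFinP.
- by apply: aeW => x _; apply: cvg_EFin; [exact: nearW|exact: cf].
- by apply: aeW => x n _; exact: fh.
Qed.

Section weak_line.
Variables (R : realType) (u : R3 R -> R) (g : 'I_3 -> R3 R -> R) (i : 'I_3) (s : R).
Hypotheses (wg : weak_gradient u g) (s0 : 0 < s) (s1 : s <= 1).

Let lu : locally_integrable3 u. Proof. by have [] := wg. Qed.
Let lg j : locally_integrable3 (g j). Proof. by have [] := wg. Qed.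

(** Write the increment of f as the integral of its derivative along the segment,
    exchange the integrals, use the definition of the weak gradient for each
    translate of f, and translate back. *)
Lemma weak_line_test (f : R3 R -> R) : test_function f ->
  (\int[leb3 R]_x (u x * (f (s *: evec R i + x)%R - f x))%:E =
   - \int[leb3 R \x @lebesgue_measure R]_z line_bwd (g i) f i s z)%E.
Proof.
move=> tf.
have tp := tame_partial i tf; have tt := tame_test tf.
have I1 := integrable_line_fwd i lu tp s0 s1.
have I2 := integrable_line_fwd i (lg i) tt s0 s1.
have I3 := integrable_line_bwd i (lg i) tt s0 s1.
have L x : (\int[@lebesgue_measure R]_t line_fwd u (partial i f) i s (x, t) = (u x * (f (s *: evec R i + x)%R - f x))%:E)%E.
  rewrite -FTC_smooth//; last exact: tf.1.
  rewrite [RHS]integral_mkcond epatch_indic; apply: eq_integral => t _.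
  by rewrite /line_fwd EFinM.
under eq_integral do rewrite -L.
have := @Fubini _ _ _ _ R (leb3 R) (@lebesgue_measure R) _ I1 => ->.
have I2N : (leb3 R \x @lebesgue_measure R)%E.-integrable setT (fun z => (-1)%:E * line_fwd (g i) f i s z)%E.
  exact: integrableZl.
have E t : (\int[leb3 R]_x line_fwd u (partial i f) i s (x, t) = \int[leb3 R]_x ((-1)%:E * line_fwd (g i) f i s (x, t)))%E.
  rewrite /line_fwd /= indicE; have [/set_mem/=|_] := boolP (t \in _); last first.
    by under eq_integral do rewrite mulr0; under [in RHS]eq_integral do rewrite mulr0 mule0.
  rewrite in_itv/= => /andP[t0 ts]; have ht : 0 <= t <= 1 by rewrite t0 (le_trans ts).
  under eq_integral do rewrite mulr1; under [in RHS]eq_integral do rewrite mulr1.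
  rewrite integralZl//; last exact: integrable_section.
  rewrite EFinN mulN1e.
  apply: Rintegral_eqN; [exact: integrable_section|exact: integrable_section|].
  exact: weak_gradient_shift.
under eq_integral do rewrite E.
have -> := integral21_prod_meas1 I2N.
rewrite integralZl// EFinN mulN1e -(integral21_prod_meas1 I2) -(integral21_prod_meas1 I3).
congr (- _)%E; apply: eq_integral => t _.
by apply/esym; exact: (integral_line_bwd i s (lg i) tt).
Qed.

(** Smooth bumps increase to the indicator of the box; dominated convergence on
    both sides. *)
Lemma weak_line_box (a c : R3 R) :
  (\int[leb3 R]_x (u x * (\1_(obox a c) (s *: evec R i + x)%R - \1_(obox a c) x))%:E =
   - \int[leb3 R \x @lebesgue_measure R]_z line_bwd (g i) (\1_(obox a c)) i s z)%E.
Proof.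
have tI := tame_obox a c.
have mu := locally_integrable_measurable lu.
have mg := locally_integrable_measurable (lg i).
have I3 := integrable_line_bwd i (lg i) tI s0 s1.
have s01 : 0 <= s <= 1 by rewrite ltW.
have z01 : 0 <= (0:R) <= 1 by rewrite lexx ler01.
have Iu1 := integrable_section i lu tI s01.
have Iu0 := integrable_section i lu tI z01.
have mboxbump n : mfun3 (boxbump a c n) by have [] := tame_test (boxbump_test a c n).
have mshift : measurable_fun [set: M3 R] ((fun x : R3 R => s *: evec R i + x) : M3 R -> M3 R).
  by under eq_fun do rewrite addrC; exact: measurable_shift.
pose D (x : M3 R) : \bar R := (`|(u x * \1_(obox a c) (s *: evec R i + x)%R)%:E| + `|(u x * \1_(obox a c) (0 *: evec R i + x)%R)%:E|)%E.
have iD : (leb3 R).-integrable setT D.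
  by apply: integrableD => //; exact: integrable_abse.
have bb n (x : R3 R) : `|boxbump a c n x| <= \1_(obox a c) x by exact: boxbump_bound.
have abs1 (x : R3 R) : `|\1_(obox a c) x : R| = \1_(obox a c) x by rewrite ger0_norm// indicE.
have cvL : (\int[leb3 R]_x (u x * (boxbump a c n (s *: evec R i + x)%R - boxbump a c n x))%:E)%E @[n --> \oo]
   --> (\int[leb3 R]_x (u x * (\1_(obox a c) (s *: evec R i + x)%R - \1_(obox a c) x))%:E)%E.
  apply: (dominated_cvg _ _ _ iD).
  - move=> n; apply: measurable_funM => //; apply: measurable_funB => //.
    exact: (measurableT_comp (mboxbump n) mshift).
  - apply: measurable_funM => //; apply: measurable_funB; last exact: tI.1.
    exact: (measurableT_comp tI.1 mshift).
  - by move=> x; apply: cvgM; [exact: cvg_cst|apply: cvgB; exact: cvg_boxbump].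
  - move=> x n; rewrite /D scale0r add0r /= -EFinD lee_fin.
    rewrite mulrBr (le_trans (ler_normB _ _))// !normrM !abs1.
    by apply: lerD; apply: ler_wpM2l.
have cvR : (\int[leb3 R \x @lebesgue_measure R]_z line_bwd (g i) (boxbump a c n) i s z)%E @[n --> \oo]
   --> (\int[leb3 R \x @lebesgue_measure R]_z line_bwd (g i) (\1_(obox a c)) i s z)%E.
  apply: (dominated_cvg _ _ _ (integrable_abse I3)).
  - move=> n; apply/measurable_EFinP; apply: measurable_line_bwd => //.
    by apply: tame_test; exact: boxbump_test.
  - by apply/measurable_EFinP; exact: measurable_line_bwd.
  - by move=> z; apply: cvgM; [apply: cvgM; [exact: cvg_cst|exact: cvg_boxbump]|exact: cvg_cst].
  - move=> z n; rewrite /line_bwd /= lee_fin !normrM.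
    by apply: ler_wpM2r => //; apply: ler_wpM2l => //; rewrite abs1.
have E n := weak_line_test (boxbump_test a c n).
move: cvL; under eq_fun do rewrite E; move=> cvL.
by apply: (cvg_unique _ cvL (cvgeN cvR)); exact: ereal_hausdorff.
Qed.

Lemma weak_line_box_shift (a c : R3 R) :
  (\int[leb3 R]_x ((u (x - s *: evec R i)%R - u x) * \1_(obox a c) x)%:E =
   - \int[leb3 R \x @lebesgue_measure R]_z line_bwd (g i) (\1_(obox a c)) i s z)%E.
Proof.
rewrite -weak_line_box.
have tI := tame_obox a c.
have mu := locally_integrable_measurable lu.
have s01 : 0 <= s <= 1 by rewrite ltW.
have z01 : 0 <= (0:R) <= 1 by rewrite lexx ler01.
have Iu1 := integrable_section i lu tI s01.
have Iu0 := integrable_section i lu tI z01.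
have Iu0' : (leb3 R).-integrable setT (fun x : M3 R => (u x * \1_(obox a c) x)%:E).
  by move: Iu0; under eq_fun do rewrite scale0r add0r.
pose h (x : R3 R) : \bar R := (u x * \1_(obox a c) (s *: evec R i + x)%R)%:E.
have mh : mfun3 h by exact: (measurable_int _ Iu1).
have hs x : h (x - s *: evec R i) = (u (x - s *: evec R i) * \1_(obox a c) x)%:E.
  by rewrite /h addrCA subrr addr0.
have Iu1' : (leb3 R).-integrable setT (fun x : M3 R => (u ((x : R3 R) - s *: evec R i) * \1_(obox a c) x)%:E).
  apply/integrableP; split.
    under eq_fun do rewrite -hs.
    by apply: (measurableT_comp mh); exact: measurable_shift.
  under eq_integral do rewrite -hs.
  rewrite (@integral_shift R (- (s *: evec R i)) (fun x => `|h x|%E)); last exact: measurableT_comp.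
  by have /integrableP[] := Iu1.
under eq_integral do rewrite mulrBl EFinB.
under [in RHS]eq_integral do rewrite mulrBr EFinB.
rewrite integralB// [RHS]integralB//; congr (_ - _)%E.
under eq_integral do rewrite -hs.
exact: (@integral_shift R (- (s *: evec R i)) h).
Qed.

End weak_line.

(** On a set of measure at most 1, integrate h^2 - 2 c h + c^2 >= 0 with c the
    integral of h. *)
Lemma sqr_integral_le d (T : measurableType d) (R : realType) (mu : {measure set T -> \bar R})
    (D : set T) (h : T -> R) : measurable D -> (mu D <= 1)%E -> measurable_fun D h ->
  (((fine (\int[mu]_(t in D) (h t)%:E)) ^+ 2)%:E <= \int[mu]_(t in D) (h t ^+ 2)%:E)%E.
Proof.
move=> mD muD mh.
have [->|fin] := eqVneq (\int[mu]_(t in D) (h t ^+ 2)%:E)%E +oo%E; first by rewrite leey.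
have h20 : (0 <= \int[mu]_(t in D) (h t ^+ 2)%:E)%E.
  by apply: integral_ge0 => t _; rewrite lee_fin sqr_ge0.
have finA : (\int[mu]_(t in D) (h t ^+ 2)%:E < +oo)%E by rewrite ltey.
have muDoo : (mu D < +oo)%E by apply: (le_lt_trans muD); rewrite ltry.
have i1 : mu.-integrable D (EFin \o cst 1).
  apply/integrableP; split; first exact/measurable_EFinP.
  by under eq_integral do rewrite /= normr1; rewrite integral_cst// mul1e.
have i2 : mu.-integrable D (fun t => (h t ^+ 2)%:E).
  apply/integrableP; split; first by apply/measurable_EFinP; exact: measurable_funX.
  by under eq_integral do rewrite gee0_abs ?lee_fin ?sqr_ge0//.
have ih : mu.-integrable D (EFin \o h).
  apply: (le_integrable mD _ _ (integrableD mD i1 i2)); first exact/measurable_EFinP.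
  move=> t _ /=; rewrite lee_fin [leRHS]ger0_norm; last by rewrite addr_ge0// sqr_ge0.
  have := sqr_ge0 (`|h t| - 1); rewrite sqrrB1 real_normK ?num_real//.
  by have := normr_ge0 (h t); lra.
set A := (\int[mu]_(t in D) (h t ^+ 2)%:E)%E in h20 finA *.
set c := fine (\int[mu]_(t in D) (h t)%:E)%E.
have fA : A \is a fin_num by rewrite ge0_fin_numE.
have Ec : (\int[mu]_(t in D) (h t)%:E = c%:E)%E by rewrite fineK//; exact: integrable_fin_num.
have key : ((2 * c)%:E * c%:E <= A + (c ^+ 2)%:E)%E.
  rewrite -Ec -integralZl//.
  apply: (@le_trans _ _ (\int[mu]_(t in D) ((h t ^+ 2)%:E + (c ^+ 2)%:E * (EFin \o cst 1%R) t)%E)%E).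
    apply: le_integral => //; first exact: integrableZl.
      by apply: integrableD => //; exact: integrableZl.
    move=> t _ /=; rewrite mule1 -EFinM -EFinD lee_fin.
    by have := sqr_ge0 (h t - c); lra.
  rewrite integralD//; last exact: integrableZl.
  apply: leeD; first exact: lexx.
  rewrite integralZl// [X in (_ * X)%E](_ : _ = mu D); last first.
    by rewrite -[RHS]mul1e -integral_cst.
  by rewrite -[leRHS]mule1 lee_wpmul2l// lee_fin sqr_ge0.
move: key; rewrite -(fineK fA) -EFinM -EFinD !lee_fin.
by rewrite !expr2; lra.
Qed.

(** On the box [K m], the function [F m] is u(x - s e_i) - u(x) plus the integral
    of g_i from x - s e_i to x. It integrates to 0 over every box, hence vanishes
    almost everywhere. *)
Section shift_bound.
Variables (R : realType) (u : R3 R -> R) (g : 'I_3 -> R3 R -> R) (i : 'I_3) (s : R).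
Hypotheses (wg : weak_gradient u g) (s0 : 0 < s) (s1 : s <= 1).

Let lu : locally_integrable3 u. Proof. by have [] := wg. Qed.
Let lg j : locally_integrable3 (g j). Proof. by have [] := wg. Qed.
Let mu := locally_integrable_measurable lu.
Let mg := locally_integrable_measurable (lg i).
Let I01 : set (measurableTypeR R) := `[0, s]%classic.
Let mI01 : measurable I01 := measurable_itv _.

Let K m : set (M3 R) := obox (cst3 (- m%:R)) (cst3 m%:R).
Let mK m : measurable (K m) := measurable_obox _ _.

Let F m (x : M3 R) : \bar R :=
  (((u ((x : R3 R) - s *: evec R i) - u x) * \1_(K m) x)%:E +
    fubini_F (@lebesgue_measure R) (line_bwd (g i) (\1_(K m)) i s) x)%E.

Lemma integrable_shift_diff m : (leb3 R).-integrable setT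
  (fun x : M3 R => ((u ((x : R3 R) - s *: evec R i) - u x) * \1_(K m) x)%:E).
Proof.
have tI := tame_obox (cst3 (- m%:R)) (cst3 m%:R : R3 R).
have s01 : 0 <= s <= 1 by rewrite ltW.
have z01 : 0 <= (0:R) <= 1 by rewrite lexx ler01.
have Iu1 := integrable_section i lu tI s01.
have Iu0 := integrable_section i lu tI z01.
have Iu0' : (leb3 R).-integrable setT (fun x : M3 R => (u x * \1_(K m) x)%:E).
  by move: Iu0; under eq_fun do rewrite scale0r add0r.
pose h (x : R3 R) : \bar R := (u x * \1_(K m) (s *: evec R i + x)%R)%:E.
have mh : mfun3 h by exact: (measurable_int _ Iu1).
have hs x : h (x - s *: evec R i) = (u (x - s *: evec R i) * \1_(K m) x)%:E.
  by rewrite /h addrCA subrr addr0.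
have Iu1' : (leb3 R).-integrable setT (fun x : M3 R => (u ((x : R3 R) - s *: evec R i) * \1_(K m) x)%:E).
  apply/integrableP; split.
    under eq_fun do rewrite -hs.
    by apply: (measurableT_comp mh); exact: measurable_shift.
  under eq_integral do rewrite -hs.
  rewrite (@integral_shift R (- (s *: evec R i)) (fun x => `|h x|%E)); last exact: measurableT_comp.
  by have /integrableP[] := Iu1.
under eq_fun do rewrite mulrBl EFinB.
exact: integrableB.
Qed.

Lemma integrable_F m : (leb3 R).-integrable setT (F m).
Proof.
apply: integrableD => //; first exact: integrable_shift_diff.
apply: integrable_fubini_F; apply: integrable_line_bwd => //; exact: tame_obox.
Qed.

Lemma integral_F_box m a c : (\int[leb3 R]_(x in obox a c) F m x = 0)%E.
Proof.
have tK := tame_obox (cst3 (- m%:R)) (cst3 m%:R : R3 R).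
have IK := integrable_line_bwd i (lg i) tK s0 s1.
have mo : measurable (obox a c) by exact: measurable_obox.
rewrite integralD//; last 2 first.
- by apply: (integrableS measurableT) => //; exact: integrable_shift_diff.
- by apply: (integrableS measurableT) => //; exact: integrable_fubini_F.
have KI x : \1_(K m) x * \1_(obox a c) x = \1_(obox a c `&` K m) x :> R.
  by rewrite indicI mulrC.
have -> : (\int[leb3 R]_(x in obox a c) ((u ((x : R3 R) - s *: evec R i)%R - u x) * \1_(K m) x)%:E =
   \int[leb3 R]_x ((u ((x : R3 R) - s *: evec R i)%R - u x) * \1_(obox a c `&` K m) x)%:E)%E.
  rewrite integral_mkcond epatch_indic; apply: eq_integral => x _ /=.
  by rewrite -EFinM -mulrA KI.
rewrite oboxI (weak_line_box_shift i wg s0 s1) -oboxI.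
have tKI : tame (\1_(obox a c `&` K m) : R3 R -> R) by rewrite oboxI; exact: tame_obox.
have IKI := integrable_line_bwd i (lg i) tKI s0 s1.
rewrite -(integral12_prod_meas1 IKI).
have -> : (\int[leb3 R]_(x in obox a c) fubini_F (@lebesgue_measure R) (line_bwd (g i) (\1_(K m)) i s) x =
  \int[leb3 R]_x fubini_F (@lebesgue_measure R) (line_bwd (g i) (\1_(obox a c `&` K m)) i s) x)%E.
  rewrite integral_mkcond epatch_indic; apply: eq_integral => x _ /=.
  rewrite /fubini_F /line_bwd /=.
  rewrite [X in (_ * X%:E)%E]indicE; have [xI|xI] := boolP (x \in obox a c).
    by rewrite mule1; apply: eq_integral => t _; rewrite -KI [X in _ * (_ * X)]indicE xI mulr1.
  rewrite mule0; under [RHS]eq_integral do rewrite -KI [X in _ * (_ * X)]indicE (negbTE xI) !mulr0 mul0r.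
  by rewrite integral0.
rewrite addeC subee//.
by apply: integrable_fin_num => //; exact: integrable_fubini_F.
Qed.

Let H (x : M3 R) : \bar R := (\int[@lebesgue_measure R]_(t in I01) (g i ((x : R3 R) - (t : R) *: evec R i) ^+ 2)%:E)%E.

Let Q (z : M3 R * measurableTypeR R) : \bar R :=
  (g i ((z.1 : R3 R) - (z.2 : R) *: evec R i) ^+ 2 * \1_I01 z.2)%:E.

Let mQ : measurable_fun setT Q.
Proof.
apply/measurable_EFinP; apply: measurable_funM; last exact: (measurableT_comp (measurable_indic mI01) measurable_snd).
by apply: measurable_funX; apply: (measurable_comp3 mg); exact: measurable_lineN.
Qed.

Let Q0 z : (0 <= Q z)%E.
Proof. by rewrite lee_fin mulr_ge0 ?sqr_ge0// indicE. Qed.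

Let HE x : H x = (\int[@lebesgue_measure R]_t Q (x, t))%E.
Proof.
by rewrite /H integral_mkcond epatch_indic; apply: eq_integral => t _; rewrite /Q EFinM.
Qed.

Let mH : measurable_fun setT H.
Proof.
rewrite (_ : H = fubini_F (@lebesgue_measure R) Q); last by apply/funext => x; exact: HE.
exact: measurable_fun_fubini_tonelli_F.
Qed.

Let lI01 : (@lebesgue_measure R I01 <= 1)%E.
Proof. by rewrite lebesgue_measure_itv/= lte_fin s0 -EFinD subr0 lee_fin. Qed.

Lemma integral_H_le : (\int[leb3 R]_x H x <= \int[leb3 R]_x (g i x ^+ 2)%:E)%E.
Proof.
under eq_integral do rewrite HE.
rewrite (@fubini_tonelli _ _ _ _ R (leb3 R) (@lebesgue_measure R) Q mQ Q0).
have mg2 : mfun3 (fun x => (g i x ^+ 2)%:E) by apply/measurable_EFinP/measurable_funX.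
set B := (\int[leb3 R]_x (g i x ^+ 2)%:E)%E.
have B0 : (0 <= B)%E by apply: integral_ge0 => x _; rewrite lee_fin sqr_ge0.
have E t : (\int[leb3 R]_x Q (x, t) = B * (\1_I01 t)%:E)%E.
  rewrite /Q /= indicE; have [_|_] := boolP (t \in I01); last first.
    by under eq_integral do rewrite mulr0; rewrite integral0 mule0.
  rewrite mule1; under eq_integral do rewrite mulr1.
  apply: (@ge0_integral_shift R (- ((t : R) *: evec R i)) (fun x => (g i x ^+ 2)%:E)) => //.
  by move=> x; rewrite lee_fin sqr_ge0.
under eq_integral do rewrite E.
rewrite ge0_integralZl//; last by apply/measurable_EFinP; exact: measurable_indic.
rewrite integral_indic// setIT.
by rewrite -[leRHS]mule1; apply: lee_wpmul2l.
Qed.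

Lemma shift_sqr_le m :
  (\int[leb3 R]_(x in K m) ((u ((x : R3 R) - s *: evec R i)%R - u x) ^+ 2)%:E <=
   \int[leb3 R]_x (g i x ^+ 2)%:E)%E.
Proof.
have ae0 : ae_eq (leb3 R) setT (F m) (cst 0%E).
  apply: (@integral_pi_system_ae0 _ _ _ _ (oboxes R)).
  - exact: measurable_oboxes.
  - exact: setI_closed_oboxes.
  - exact: integrable_F.
  - by move=> _ [a [c ->]]; exact: integral_F_box.
  - rewrite -(integral_F_box m (cst3 (- m%:R)) (cst3 m%:R)) [RHS]integral_mkcond.
    apply: eq_integral => x _; rewrite patchE; case: ifPn => // xK.
    rewrite /F indicE (negbTE xK) mulr0 add0e /fubini_F /line_bwd /=.
    under eq_integral do rewrite [X in _ * X * _]indicE (negbTE xK) mulr0 mul0r.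
    by rewrite integral0.
have H0 x : (0 <= H x)%E by apply: integral_ge0 => t _; rewrite lee_fin sqr_ge0.
apply: (le_trans _ integral_H_le).
apply: (@le_trans _ _ (\int[leb3 R]_(x in K m) H x)%E); last first.
  by apply: ge0_subset_integral.
apply: ae_ge0_le_integral => //.
- by move=> x _; rewrite lee_fin sqr_ge0.
- apply: measurable_funTS; apply: (@measurable_sqr_diff R _ _ u (fun x : M3 R => (x : R3 R) - s *: evec R i) id) => //.
  exact: measurable_shift.
- exact: measurable_funTS.
apply: filterS ae0 => x /(_ I); rewrite /F /= => Fx xK.
have G : fubini_F (@lebesgue_measure R) (line_bwd (g i) (\1_(K m)) i s) x =
    (\int[@lebesgue_measure R]_(t in I01) (g i ((x : R3 R) - (t : R) *: evec R i))%:E)%E.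
  rewrite [RHS]integral_mkcond epatch_indic; apply: eq_integral => t _.
  by rewrite /line_bwd /= [X in _ * X * _]indicE mem_set// mulr1 EFinM.
move: Fx; rewrite G indicE mem_set// mulr1.
have mgx : measurable_fun I01 (fun t : measurableTypeR R => g i ((x : R3 R) - (t : R) *: evec R i)).
  apply: measurable_funTS; apply: (measurable_comp3 mg).
  exact: (measurableT_comp (measurable_lineN i) (measurable_pair1 x)).
have := @sqr_integral_le _ _ R (@lebesgue_measure R) I01 _ mI01 lI01 mgx.
move: (\int[_]_(_ in _) _)%E => A; case: A => [r| |] //= hA.
move=> /eqP; rewrite -EFinD eqe addr_eq0 => /eqP ->.
by rewrite sqrrN.
Qed.

Lemma shift_energy_neg_le :
  (shift_energy u (- (s *: evec R i))%R <= \int[leb3 R]_x (g i x ^+ 2)%:E)%E.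
Proof.
have ndK : {homo K : n m / (n <= m)%N >-> (n <= m)%O}.
  move=> n m nm; apply/subsetPset => x /oboxP h; apply/oboxP => j.
  have := h j; rewrite !coord_cst3 => /andP[h1 h2].
  have : n%:R <= m%:R :> R by rewrite ler_nat.
  by move=> nm'; apply/andP; split; lra.
have md : measurable_fun setT (fun x : M3 R => ((u ((x : R3 R) - s *: evec R i)%R - u x) ^+ 2)%:E).
  apply: (@measurable_sqr_diff R _ _ u (fun x : M3 R => (x : R3 R) - s *: evec R i) id) => //.
  exact: measurable_shift.
have sq0 (m : nat) (x : M3 R) : K m x -> (0 <= ((u ((x : R3 R) - s *: evec R i)%R - u x) ^+ 2)%:E)%E.
  by move=> _; rewrite lee_fin sqr_ge0.
have cv := @ge0_nondecreasing_set_cvg_integral _ _ R K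
  (fun x : M3 R => ((u ((x : R3 R) - s *: evec R i)%R - u x) ^+ 2)%:E) (leb3 R) ndK mK
  (fun m => measurable_funTS md) sq0.
move: cv; rewrite (_ : \bigcup_m K m = setT); last exact: bigcup_obox.
move=> cv; rewrite /shift_energy -(cvg_lim _ cv)//.
apply: lime_le; first by apply/cvg_ex; eexists; exact: cv.
by apply: nearW => m; exact: shift_sqr_le.
Qed.

End shift_bound.

Lemma shift_energyN (R : realType) (u : R3 R -> R) (z : R3 R) : mfun3 u ->
  shift_energy u (- z) = shift_energy u z.
Proof.
move=> mu; rewrite /shift_energy.
rewrite -(@ge0_integral_shift R z (fun x => ((u (x - z) - u x) ^+ 2)%:E)); last 2 first.
- apply: (@measurable_sqr_diff R _ _ u (fun x : M3 R => (x : R3 R) - z) id) => //.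
  exact: measurable_shift.
- by move=> x; rewrite lee_fin sqr_ge0.
by apply: eq_integral => x _; rewrite addrK -sqrrN opprB.
Qed.

Lemma gradient_energy_lty (R : realType) (g : 'I_3 -> R3 R -> R) (i : 'I_3) :
  (forall j, mfun3 (g j)) -> Lp3 2 (fun x => Num.sqrt (\sum_(j < 3) g j x ^+ 2)) ->
  (\int[leb3 R]_x (g i x ^+ 2)%:E < +oo)%E.
Proof.
move=> mg /Lp3P[]; first by rewrite ler1n.
move=> _; apply: le_lt_trans; apply: ge0_le_integral => //.
- by move=> x _; rewrite lee_fin sqr_ge0.
- by apply/measurable_EFinP/measurable_funX.
- apply/measurable_EFinP; apply: (measurableT_comp (measurable_powR _)).
  apply: measurableT_comp => //; apply: measurable_sqrt.
  by apply: measurable_sum => j; exact: measurable_funX.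
move=> x _; rewrite lee_fin powR_mulrn// real_normK ?num_real//.
have S0 : 0 <= \sum_(j < 3) g j x ^+ 2 by apply: sumr_ge0 => j _; exact: sqr_ge0.
rewrite sqr_sqrtr// (bigD1 i)//= lerDl.
by apply: sumr_ge0 => j _; exact: sqr_ge0.
Qed.

Lemma lee_comb2 (R : realType) (a b : \bar R) (r t : R) : (a <= r%:E)%E -> (b <= t%:E)%E ->
  (2%:E * a + 2%:E * b <= (2 * r + 2 * t)%:E)%E.
Proof.
move=> ar bt; rewrite (_ : (2 * r + 2 * t)%:E = 2%:E * r%:E + 2%:E * t%:E)%E//.
by apply: leeD; apply: lee_wpmul2l; rewrite ?lee_fin.
Qed.

(** A translation by s is a composition of translations along the axes. *)
Lemma D12_shift_energy (R : realType) (u : R3 R -> R) : D12 u ->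
  exists B : R, forall s, ucube R s -> (shift_energy u s <= B%:E)%E.
Proof.
move=> [_ [g wg Lg]].
have [lu lg _] := wg.
have mu := locally_integrable_measurable lu.
have fN i := gradient_energy_lty i (fun j => locally_integrable_measurable (lg j)) Lg.
pose N i := (\int[leb3 R]_x (g i x ^+ 2)%:E)%E.
have N0 i : (0 <= N i)%E by apply: integral_ge0 => x _; rewrite lee_fin sqr_ge0.
have fiN i : N i = (fine (N i))%:E by rewrite fineK// ge0_fin_numE//; exact: fN.
have NE i t : 0 < t -> t <= 1 -> (shift_energy u (t *: evec R i) <= (fine (N i))%:E)%E.
  move=> t0 t1; rewrite -shift_energyN// -fiN; exact: (shift_energy_neg_le i wg t0 t1).
pose o1 : 'I_3 := @Ordinal 3 1 isT; pose o2 : 'I_3 := @Ordinal 3 2 isT.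
exists (2 * (2 * fine (N ord0) + 2 * fine (N o1)) + 2 * fine (N o2)).
move=> [[s1 s2] s3] [[]] /=; rewrite !in_itv/= => /andP[a0 a1] /andP[b0 b1] /andP[c0 c1].
have -> : (s1, s2, s3) = (s1 *: evec R ord0 + s2 *: evec R o1) + s3 *: evec R o2.
  by congr (_, _, _); rewrite /= /GRing.scale/= ?mulr0 ?mulr1 ?addr0 ?add0r.
apply: (le_trans (shift_energyD _ _ mu)).
apply: lee_comb2; last exact: NE.
apply: (le_trans (shift_energyD _ _ mu)).
by apply: lee_comb2; exact: NE.
Qed.

(** * The inclusion for exponents in [3, 6) *)

Lemma powR_le_interp (R : realType) (p t : R) : 0 <= t -> 3 <= p -> p < 6 ->
  t `^ p <= t ^+ 3 + t ^+ 6.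
Proof.
move=> t0 p3 p6; rewrite -!powR_mulrn//.
have [t1|t1] := leP t 1.
  rewrite (@le_trans _ _ (t `^ 3))//; last by rewrite lerDl powR_ge0.
  by move: t0; rewrite le_eqVlt => /orP[/eqP <-|t0]; [rewrite !powR0//; lra|rewrite ger_powR// t0 t1].
rewrite (@le_trans _ _ (t `^ 6))//; last by rewrite lerDr powR_ge0.
by rewrite ler_powR// ltW.
Qed.

Lemma Espace_sub_Lp (R : realType) (p : R) : 3 <= p -> p < 6 -> Espace R `<=` Lp3 p.
Proof.
move=> p3 p6 u [du eu]; have [L6 _] := du.
have p1 : 1 <= p by lra.
have /Lp3P[|mu] := L6; first by rewrite ler1n.
under eq_integral do rewrite powR_mulrn//.
move=> h6; apply/Lp3P => //; split => //.
have [B hB] := D12_shift_energy du.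
have h3 := integral_cube_lty mu eu hB h6.
have mn : mfun3 (fun x => `|u x|) by exact: (measurableT_comp (@normr_measurable R setT) mu).
have mX n : mfun3 (fun x => (`|u x| ^+ n)%:E) by apply/measurable_EFinP/measurable_funX.
apply: (@le_lt_trans _ _ (\int[leb3 R]_x ((`|u x| ^+ 3)%:E + (`|u x| ^+ 6)%:E))%E).
  apply: ge0_le_integral => //.
  - by apply/measurable_EFinP; exact: (measurableT_comp (measurable_powR _)).
  - exact: emeasurable_funD.
  - by move=> x _; rewrite -EFinD lee_fin powR_le_interp.
rewrite ge0_integralD//.
exact: lte_add_pinfty.
Qed.

(** * Weak gradients from difference quotients *)

Lemma smooth_line_lipschitz (R : realType) (f : R3 R -> R) (i : 'I_3) (C r : R) (x : R3 R) :
  smooth f -> (forall x, `|partial i f x| <= C) -> 0 < r ->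
  `|f (r *: evec R i + x) - f x| <= C * r.
Proof.
move=> sf hC r0.
have cf : continuous (fun t : R => f (t *: evec R i + x)).
  by move=> t; apply: differentiable_continuous; apply/derivable1_diffP; exact: (ex_derive (is_derive := is_derive_line i x t sf)).
have [] := @MVT R (fun t => f (t *: evec R i + x)) (fun t => partial i f (t *: evec R i + x)) 0 r r0.
- by move=> t _; exact: is_derive_line.
- exact: continuous_subspaceT.
move=> t _; rewrite scale0r add0r subr0 => ->.
by rewrite normrM (gtr0_norm r0) ler_pM2r.
Qed.

Lemma cvg_invS_dnbhs (R : realType) : (n.+1%:R^-1 : R) @[n --> \oo] --> (0:R)^'.
Proof.
move=> A [e /= e0 hA].
have /cvgrPdist_lt/(_ _ e0) := @cvg_harmonic R; apply: filterS => n /= hn.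
by apply: hA => //=; rewrite invr_neq0// pnatr_eq0.
Qed.

Lemma cvg_quotient (R : realType) (f : R3 R -> R) (i : 'I_3) (x : R3 R) : smooth f ->
  n.+1%:R * (f (n.+1%:R^-1 *: evec R i + x) - f x) @[n --> \oo] --> partial i f x.
Proof.
move=> sf; have /is_derive_cvgP := derivableP ((sf [::]).2 i x).
move=> /(cvg_comp _ _ (@cvg_invS_dnbhs R)) /=.
by apply: cvg_trans; apply: near_eq_cvg; apply: nearW => n /=; rewrite invrK.
Qed.

Lemma locally_integrable_bounded (R : realType) (f : R3 R -> R) (M : R) : mfun3 f ->
  (forall x, `|f x| <= M) -> locally_integrable3 f.
Proof.
move=> mf hM K cK; have mK := compact_measurable3 cK.
have [r hr] := compact_sub_cbox cK.
have M0 : 0 <= M by apply: (le_trans _ (hM 0)).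
have fK : (leb3 R K < +oo)%E.
  apply: (@le_lt_trans _ _ (leb3 R (cbox (cst3 (- r)) (cst3 r)))).
    by apply: le_measure; rewrite ?inE//; exact: measurable_cbox.
  rewrite leb3_box// !lebesgue_measure_itv/=.
  by case: ifP => _; rewrite ?mule0 ?ltry// -?EFinD -?EFinM ?ltry.
apply/integrableP; split; first by apply: measurable_funTS; exact/measurable_EFinP.
apply: (@le_lt_trans _ _ (\int[leb3 R]_(x in K) (cst M%:E) x)%E).
  apply: ge0_le_integral => //.
  - by apply: measurable_funTS; apply: measurableT_comp => //; exact/measurable_EFinP.
  - by move=> x _ /=; rewrite lee_fin.
by rewrite integral_cst//; apply: lte_mul_pinfty.
Qed.

Lemma locally_integrable_tame (R : realType) (f : R3 R -> R) :
  tame f -> (leb3 R).-integrable setT (fun x : M3 R => (f x)%:E).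
Proof.
move=> [mf [r [C [hC h0]]]].
have := locally_integrable_indic r (locally_integrable_bounded mf hC).
congr (integrable _ _ _); apply/funext => x; rewrite indicE.
by case: (pselect (cbox (cst3 (- r)) (cst3 r) x)) => [/mem_set ->|/h0 ->]; rewrite ?mulr1 ?mul0r.
Qed.

Lemma evec_step_cbox (R : realType) (i : 'I_3) (t r : R) (x : R3 R) : 0 <= t <= 1 ->
  ~ cbox (cst3 (- (r + 1))) (cst3 (r + 1)) x -> ~ cbox (cst3 (- r)) (cst3 r) (t *: evec R i + x).
Proof.
move=> /andP[t0 t1] nx /cboxP hx; apply: nx; apply/cboxP => j.
have := hx j; rewrite coord_add_evec !coord_cst3.
by case: ifP => _ /andP[? ?]; apply/andP; split; lra.
Qed.

(** Summation by parts: for each step size, the difference quotient can be moved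
    from the test function to u by translating the integral. Both sides are
    uniformly bounded and supported in a fixed cube, so dominated convergence
    applies as the step tends to 0. Left quotients of u match right quotients of
    the test function. *)
Lemma weak_gradient_quotient (R : realType) (u : R3 R -> R) (g : 'I_3 -> R3 R -> R) (M : R) :
  mfun3 u -> (forall i, mfun3 (g i)) ->
  (forall x, `|u x| <= M) -> (forall i x, `|g i x| <= M) ->
  (forall i x r, 0 < r -> `|u x - u (x - r *: evec R i)| <= M * r) ->
  (forall i x, n.+1%:R * (u x - u (x - n.+1%:R^-1 *: evec R i)) @[n --> \oo] --> g i x) ->
  weak_gradient u g.
Proof.
move=> mu mg uM gM uL ug; split; [exact: locally_integrable_bounded mu uM|
  by move=> i; exact: locally_integrable_bounded (mg i) (gM i)|].
move=> i f tf; have [r [C [fC dC f0]]] := test_function_bounded tf.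
have M0 : 0 <= M by apply: le_trans (uM 0).
have C0 : 0 <= C by apply: le_trans (fC 0).
pose e n : R3 R := n.+1%:R^-1 *: evec R i.
pose S : set (M3 R) := cbox (cst3 (- (r + 1))) (cst3 (r + 1)).
have n01 n : 0 <= (n.+1%:R^-1 : R) <= 1 by rewrite invr_ge0 ler0n/= invf_le1// ler1n.
have fS n x : ~ S x -> f (e n + x) = 0.
  by move=> nS; have [] := f0 _ (evec_step_cbox (i := i) (n01 n) nS).
have fS0 x : ~ S x -> f x = 0.
  move=> nS; have z01 : 0 <= (0:R) <= 1 by rewrite lexx ler01.
  by have [] := f0 _ (evec_step_cbox (i := i) z01 nS); rewrite scale0r add0r.
have mf : mfun3 f by apply: continuous_measurable3; exact: (tf.1 [::]).1.
have mdf : mfun3 (partial i f) by apply: continuous_measurable3; exact: (tf.1 [:: i]).1.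
have mfe n : mfun3 (fun x : R3 R => f (e n + x)).
  under eq_fun do rewrite addrC.
  by apply: (measurableT_comp mf); exact: measurable_shift.
have mue n : mfun3 (fun x : R3 R => u (x - e n)).
  by apply: (measurableT_comp mu); exact: measurable_shift.
pose A n (x : M3 R) := u x * (n.+1%:R * (f (e n + x) - f x)).
pose B n (x : M3 R) := - (n.+1%:R * (u x - u ((x : R3 R) - e n)) * f x).
pose H n (x : M3 R) := n.+1%:R * (u ((x : R3 R) - e n) * f x).
have mA n : mfun3 (A n).
  by apply: measurable_funM => //; apply: measurable_funM => //; exact: measurable_funB.
have mB n : mfun3 (B n).
  apply: measurableT_comp => //; apply: measurable_funM => //; apply: measurable_funM => //.
  exact: measurable_funB.
have mH n : mfun3 (H n).
  by apply: measurable_funM => //; exact: measurable_funM.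
have AM n x : `|A n x| <= M * C.
  rewrite normrM ler_pM// normrM ger0_norm//.
  have := smooth_line_lipschitz x tf.1 (dC i) (_ : 0 < n.+1%:R^-1).
  rewrite invr_gt0 ltr0Sn => /(_ isT); rewrite -/(e n) => h.
  by rewrite mulrC -ler_pdivlMr// ltr0Sn.
have BM n x : `|B n x| <= M * C.
  rewrite normrN normrM ler_pM// normrM ger0_norm//.
  by rewrite mulrC -ler_pdivlMr ?ltr0Sn// uL// invr_gt0 ltr0Sn.
have A0 n x : ~ S x -> A n x = 0 by move=> nS; rewrite /A fS// fS0// subr0 !mulr0.
have B0 n x : ~ S x -> B n x = 0 by move=> nS; rewrite /B fS0// mulr0 oppr0.
have iA n : (leb3 R).-integrable setT (EFin \o A n).
  by apply: locally_integrable_tame; split => //; exists (r + 1), (M * C); split => // x; exact: A0.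
have iB n : (leb3 R).-integrable setT (EFin \o B n).
  by apply: locally_integrable_tame; split => //; exists (r + 1), (M * C); split => // x; exact: B0.
have iH n : (leb3 R).-integrable setT (EFin \o H n).
  apply: locally_integrable_tame; split => //; exists (r + 1), (n.+1%:R * (M * C)); split => x.
    by rewrite normrM ger0_norm// ler_wpM2l// normrM ler_pM.
  by move=> nS; rewrite /H fS0// !mulr0.
have ABH n (x : R3 R) : A n x + H n x = B n x + H n (x + e n).
  by rewrite /A /B /H addrK [e n + x]addrC; ring.
have iHs n : (leb3 R).-integrable setT (fun x : M3 R => (H n ((x : R3 R) + e n))%:E).
  have := integrableB measurableT (integrableD measurableT (iA n) (iH n)) (iB n).
  congr (integrable _ _ _); apply/funext => x /=.
  by rewrite -!EFinD ABH addrAC subrr add0r.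
have AB n : (\int[leb3 R]_x (A n x)%:E = \int[leb3 R]_x (B n x)%:E)%E.
  have hn : (\int[leb3 R]_x (H n x)%:E)%E \is a fin_num by exact: (integrable_fin_num measurableT (iH n)).
  rewrite -[LHS](addeK _ hn) -[RHS](addeK _ hn); congr (_ - _)%E.
  rewrite -[in RHS](@integral_shift R (e n) (EFin \o H n)); last exact/measurable_EFinP.
  rewrite -(integralD measurableT (iA n) (iH n)) -(integralD measurableT (iB n) (iHs n)).
  by apply: eq_integral => x _ /=; rewrite -EFinD ABH.
have ih : (leb3 R).-integrable setT (fun x : M3 R => (M * C * \1_S x)%:E).
  apply: locally_integrable_indic; apply: (@locally_integrable_bounded _ _ (M * C)) => // x.
  by rewrite ger0_norm// mulr_ge0.
have dom (G : nat -> M3 R -> R) : (forall n x, `|G n x| <= M * C) ->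
    (forall n x, ~ S x -> G n x = 0) -> forall x n, (`|(G n x)%:E| <= (M * C * \1_S x)%:E)%E.
  move=> h1 h2 x n; rewrite lee_fin indicE.
  by case: (pselect (S x)) => [/mem_set ->|/h2 ->]; rewrite ?mulr1// normr0 mulr_ge0// mulr_ge0.
have cA := dominated_cvg mA (measurable_funM mu mdf) _ ih (dom _ AM A0).
have cB := dominated_cvg mB (measurableT_comp (@oppr_measurable R setT) (measurable_funM (mg i) mf)) _ ih (dom _ BM B0).
have eqAB : (\int[leb3 R]_x (u x * partial i f x)%:E = \int[leb3 R]_x (- (g i x * f x))%:E)%E.
  apply: (cvg_unique _ (cA _) (_ : _ --> _)) => //.
    by move=> x; apply: cvgMr; exact: cvg_quotient tf.1.
  under eq_fun do rewrite AB.
  apply: cB => x; apply: cvgN; apply: cvgMl; exact: ug.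
rewrite /Rintegral eqAB -fineN; congr fine.
have ig : (leb3 R).-integrable setT (fun x : M3 R => (g i x * f x)%:E).
  apply: (@locally_integrable_tame R (fun x => g i x * f x)); split; first exact: measurable_funM.
  exists (r + 1), (M * C); split => x; first by rewrite normrM ler_pM.
  by move=> nS; rewrite fS0// mulr0.
by rewrite -(integralN (integrable_add_def measurableT ig)); apply: eq_integral.
Qed.

(** * A bump supported in a cube *)

(** A parabolic arch. The half-open interval makes the left difference quotients
    converge everywhere to [dhat]. *)
Definition hat (R : realType) (a l t : R) : R :=
  if a < t <= a + l then 4 * ((t - a) / l) * (1 - (t - a) / l) else 0.

Definition dhat (R : realType) (a l t : R) : R :=
  if a < t <= a + l then 4 / l * (1 - 2 * ((t - a) / l)) else 0.

Lemma hat_cases (R : realType) (a l t : R) : 0 < l ->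
  [\/ (t - a) / l <= 0 /\ (a < t <= a + l) = false,
      0 < (t - a) / l <= 1 /\ (a < t <= a + l) = true |
      1 < (t - a) / l /\ (a < t <= a + l) = false].
Proof.
move=> l0; rewrite ler_pdivrMr// mul0r ltr_pdivlMr// mul0r ler_pdivrMr// ltr_pdivlMr// mul1r.
case: (leP (t - a) 0) => h; first by apply: Or31; split; [|apply/negbTE; rewrite negb_and -leNgt; lra].
case: (leP (t - a) l) => h'; [apply: Or32|apply: Or33]; split => //.
  by apply/andP; split; lra.
by apply/negbTE; rewrite negb_and -ltNge; apply/orP; right; lra.
Qed.

Lemma hat_itv (R : realType) (a l t : R) : 0 < l -> 0 <= hat a l t <= 1.
Proof.
move=> l0; rewrite /hat; have [[h ->]|[/andP[h1 h2] ->]|[h ->]] := hat_cases a t l0; rewrite ?lexx ?ler01//.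
set s := _ / l in h1 h2 *; have := sqr_ge0 (2 * s - 1); rewrite expr2 => h3.
by apply/andP; split; nra.
Qed.

Lemma dhat_le (R : realType) (a l t : R) : 0 < l -> `|dhat a l t| <= 4 / l.
Proof.
move=> l0; have l4 : 0 <= 4 / l by rewrite divr_ge0// ltW.
rewrite /dhat; have [[h ->]|[/andP[h1 h2] ->]|[h ->]] := hat_cases a t l0; rewrite ?normr0//.
rewrite normrM [`|4 / l|]ger0_norm// ler_piMr// ler_norml; lra.
Qed.

Lemma hat_supp (R : realType) (a l t : R) : ~ (a <= t <= a + l) -> hat a l t = 0 /\ dhat a l t = 0.
Proof.
rewrite /hat /dhat => h; case: ifP => // /andP[h1 h2].
by exfalso; apply: h; rewrite ltW.
Qed.

Lemma hat_lipschitz (R : realType) (a l t r : R) : 0 < l -> 0 < r ->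
  `|hat a l t - hat a l (t - r)| <= 4 / l * r.
Proof.
move=> l0 r0; have -> : 4 / l * r = 4 * ((t - a) / l - (t - r - a) / l) by field; rewrite gt_eqF.
have : (t - r - a) / l < (t - a) / l by rewrite ltr_pM2r ?invr_gt0//; lra.
rewrite /hat ler_norml.
have [[h ->]|[/andP[h1 h2] ->]|[h ->]] := hat_cases a t l0;
have [[k ->]|[/andP[k1 k2] ->]|[k ->]] := hat_cases a (t - r) l0 => d; apply/andP; split; nra.
Qed.

Lemma hat_quotient (R : realType) (a l t : R) : 0 < l ->
  n.+1%:R * (hat a l t - hat a l (t - n.+1%:R^-1)) @[n --> \oo] --> dhat a l t.
Proof.
move=> l0; have l0' : l != 0 by rewrite gt_eqF.
have near_lt (b : R) : 0 < b -> \forall n \near \oo, (n.+1%:R^-1 : R) < b.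
  move=> b0; have /cvgrPdist_lt/(_ _ b0) := @cvg_harmonic R; apply: filterS => n /=.
  by rewrite sub0r normrN ger0_norm.
have pos n : 0 < (n.+1%:R^-1 : R) by rewrite invr_gt0 ltr0Sn.
case: (leP t a) => ta.
  apply: (@cvg_trans _ (0 @[_ --> \oo])); last first.
    by rewrite /dhat ifF; [exact: cvg_cst|apply/negbTE; rewrite negb_and -leNgt ta].
  apply: near_eq_cvg; apply: nearW => n; have v0 := pos n.
  have tv : t - n.+1%:R^-1 <= a by rewrite (le_trans _ ta)// lerBlDr lerDl ltW.
  by rewrite /hat !ltNge ta tv subrr mulr0.
case: (leP t (a + l)) => tal; last first.
  apply: (@cvg_trans _ (0 @[_ --> \oo])); last first.
    by rewrite /dhat ifF; [exact: cvg_cst|apply/negbTE; rewrite negb_and -ltNge tal orbT].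
  have h : 0 < t - (a + l) by rewrite subr_gt0.
  apply: near_eq_cvg; apply: filterS (near_lt _ h) => n hn.
  have tv : a + l < t - n.+1%:R^-1 by rewrite ltrBrDl -ltrBrDr.
  by rewrite /hat !(leNgt _ (a + l)) tal tv !andbF subrr mulr0.
have h : 0 < t - a by rewrite subr_gt0.
apply: (@cvg_trans _ ((4 / l * (1 - 2 * ((t - a) / l)) + 4 / l ^+ 2 * n.+1%:R^-1) @[n --> \oo])).
  apply: near_eq_cvg; apply: filterS (near_lt _ h) => n hn; have p0 := pos n.
  have tv1 : a < t - n.+1%:R^-1 by rewrite ltrBrDl -ltrBrDr.
  have tv2 : t - n.+1%:R^-1 <= a + l by rewrite (le_trans _ tal)// gerBl ltW.
  rewrite {1}/hat ta tal {1}/hat tv1 tv2 [true && true]/=.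
  have n0 : (n.+1%:R : R) != 0 by rewrite pnatr_eq0.
  by move: (n.+1%:R : R) n0 => N n0; field; rewrite l0' n0.
rewrite /dhat ifT; last by apply/andP.
set c := 4 / l * _; have : c + 4 / l ^+ 2 * n.+1%:R^-1 @[n --> \oo] --> c + 4 / l ^+ 2 * 0.
  by apply: cvgD; [exact: cvg_cst|apply: cvgMr; exact: cvg_harmonic].
by rewrite mulr0 addr0.
Qed.

Lemma hat_mid (R : realType) (a l t : R) : 0 < l -> a + l / 4 <= t <= a + 3 * l / 4 -> 2^-1 <= hat a l t.
Proof.
move=> l0 /andP[h1 h2].
have s1 : 4^-1 <= (t - a) / l by rewrite ler_pdivlMr//; lra.
have s2 : (t - a) / l <= 3 / 4 by rewrite ler_pdivrMr//; lra.
rewrite /hat; have [[h _]|[_ ->]|[h _]] := hat_cases a t l0; [lra| |lra].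
set s := _ / l in s1 s2 *; nra.
Qed.

Lemma measurable_hat (R : realType) (a l : R) :
  measurable_fun [set: measurableTypeR R] (hat a l : measurableTypeR R -> R) /\
  measurable_fun [set: measurableTypeR R] (dhat a l : measurableTypeR R -> R).
Proof.
have mb : measurable_fun [set: measurableTypeR R] (fun t : measurableTypeR R => a < (t:R) <= a + l).
  by apply: measurable_and; [exact: measurable_fun_ltr|exact: measurable_fun_ler].
have ms : measurable_fun [set: measurableTypeR R] (fun t : measurableTypeR R => ((t:R) - a) / l).
  by apply: measurable_funM => //; exact: measurable_funB.
split; apply: measurable_fun_ifT => //.
  by apply: measurable_funM; [exact: measurable_funM|exact: measurable_funB].
by apply: measurable_funM => //; apply: measurable_funB => //; exact: measurable_funM.
Qed.

Lemma coordD (R : realType) (i : 'I_3) (x y : R3 R) : coord i (x + y) = coord i x + coord i y.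
Proof. by rewrite /coord; case: i => [[|[|[|//]]] ?]. Qed.

Lemma prod3_upd (R : realType) (F : 'I_3 -> R -> R) (i : 'I_3) (g : R -> R) (x : R3 R) :
  prod3 (upd3 F i g) x = g (coord i x) * \prod_(j | j != i) F j (coord j x).
Proof.
rewrite /prod3 (bigD1 i)//= /upd3 eqxx; congr (_ * _).
by apply: eq_bigr => j /negbTE ->.
Qed.

Lemma prod3_step (R : realType) (F : 'I_3 -> R -> R) (i : 'I_3) (t : R) (x : R3 R) :
  prod3 F (x - t *: evec R i) = F i (coord i x - t) * \prod_(j | j != i) F j (coord j x).
Proof.
rewrite /prod3 (bigD1 i)//= addrC -scaleNr coord_add_evec eqxx [_ + coord i x]addrC; congr (_ * _).
by apply: eq_bigr => j /negbTE ji; rewrite coord_add_evec ji add0r.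
Qed.

Lemma measurable_prod3 (R : realType) (F : 'I_3 -> R -> R) :
  (forall i, measurable_fun [set: measurableTypeR R] (F i : measurableTypeR R -> R)) ->
  mfun3 (prod3 F).
Proof.
move=> mF; have mc i : mfun3 (fun x : R3 R => F i (coord i x)).
  by apply: (measurableT_comp (mF i)); apply: continuous_measurable3; exact: coord_continuous.
rewrite /prod3; under eq_fun do rewrite !big_ord_recl big_ord0 mulr1.
by do 2! apply: measurable_funM => //.
Qed.

Definition cubebump (R : realType) (a : R3 R) (l : R) : R3 R -> R :=
  prod3 (fun j => hat (coord j a) l).

Definition dcubebump (R : realType) (a : R3 R) (l : R) (i : 'I_3) : R3 R -> R :=
  prod3 (upd3 (fun j => hat (coord j a) l) i (dhat (coord i a) l)).

Definition cube (R : realType) (a : R3 R) (l : R) : set (M3 R) := cbox a (a + cst3 l).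

Lemma cubeP (R : realType) (a : R3 R) (l : R) (x : R3 R) :
  cube a l x <-> forall i, coord i a <= coord i x <= coord i a + l.
Proof.
split=> [/cboxP h i|h]; first by have := h i; rewrite coordD coord_cst3.
by apply/cboxP => i; rewrite coordD coord_cst3.
Qed.

Lemma measurable_cube (R : realType) (a : R3 R) (l : R) : measurable (cube a l).
Proof. exact: measurable_cbox. Qed.

Lemma leb3_cube (R : realType) (a : R3 R) (l : R) : 0 <= l -> leb3 R (cube a l) = (l ^+ 3)%:E.
Proof.
move=> l0; have h (b : R) : lebesgue_measure `[b, b + l]%classic = l%:E.
  rewrite lebesgue_measure_itv/= lte_fin ltrDl -EFinD addrAC subrr add0r.
  by case: ltP => // l0'; congr EFin; apply/eqP; rewrite eq_le l0 l0'.
by rewrite /cube /cbox leb3_box//= !h -!EFinM !exprS expr0 mulr1 mulrA.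
Qed.

Section cubebump.
Variables (R : realType) (a : R3 R) (l : R).
Hypothesis l0 : 0 < l.

Let H (j : 'I_3) := hat (coord j a) l.
Let P (i : 'I_3) (x : R3 R) := \prod_(j | j != i) H j (coord j x).

Let H01 j t : 0 <= H j t <= 1. Proof. exact: hat_itv. Qed.

Let P01 i x : 0 <= P i x <= 1.
Proof.
apply/andP; split; first by apply: prodr_ge0 => j _; have /andP[] := H01 j (coord j x).
by apply: Num.Theory.prodr_ile1 => j _; exact: H01.
Qed.

Lemma cubebump_itv x : 0 <= cubebump a l x <= 1.
Proof.
apply/andP; split; first by apply: prodr_ge0 => j _; have /andP[] := H01 j (coord j x).
by apply: Num.Theory.prodr_ile1 => j _; exact: H01.
Qed.

Lemma dcubebump_le i x : `|dcubebump a l i x| <= 4 / l.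
Proof.
have /andP[p0 p1] := P01 i x; have l4 : 0 <= 4 / l by rewrite divr_ge0// ltW.
by rewrite /dcubebump prod3_upd normrM [`|\prod_(_ | _) _|]ger0_norm// -[leRHS]mulr1 ler_pM// dhat_le.
Qed.

Lemma cubebump_supp i x : ~ cube a l x -> cubebump a l x = 0 /\ dcubebump a l i x = 0.
Proof.
move=> nx; have [j nj] : exists j, ~ (coord j a <= coord j x <= coord j a + l).
  by apply/existsNP => h; exact/nx/cubeP.
have [h0 d0] := hat_supp nj.
split; rewrite /cubebump /dcubebump /prod3 (bigD1 j)//= ?h0 ?mul0r//.
by rewrite /upd3; case: eqP => [<-|_]; rewrite ?d0 ?h0 mul0r.
Qed.

Lemma cubebump_lipschitz i x r : 0 < r ->
  `|cubebump a l x - cubebump a l (x - r *: evec R i)| <= 4 / l * r.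
Proof.
move=> r0; have /andP[p0 p1] := P01 i x.
have l4 : 0 <= 4 / l * r by rewrite mulr_ge0 ?divr_ge0// ltW.
rewrite /cubebump prod3_step /prod3 (bigD1 i)//= -mulrBl normrM.
by rewrite [`|\prod_(_ | _) _|]ger0_norm// -[leRHS]mulr1 ler_pM// hat_lipschitz.
Qed.

Lemma cubebump_quotient i x :
  n.+1%:R * (cubebump a l x - cubebump a l (x - n.+1%:R^-1 *: evec R i)) @[n --> \oo]
    --> dcubebump a l i x.
Proof.
rewrite /dcubebump prod3_upd /cubebump.
under eq_fun do rewrite prod3_step [X in X - _]/prod3 (bigD1 i)//= -mulrBl mulrA.
by apply: cvgMl; exact: hat_quotient.
Qed.

Lemma cubebump_mid x : cube (a + cst3 (l / 4)) (l / 2) x -> 8^-1 <= cubebump a l x.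
Proof.
move=> /cubeP h; have m j : 2^-1 <= H j (coord j x).
  apply: hat_mid => //; have /andP[] := h j; rewrite coordD coord_cst3 => h1 h2.
  by rewrite h1 /= (le_trans h2)//; lra.
rewrite /cubebump /prod3 !big_ord_recl big_ord0 mulr1.
rewrite (_ : 8^-1 = 2^-1 * (2^-1 * 2^-1)); last by rewrite -!invfM -!natrM.
by rewrite ler_pM ?ler_pM ?mulr_ge0 ?invr_ge0//; exact: m.
Qed.

Lemma measurable_cubebump : mfun3 (cubebump a l).
Proof. by apply: measurable_prod3 => j; exact: (measurable_hat _ _).1. Qed.

Lemma measurable_dcubebump i : mfun3 (dcubebump a l i).
Proof.
apply: measurable_prod3 => j; rewrite /upd3.
by case: ifP => _; [exact: (measurable_hat _ _).2|exact: (measurable_hat _ _).1].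
Qed.

End cubebump.

(** * Integrals of functions dominated on countably many sets *)

Section cover.
Context d (T : measurableType d) (R : realType) (mu : {measure set T -> \bar R}).
Implicit Types (A : nat -> set T) (c v : nat -> R).

Definition step_series c A (x : T) : \bar R := (\sum_(k <oo) (c k * \1_(A k) x)%:E)%E.

Let term_ge0 c A x k : (forall k, 0 <= c k) -> (0 <= (c k * \1_(A k) x)%:E)%E.
Proof. by move=> c0; rewrite lee_fin mulr_ge0. Qed.

Lemma step_series_ge c A x k : (forall k, 0 <= c k) ->
  ((c k * \1_(A k) x)%:E <= step_series c A x)%E.
Proof.
move=> c0; rewrite /step_series (@nneseriesD1 _ (fun k => (c k * \1_(A k) x)%:E) k).
  by rewrite leeDl// nneseries_ge0// => *; exact: term_ge0.
- by move=> *; exact: term_ge0.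
- by [].
Qed.

Let measurable_term c A k : measurable (A k) -> measurable_fun setT (fun x => (c k * \1_(A k) x)%:E).
Proof.
by move=> mA; apply/measurable_EFinP; apply: measurable_funM => //; exact: measurable_indic.
Qed.

Lemma measurable_step_series c A : (forall k, 0 <= c k) -> (forall k, measurable (A k)) ->
  measurable_fun setT (step_series c A).
Proof.
move=> c0 mA; apply: ge0_emeasurable_sum => [k x _ _|k _]; first exact: term_ge0.
exact: measurable_term.
Qed.

Lemma integral_step_series c A v (D : R) : (forall k, 0 <= c k) -> (forall k, measurable (A k)) ->
  (forall k, (mu (A k) <= (v k)%:E)%E) -> (forall n, \sum_(k < n) c k * v k <= D) ->
  (\int[mu]_x step_series c A x <= D%:E)%E.
Proof.
move=> c0 mA Av hD.
rewrite integral_nneseries//; [|by move=> k; exact: measurable_term|by move=> *; exact: term_ge0].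
apply: lime_le; first by apply: is_cvg_nneseries => k _ _; apply: integral_ge0 => x _; exact: term_ge0.
apply: nearW => n; rewrite big_mkord; apply: (@le_trans _ _ (\sum_(k < n) c k * v k)%:E); last by rewrite lee_fin.
rewrite -sumEFin; apply: lee_sum => k _.
under eq_integral do rewrite EFinM.
rewrite ge0_integralZl//; [|exact/measurable_EFinP/measurable_indic|by rewrite lee_fin].
by rewrite integral_indic// setIT EFinM lee_wpmul2l// lee_fin.
Qed.

(** Two families are allowed, because the Coulomb kernel is bounded differently
    near and away from its singularity. *)
Lemma integral_le_cover2 (f : T -> \bar R) (A B : nat -> set T) (c v e w : nat -> R) (D E : R) :
  measurable_fun setT f -> (forall x, (0 <= f x)%E) ->
  (forall k, 0 <= c k) -> (forall k, measurable (A k)) -> (forall k, (mu (A k) <= (v k)%:E)%E) ->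
  (forall n, \sum_(k < n) c k * v k <= D) ->
  (forall k, 0 <= e k) -> (forall k, measurable (B k)) -> (forall k, (mu (B k) <= (w k)%:E)%E) ->
  (forall n, \sum_(k < n) e k * w k <= E) ->
  (forall x, (exists k, (f x <= (c k * \1_(A k) x)%:E)%E) \/
             (exists k, (f x <= (e k * \1_(B k) x)%:E)%E)) ->
  (\int[mu]_x f x <= (D + E)%:E)%E.
Proof.
move=> mf f0 c0 mA Av hD e0 mB Bw hE fcov.
have s0 c' A' x : (forall k, 0 <= c' k) -> (0 <= step_series c' A' x)%E.
  by move=> c'0; apply: nneseries_ge0 => *; exact: term_ge0.
apply: (@le_trans _ _ (\int[mu]_x (step_series c A x + step_series e B x))%E).
  apply: ge0_le_integral => //.
    by apply: emeasurable_funD; exact: measurable_step_series.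
  move=> x _; case: (fcov x) => -[k h]; apply: (le_trans h).
    by rewrite (le_trans (step_series_ge A x k c0))// leeDl// s0.
  by rewrite (le_trans (step_series_ge B x k e0))// leeDr// s0.
rewrite ge0_integralD//; [|by move=> *; exact: s0|exact: measurable_step_series
  |by move=> *; exact: s0|exact: measurable_step_series].
by rewrite EFinD leeD//; exact: integral_step_series.
Qed.

Lemma integral_le_cover (f : T -> \bar R) (A : nat -> set T) (c v : nat -> R) (D : R) :
  measurable_fun setT f -> (forall x, (0 <= f x)%E) ->
  (forall k, 0 <= c k) -> (forall k, measurable (A k)) -> (forall k, (mu (A k) <= (v k)%:E)%E) ->
  (forall n, \sum_(k < n) c k * v k <= D) ->
  (forall x, exists k, (f x <= (c k * \1_(A k) x)%:E)%E) ->
  (\int[mu]_x f x <= D%:E)%E.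
Proof.
move=> mf f0 c0 mA Av hD fcov; rewrite -[D]addr0.
apply: (@integral_le_cover2 f A (fun=> set0) c v (fun=> 0) (fun=> 0)) => //.
- by move=> k; rewrite measure0.
- by move=> n; rewrite big1// => k _; rewrite mulr0.
- by move=> x; left; exact: fcov.
Qed.

End cover.

Lemma sum_expr_half (R : realType) (n : nat) : \sum_(k < n) (2^-1 : R) ^+ k <= 2.
Proof.
suff -> : \sum_(k < n) (2^-1 : R) ^+ k = 2 - 2 * 2^-1 ^+ n by rewrite gerBl mulr_ge0 ?exprn_ge0.
elim: n => [|n IH]; first by rewrite big_ord0 expr0 mulr1 subrr.
by rewrite big_ord_recr /= IH exprSr; field.
Qed.

(** Telescoping against [t `^ (1 - a)], by [1 + x <= expR x]. *)
Lemma sum_powRN (R : realType) (a : R) (n : nat) : 1 < a ->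
  \sum_(k < n) k.+1%:R `^ (- a) <= 1 + (a - 1)^-1.
Proof.
move=> a1; have a0 : 0 < a - 1 by rewrite subr_gt0.
have step k : k.+2%:R `^ (- a) <= (k.+1%:R `^ (1 - a) - k.+2%:R `^ (1 - a)) / (a - 1) :> R.
  have k1 : 0 < (k.+1%:R : R) by rewrite ltr0Sn.
  have k2 : 0 < (k.+2%:R : R) by rewrite ltr0Sn.
  rewrite ler_pdivlMr//.
  have -> : k.+2%:R `^ (- a) = k.+2%:R `^ (1 - a) / k.+2%:R :> R.
    rewrite -(_ : k.+2%:R `^ (- 1) = k.+2%:R^-1); last by rewrite powRN powRr1 ?ltW.
    rewrite -powRD; first by congr (_ `^ _); ring.
    by rewrite (gt_eqF k2) implybT.
  have -> : k.+1%:R `^ (1 - a) = k.+2%:R `^ (1 - a) * expR ((a - 1) * ln (k.+2%:R / k.+1%:R)) :> R.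
    rewrite /powR !gt_eqF// -expRD lnM ?posrE ?invr_gt0// lnV ?posrE//; congr expR; ring.
  set P := k.+2%:R `^ (1 - a); have P0 : 0 <= P by exact: powR_ge0.
  have h1 : k.+2%:R^-1 <= ln (k.+2%:R / k.+1%:R) :> R.
    rewrite -[k.+2%:R / _]invrK invf_div lnV ?posrE ?divr_gt0// lerNr.
    rewrite (_ : k.+1%:R / k.+2%:R = 1 + (- k.+2%:R^-1)); last first.
      by rewrite -[k.+2%:R]natr1; move: (k.+1%:R : R) k1 => N N0; field; rewrite gt_eqF// ltr_wpDr.
    by apply: le_ln1Dx; rewrite ltrN2 invf_lt1// ltr1n.
  have h2 := expR_ge1Dx ((a - 1) * ln (k.+2%:R / k.+1%:R)).
  have h3 : (a - 1) / k.+2%:R <= (a - 1) * ln (k.+2%:R / k.+1%:R) by rewrite ler_pM2l.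
  have : P * ((a - 1) / k.+2%:R) <= P * (expR ((a - 1) * ln (k.+2%:R / k.+1%:R)) - 1).
    by rewrite ler_wpM2l// (le_trans h3)// lerBrDl.
  by rewrite -mulrA [_^-1 * (a - 1)]mulrC mulrBr mulr1.
case: n => [|n]; first by rewrite big_ord0 addr_ge0// invr_ge0 ltW.
rewrite big_ord_recl powR1 lerD2l.
apply: (@le_trans _ _ ((1 - n.+1%:R `^ (1 - a)) / (a - 1))); last first.
  by rewrite ler_pdivrMr// mulVf ?gt_eqF// gerBl powR_ge0.
elim: n => [|n IH]; first by rewrite big_ord0 powR1 subrr mul0r.
rewrite big_ord_recr /=; apply: (le_trans (lerD IH (step n))).
by rewrite -mulrDl addrA subrK.
Qed.

(** * Sparse sums of bumps *)

(** A test function only sees u and g on a bounded cube. *)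
Lemma weak_gradient_local (R : realType) (u : R3 R -> R) (g : 'I_3 -> R3 R -> R) :
  (forall r : R, exists v w, weak_gradient v w /\
    forall x, cbox (cst3 (- r)) (cst3 r) x -> u x = v x /\ forall i, g i x = w i x) ->
  weak_gradient u g.
Proof.
move=> loc.
have li (f : R3 R -> R) : (forall r : R, exists2 v, locally_integrable3 v &
    forall x, cbox (cst3 (- r)) (cst3 r) x -> f x = v x) -> locally_integrable3 f.
  move=> h K cK; have [r hr] := compact_sub_cbox cK; have [v lv fv] := h r.
  apply: eq_integrable (lv K cK); first exact: compact_measurable3.
  by move=> x /set_mem/hr/fv /= ->.
split=> [|i|i f tf].
- by apply: li => r; have [v [w [[lv _ _] h]]] := loc r; exists v => // x /h[].
- by apply: li => r; have [v [w [[_ lw _] h]]] := loc r; exists (w i) => // x /h[_].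
have [r [C [_ _ f0]]] := test_function_bounded tf.
have [v [w [[_ _ wg] h]]] := loc r.
have -> : \int[leb3 R]_x (u x * partial i f x) = \int[leb3 R]_x (v x * partial i f x).
  apply: eq_Rintegral => x _; have [/h[->]//|/f0[_ ->]] := pselect (cbox (cst3 (- r)) (cst3 r) x).
  by rewrite !mulr0.
rewrite wg//; congr (- _); apply: eq_Rintegral => x _.
by have [/h[_ ->]//|/f0[-> _]] := pselect (cbox (cst3 (- r)) (cst3 r) x); rewrite !mulr0.
Qed.

Lemma coord_le_enorm (R : realType) (i : 'I_3) (z : R3 R) : `|coord i z| <= enorm z.
Proof.
rewrite -sqrtr_sqr ler_wsqrtr//.
case: i => [[|[|[|//]]] ?]; rewrite /coord /=;
 have := sqr_ge0 z.1.1; have := sqr_ge0 z.1.2; have := sqr_ge0 z.2; lra.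
Qed.

Lemma enorm0 (R : realType) : enorm (0 : R3 R) = 0.
Proof. by rewrite /enorm /= expr0n/= !addr0 sqrtr0. Qed.

(** The largest dyadic scale r 2^-n at which z fits in the cube; some coordinate
    then exceeds half of it, and so does the norm of z. *)
Lemma dyadic_scale (R : realType) (r : R) (z : R3 R) : 0 < r -> (forall i, `|coord i z| <= r) ->
  exists n, (forall i, `|coord i z| <= r * 2^-1 ^+ n) /\ (enorm z)^-1 <= 2 / r * 2 ^+ n.
Proof.
move=> r0 zr; have [z0|/existsNP[i0 /eqP zi0]] := pselect (forall i, coord i z = 0).
  exists 0%N; split => [i|]; first by rewrite expr0 mulr1.
  have -> : z = 0.
    have := z0 ord0; have := z0 (lift ord0 ord0); have := z0 (lift ord0 (lift ord0 ord0)).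
    by rewrite /coord /=; case: z {zr z0} => [[a b] c] /= -> -> ->.
  by rewrite enorm0 invr0 mulr_ge0// divr_ge0// ltW.
pose P n := [exists i, r * 2^-1 ^+ n < `|coord i z|].
have exP : exists n, P n.
  have /cvgrPdist_lt/(_ (`|coord i0 z| / r)) : (2^-1 : R) ^+ n @[n --> \oo] --> 0.
    by apply: cvg_expr; rewrite ger0_norm// invf_lt1// ltr1n.
  rewrite divr_gt0 ?normr_gt0// => /(_ isT)[n _ /(_ n (leqnn n)) /=].
  rewrite sub0r normrN ger0_norm ?exprn_ge0// ltr_pdivlMr// mulrC => h.
  by exists n; apply/existsP; exists i0.
case: (ex_minnP exP) => -[/existsP[i]|n /existsP[i hi] hmin].
  by rewrite expr0 mulr1 ltNge zr.
exists n; split=> [j|].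
  have : ~~ P n by apply/negP => /hmin; rewrite ltnn.
  by rewrite negb_exists => /forallP/(_ j); rewrite -leNgt.
have h := lt_le_trans hi (coord_le_enorm i z).
rewrite -[leRHS]invrK lef_pV2 ?posrE; last 2 first.
- by rewrite (le_lt_trans _ h)// mulr_ge0 ?exprn_ge0// ltW.
- by rewrite invr_gt0 mulr_gt0 ?exprn_gt0// divr_gt0.
apply: le_trans (ltW h); rewrite exprSr exprVn.
have : (2:R) ^+ n != 0 by rewrite expf_neq0.
by move: (2 ^+ n) => t t0; rewrite le_eqVlt; apply/orP; left; apply/eqP; field; rewrite t0 gt_eqF.
Qed.

Section sparse_bumps.
Variables (R : realType) (l : nat -> R) (S : R).
Hypotheses (l_ge1 : forall k, 1 <= l k) (l_le : forall k, l k <= k.+1%:R).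
Hypothesis sum_l : forall n, \sum_(k < n) (l k ^+ 3)^-1 <= S.

Let l0 k : 0 < l k. Proof. exact: lt_le_trans ltr01 (l_ge1 k). Qed.

(** The side of the k-th cube is at most k + 1, so corners growing like 4^k leave
    room between the cubes. *)
Definition corner (k : nat) : R3 R := (4 ^+ k.+1, 0, 0).
Definition site (k : nat) : set (M3 R) := cube (corner k) (l k).
Definition height (k : nat) : R := (l k ^+ 2)^-1.
Definition site_bump (k : nat) (x : R3 R) : R := height k * cubebump (corner k) (l k) x.
Definition dsite_bump (k : nat) (i : 'I_3) (x : R3 R) : R :=
  height k * dcubebump (corner k) (l k) i x.

(** Beyond this index no site contains [x]. *)
Definition nsites (x : R3 R) : nat := Num.truncn `|x.1.1|.
Definition sparse (x : R3 R) : R := \sum_(0 <= k < nsites x) site_bump k x.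
Definition dsparse (i : 'I_3) (x : R3 R) : R := \sum_(0 <= k < nsites x) dsite_bump k i x.

Let h01 k : 0 < height k <= 1.
Proof. by rewrite invr_gt0 exprn_gt0//= invf_le1 ?exprn_gt0// exprn_ege1. Qed.

Let site_itv k x : site k x -> ((4 ^ k.+1)%N%:R : R) <= x.1.1 <= (4 ^ k.+1 + k.+1)%N%:R.
Proof.
move=> /cubeP/(_ ord0); rewrite /coord /= -natrX => /andP[-> h] /=.
by rewrite (le_trans h)// natrD lerD2l.
Qed.

Lemma site_index k x : site k x -> (k < nsites x)%N.
Proof.
move=> /site_itv/andP[h _]; rewrite truncn_gt_nat (le_trans _ (ler_norm _))//.
by rewrite (le_trans _ h)// ler_nat ltnW// ltn_expl.
Qed.

Lemma site_gap j k x y : j != k -> site j x -> site k y -> 2 ^+ (j + k) <= enorm (x - y).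
Proof.
have gap a b x' y' : (a < b)%N -> site a x' -> site b y' -> 2 ^+ (a + b) <= `|y'.1.1 - x'.1.1|.
  move=> ab /site_itv/andP[_ h1] /site_itv/andP[h2 _].
  rewrite (le_trans _ (ler_norm _))// lerBrDr (le_trans (lerD (lexx _) h1))// (le_trans _ h2)//.
  rewrite -natrX -natrD ler_nat.
  have e1 : (2 ^ (a + b) <= 4 ^ b)%N.
    by rewrite -[4%N]/(2 ^ 2)%N -expnM leq_exp2l// mul2n -addnn leq_add2r ltnW.
  have e2 : (4 ^ a.+1 <= 4 ^ b)%N by rewrite leq_exp2l.
  have e3 : (a.+1 <= 4 ^ b)%N by rewrite (leq_trans ab)// ltnW// ltn_expl.
  rewrite (leq_trans (leq_add e1 (leq_add e2 e3)))// expnS.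
  by rewrite -[(4 * _)%N]/(_ + (_ + (_ + (_ + 0))))%N !leq_add2l leq_addr.
move=> jk sj sk; apply: le_trans (coord_le_enorm ord0 _).
case: (ltngtP j k) jk => // jk _; last by rewrite addnC; exact: (gap _ _ _ _ jk sk sj).
by rewrite /coord /= distrC; exact: (gap _ _ _ _ jk sj sk).
Qed.

Lemma site_uniq j k x : j != k -> site j x -> ~ site k x.
Proof.
move=> jk sj sk; have := site_gap jk sj sk; rewrite subrr.
by rewrite enorm0 leNgt exprn_gt0.
Qed.

Lemma site_bump_out k x : ~ site k x -> site_bump k x = 0 /\ forall i, dsite_bump k i x = 0.
Proof.
move=> nx; split=> [|i]; rewrite /site_bump /dsite_bump.
  by have [-> _] := cubebump_supp ord0 nx; rewrite mulr0.
by have [_ ->] := cubebump_supp i nx; rewrite mulr0.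
Qed.

(** The sites are disjoint, so at each point the sum has at most one term. *)
Lemma sparse_at x : exists k, [/\ forall j, j != k -> ~ site j x,
  sparse x = site_bump k x & forall i, dsparse i x = dsite_bump k i x].
Proof.
have [[k sk]|ns] := pselect (exists k, site k x).
  exists k; have nj j : j != k -> ~ site j x by move=> jk; apply: (site_uniq _ sk); rewrite eq_sym.
  have kn : k \in index_iota 0 (nsites x) by rewrite mem_index_iota/= site_index.
  split => // [|i]; rewrite /sparse /dsparse (bigD1_seq k)//= ?iota_uniq// big1 ?addr0// => j /nj.
    by move=> /site_bump_out[].
  by move=> /site_bump_out[_].
have nj j : ~ site j x by move=> sj; apply: ns; exists j.
exists 0; have [b0 d0] := site_bump_out (nj 0); split => // [|i]; rewrite ?b0.
  by rewrite /sparse big1// => j _; have [] := site_bump_out (nj j).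
by rewrite d0 /dsparse big1// => j _; have [_] := site_bump_out (nj j).
Qed.

Lemma sparse_sum n x : (nsites x <= n)%N ->
  sparse x = \sum_(0 <= k < n) site_bump k x /\
  forall i, dsparse i x = \sum_(0 <= k < n) dsite_bump k i x.
Proof.
move=> xn; have out k : (nsites x <= k < n)%N -> ~ site k x.
  by move=> /andP[xk _] /site_index; rewrite ltnNge xk.
split=> [|i]; rewrite [RHS](@big_cat_nat _ _ _ (nsites x))//= [X in _ = _ + X]big_nat_cond [X in _ = _ + X]big1 ?addr0// => k;
  by rewrite andbT => /out/site_bump_out[].
Qed.

Lemma site_bump_itv k x : 0 <= site_bump k x <= height k * \1_(site k) x.
Proof.
have /andP[h0 _] := h01 k; have /andP[b0 b1] := cubebump_itv (corner k) (l0 k) x.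
rewrite mulr_ge0//=; last exact: ltW.
have [sx|/[dup] nx /site_bump_out[-> _]] := pselect (site k x); last by rewrite mulr_ge0// ltW.
by rewrite indicE mem_set// mulr1 ler_piMr// ltW.
Qed.

Lemma dsite_bump_le k i x : `|dsite_bump k i x| <= 4 * (height k / l k).
Proof.
have /andP[h0 _] := h01 k; rewrite normrM gtr0_norm// mulrCA ler_wpM2l ?(ltW h0)//.
exact: dcubebump_le.
Qed.

Lemma measurable_site_bump k : mfun3 (site_bump k).
Proof. by apply: measurable_funM => //; exact: measurable_cubebump. Qed.

Lemma measurable_dsite_bump k i : mfun3 (dsite_bump k i).
Proof. by apply: measurable_funM => //; exact: measurable_dcubebump. Qed.

Lemma measurable_sparse : mfun3 sparse.
Proof.
apply: (@measurable_fun_cvg _ _ _ setT (fun n x => \sum_(0 <= k < n) site_bump k x)).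
  by move=> n; apply: measurable_sum => k; exact: measurable_site_bump.
move=> x _; apply: cvg_near_cst; exists (nsites x) => //= n xn.
by apply/esym; exact: (sparse_sum xn).1.
Qed.

Lemma measurable_dsparse i : mfun3 (dsparse i).
Proof.
apply: (@measurable_fun_cvg _ _ _ setT (fun n x => \sum_(0 <= k < n) dsite_bump k i x)).
  by move=> n; apply: measurable_sum => k; exact: measurable_dsite_bump.
move=> x _; apply: cvg_near_cst; exists (nsites x) => //= n xn.
by apply/esym; exact: (sparse_sum xn).2.
Qed.

(** On a bounded cube [sparse] is a finite sum of Lipschitz bumps. *)
Lemma sparse_weak_gradient : weak_gradient sparse dsparse.
Proof.
apply: weak_gradient_local => r; pose n := Num.truncn `|r|.
exists (fun x => \sum_(0 <= k < n) site_bump k x), (fun i x => \sum_(0 <= k < n) dsite_bump k i x).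
split; last first.
  move=> x /cboxP/(_ ord0); rewrite !coord_cst3 /coord/= => h.
  apply: sparse_sum; apply: le_truncn; rewrite ler_norml.
  by have := ler_norm r; have := h; move=> /andP[? ?] ?; apply/andP; split; lra.
have hl k : 4 / l k <= 4 by rewrite ler_pdivrMr// ler_peMr.
apply: (@weak_gradient_quotient _ _ _ (\sum_(0 <= k < n) 4)).
- by apply: measurable_sum => k; exact: measurable_site_bump.
- by move=> i; apply: measurable_sum => k; exact: measurable_dsite_bump.
- move=> x; apply: (le_trans (ler_norm_sum _ _ _)); apply: ler_sum => k _.
  have /andP[s0 s1] := site_bump_itv k x; have /andP[h0 h1] := h01 k.
  rewrite ger0_norm// (le_trans s1)// (@le_trans _ _ 1) ?ler1n//.
  by rewrite mulr_ile1 ?(ltW h0)// indicE lern1; case: (_ \in _).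
- move=> i x; apply: (le_trans (ler_norm_sum _ _ _)); apply: ler_sum => k _.
  have /andP[h0 h1] := h01 k; apply: (le_trans (dsite_bump_le k i x)).
  rewrite ler_piMr// ler_pdivrMr// mul1r; exact: le_trans (l_ge1 k).
- move=> i x t t0; rewrite -sumrB mulr_suml; apply: (le_trans (ler_norm_sum _ _ _)); apply: ler_sum => k _.
  have /andP[h0 h1] := h01 k; rewrite -mulrBr normrM gtr0_norm//.
  rewrite -[leRHS]mul1r ler_pM//; first exact: ltW.
  by apply: (le_trans (cubebump_lipschitz _ (l0 k) _ _ t0)); rewrite ler_pM2r.
move=> i x; under eq_fun do rewrite -sumrB mulr_sumr.
apply: (cvg_big (op := +%R)) => [|k _]; first exact: add_continuous.
under eq_fun do rewrite -mulrBr mulrCA.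
by apply: cvgMr; exact: cubebump_quotient.
Qed.

Let hl k : height k ^+ 3 * l k ^+ 3 = (l k ^+ 3)^-1.
Proof. by rewrite /height; field; rewrite gt_eqF. Qed.

Let sum_site (c : nat -> R) (b : R) : 0 <= b -> (forall k, c k <= b * height k ^+ 3) ->
  forall n, \sum_(k < n) c k * l k ^+ 3 <= b * S.
Proof.
move=> b0 hc n; apply: le_trans (ler_wpM2l b0 (sum_l n)); rewrite mulr_sumr; apply: ler_sum => k _.
by rewrite -hl [leRHS]mulrA; apply: ler_wpM2r; [rewrite exprn_ge0// ltW|exact: hc].
Qed.

Let site_vol k : (leb3 R (site k) <= (l k ^+ 3)%:E)%E.
Proof. by rewrite leb3_cube// ltW. Qed.

Let site_meas k : measurable (site k). Proof. exact: measurable_cube. Qed.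

(** The heights are at most 1, so the sixth power is at most height^3 = l^-6 on a
    cube of volume l^3. *)
Lemma sparse_L6 : Lp3 6 sparse.
Proof.
apply/Lp3P; first by rewrite ler1n.
split; first exact: measurable_sparse.
apply: le_lt_trans (ltry (1 * S)).
apply: (@integral_le_cover _ _ _ (leb3 R) _ site (fun k => height k ^+ 3) (fun k => l k ^+ 3)) => //.
- apply/measurable_EFinP; apply: (measurableT_comp (measurable_powR _)).
  by apply: measurableT_comp => //; exact: measurable_sparse.
- by move=> k; rewrite exprn_ge0// ltW// (andP (h01 k)).1.
- by apply: (@sum_site (fun k => height k ^+ 3) 1) => // k; rewrite mul1r.
move=> x; have [k [_ -> _]] := sparse_at x; exists k; rewrite lee_fin powR_mulrn//.
have /andP[s0 s1] := site_bump_itv k x; have /andP[h0 h1] := h01 k.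
rewrite ger0_norm//.
have [sx|/site_bump_out[-> _]] := pselect (site k x); last first.
  by rewrite expr0n/= mulr_ge0// exprn_ge0// ltW.
move: s1; rewrite indicE mem_set// !mulr1 => s1.
rewrite (le_trans (lerXn2r 6 _ _ s1))// ?nnegrE ?(ltW h0)//.
by rewrite ler_wiXn2l// ltW.
Qed.

(** Each partial derivative is at most 4 height / l, whose square is
    16 height^3 = 16 l^-6. *)
Lemma sparse_D12 : D12 sparse.
Proof.
split; first exact: sparse_L6.
exists dsparse; first exact: sparse_weak_gradient.
have mS : mfun3 (fun x => Num.sqrt (\sum_(i < 3) dsparse i x ^+ 2)).
  apply: measurable_sqrt; apply: measurable_sum => i; apply: measurable_funX.
  exact: measurable_dsparse.
apply/Lp3P; first by rewrite ler1n.
split=> //.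
apply: le_lt_trans (ltry (48 * S)).
have h3 k : 0 <= 48 * height k ^+ 3 by rewrite mulr_ge0// exprn_ge0// ltW// (andP (h01 k)).1.
apply: (@integral_le_cover _ _ _ (leb3 R) _ site (fun k => 48 * height k ^+ 3) (fun k => l k ^+ 3)) => //.
- apply/measurable_EFinP; apply: (measurableT_comp (measurable_powR _)).
  exact: measurableT_comp.
- by apply: (@sum_site (fun k => 48 * height k ^+ 3) 48).
move=> x; have [k [_ _ dk]] := sparse_at x; exists k; rewrite lee_fin powR_mulrn//.
have g0 : 0 <= \sum_(i < 3) dsparse i x ^+ 2 by apply: sumr_ge0 => i _; exact: sqr_ge0.
rewrite real_normK ?num_real// sqr_sqrtr//.
have [sx|/site_bump_out[_ d0]] := pselect (site k x); last first.
  rewrite (_ : \sum_(i < 3) _ = 0); first by rewrite mulr_ge0.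
  by rewrite big1// => i _; rewrite dk d0 expr0n.
rewrite indicE mem_set// mulr1.
have gi i : dsparse i x ^+ 2 <= 16 * height k ^+ 3.
  rewrite dk -[_ ^+ 2]real_normK ?num_real// -(_ : (4 * (height k / l k)) ^+ 2 = 16 * height k ^+ 3).
    by rewrite lerXn2r ?nnegrE// ?dsite_bump_le// (le_trans _ (dsite_bump_le k i x)).
  by rewrite /height; field; rewrite gt_eqF.
rewrite !big_ord_recl big_ord0 addr0.
have := gi ord0; have := gi (lift ord0 ord0); have := gi (lift ord0 (lift ord0 ord0)).
move: (height k ^+ 3) => h g1 g2 g3.
by rewrite (_ : 48 * h = 16 * h + (16 * h + 16 * h)); [rewrite !lerD|ring].
Qed.

Let h0 k : 0 < height k. Proof. by have /andP[] := h01 k. Qed.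

Let cube_center (x : R3 R) (r : R) (y : R3 R) : cube (x - cst3 r) (2 * r) y <-> forall i, `|coord i (x - y)| <= r.
Proof.
have e i : coord i (x - y) = coord i x - coord i y by rewrite /coord; case: i => [[|[|[|//]]] ?].
have e' i : coord i (x - cst3 r) = coord i x - r.
  by rewrite -[r in RHS](coord_cst3 r i) /coord; case: i => [[|[|[|//]]] ?].
split=> [/cubeP h i|h]; last apply/cubeP => i; have := h i; rewrite e e' ler_norml => /andP[? ?]; apply/andP; split; lra.
Qed.

Let half_ge0 n : 0 <= (2^-1 : R) ^+ n. Proof. by rewrite exprn_ge0. Qed.

Let hl2 k : height k ^+ 2 * l k ^+ 3 = (l k)^-1.
Proof. by rewrite /height; field; rewrite gt_eqF. Qed.

(** Near [x] the kernel is bounded on dyadic cubes around [x]; on the other sites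
    it is at most [2 ^- (j + k)], by [site_gap]. *)
Lemma potential_sparse_le k (x : R3 R) : site k x -> sparse x = site_bump k x ->
  (potential sparse x <= (32 * height k ^+ 3 + 2 * (height k ^+ 2 * 2^-1 ^+ k))%:E)%E.
Proof.
move=> sx ux; pose r n := l k * 2^-1 ^+ n.
have r0 n : 0 <= r n by rewrite mulr_ge0 ?exprn_ge0// ltW.
have u2 j y : site j y -> 0 <= site_bump j y ^+ 2 <= height j ^+ 2.
  move=> sy; have /andP[b0 b1] := site_bump_itv j y; rewrite sqr_ge0/= lerXn2r ?nnegrE ?(ltW (h0 _))//.
  by rewrite (le_trans b1)// indicE mem_set// mulr1.
have c0 n : 0 <= height k ^+ 4 * (2 / l k * 2 ^+ n).
  by apply: mulr_ge0; [|apply: mulr_ge0; [apply: divr_ge0|]]; rewrite ?exprn_ge0// ltW.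
have vol n : (leb3 R (cube (x - cst3 (r n))%R (2 * r n)%R) <= ((2 * r n) ^+ 3)%:E)%E.
  by rewrite leb3_cube// mulr_ge0.
apply: (@integral_le_cover2 _ _ _ (leb3 R) _
  (fun n => cube (x - cst3 (r n)) (2 * r n)) site
  (fun n => height k ^+ 4 * (2 / l k * 2 ^+ n)) (fun n => (2 * r n) ^+ 3)
  (fun j => height k ^+ 2 * (2^-1 ^+ k) * (height j ^+ 2 * 2^-1 ^+ j)) (fun j => l j ^+ 3)) => //.
- apply/measurable_EFinP; apply: measurable_funM.
    by apply: measurable_funM => //; apply: measurable_funX; exact: measurable_sparse.
  apply: measurable_invr => [y|]; first exact: enorm_ge0.
  apply: (measurableT_comp (@measurable_enorm R)).
  by apply: measurable_add3 => //; exact: measurable_opp3.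
- by move=> y; exact: (coulomb_integrand_ge0 sparse (x, y)).

- by move=> n; exact: measurable_cube.

- move=> n; rewrite [leRHS](_ : _ = (16 * height k ^+ 3) * 2); last by ring.
  apply: le_trans (ler_wpM2l _ (sum_expr_half R n)); last by rewrite mulr_ge0 ?exprn_ge0// ltW.
  rewrite mulr_sumr; apply: ler_sum => j _.
  have -> : height k ^+ 4 * (2 / l k * 2 ^+ j) * (2 * r j) ^+ 3 = 16 * height k ^+ 3 * (2^-1 ^+ j * 2^-1 ^+ j).
    rewrite /r /height exprVn; have : (2 : R) ^+ j != 0 by rewrite expf_neq0.
    by move: (2 ^+ j) => t t0; field; rewrite t0 gt_eqF.
  rewrite ler_wpM2l ?mulr_ge0 ?exprn_ge0// ?(ltW (h0 k))// ler_piMr//.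
  by rewrite exprn_ile1// invf_le1// ler1n.
- by move=> j; rewrite !mulr_ge0 ?exprn_ge0// ltW.
- move=> n; rewrite [leRHS]mulrC; apply: le_trans (ler_wpM2l _ (sum_expr_half R n)); last by rewrite mulr_ge0 ?exprn_ge0// ltW.
  rewrite mulr_sumr; apply: ler_sum => j _; rewrite -mulrA ler_wpM2l ?mulr_ge0 ?exprn_ge0// ?(ltW (h0 k))//.
  by rewrite mulrAC hl2 ler_piMl// invf_le1.
move=> y; have [j [nj uy _]] := sparse_at y.
have /andP[x0 x1] := u2 k x sx; rewrite ux uy.
have [sy|/site_bump_out[-> _]] := pselect (site j y); last first.
  left; exists 0%N; rewrite expr0n/= mulr0 mul0r lee_fin; apply: mulr_ge0; [exact: c0|rewrite indicE; exact: ler0n].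
have /andP[y0 y1] := u2 j y sy.
have [jk|jk] := eqVneq j k; [left|right].
  subst j; have [n [hn en]] : exists n, (forall i, `|coord i (x - y)| <= r n) /\
      (enorm (x - y))^-1 <= 2 / l k * 2 ^+ n.
    apply: dyadic_scale => // i; have /cubeP/(_ i) := sx; have /cubeP/(_ i) := sy.
    have -> : coord i (x - y) = coord i x - coord i y by rewrite /coord; case: i => [[|[|[|//]]] ?].
    by rewrite ler_norml => /andP[? ?] /andP[? ?]; apply/andP; split; lra.
  exists n; rewrite indicE mem_set ?mulr1 ?lee_fin; last exact/cube_center.
  apply: ler_pM => //; [exact: mulr_ge0|by rewrite invr_ge0 enorm_ge0|].
  by rewrite -[4%N]/(2 + 2)%N exprD; exact: ler_pM.
exists j; rewrite indicE mem_set ?mulr1 ?lee_fin//.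
have := site_gap jk sy sx; rewrite -enormN opprB exprD => g.
have e2 : (enorm (x - y))^-1 <= 2^-1 ^+ j * 2^-1 ^+ k.
  have p0 : 0 < (2:R) ^+ j * 2 ^+ k by rewrite mulr_gt0 ?exprn_gt0.
  by rewrite !exprVn -invfM lef_pV2// posrE; exact: lt_le_trans g.
apply: le_trans (ler_pM _ _ (ler_pM x0 y0 x1 y1) e2) _; [exact: mulr_ge0|by rewrite invr_ge0 enorm_ge0|].
by rewrite le_eqVlt; apply/orP; left; apply/eqP; ring.
Qed.

Lemma sparse_coulomb : (coulomb_energy sparse < +oo)%E.
Proof.
apply: (@le_lt_trans _ _ (32 * S + 4)%:E); last exact: ltry.
rewrite [coulomb_energy _](_ : _ = \int[leb3 R]_x potential sparse x)%E//.
apply: (@integral_le_cover _ _ _ (leb3 R) _ site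
  (fun k => 32 * height k ^+ 3 + 2 * (height k ^+ 2 * 2^-1 ^+ k)) (fun k => l k ^+ 3)) => //.
- by apply: measurable_potential; exact: measurable_sparse.
- by move=> x; exact: potential_ge0.
- by move=> k; rewrite addr_ge0 ?mulr_ge0 ?exprn_ge0// ltW.
- move=> n; under eq_bigr do rewrite mulrDl; rewrite big_split/= lerD//.
    exact: (@sum_site (fun k => 32 * height k ^+ 3) 32).
  rewrite (_ : 4 = 2 * 2 :> R); last by ring.
  apply: le_trans (ler_wpM2l _ (sum_expr_half R n)); last by [].
  rewrite mulr_sumr; apply: ler_sum => k _; rewrite -mulrA ler_wpM2l//.
  by rewrite mulrAC hl2 ler_piMl// invf_le1.
move=> x; have [k [_ ux _]] := sparse_at x; exists k.
have [sx|/site_bump_out[u0 _]] := pselect (site k x).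
  by rewrite indicE mem_set// mulr1; exact: potential_sparse_le.
rewrite /potential ux u0; under eq_integral do rewrite expr0n/= !mul0r.
by rewrite integral0 lee_fin mulr_ge0// addr_ge0 ?mulr_ge0 ?exprn_ge0// ltW.
Qed.

(** Each bump is at least 1/8 of its height on the concentric cube of half the
    side. *)
Lemma sparse_Lp_ge (p : R) (n : nat) : 0 <= p ->
  ((\sum_(0 <= k < n) (8^-1 * height k) `^ p * (l k / 2) ^+ 3)%:E <=
    \int[leb3 R]_x (`|sparse x| `^ p)%:E)%E.
Proof.
move=> p0; pose M k : set (M3 R) := cube (corner k + cst3 (l k / 4)) (l k / 2).
have mM k : measurable (M k) by exact: measurable_cube.
have Msub k x : M k x -> site k x.
  move=> /cubeP h; apply/cubeP => i; have := h i; rewrite coordD coord_cst3.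
  by have := l0 k => ? /andP[? ?]; apply/andP; split; lra.
have tM : trivIset [set` index_iota 0 n] M.
  apply/trivIsetP => j k _ _ jk; apply/seteqP; split => // x [/Msub sj /Msub sk].
  exact: (site_uniq jk sj).
have mf : mfun3 (fun x => (`|sparse x| `^ p)%:E).
  apply/measurable_EFinP; apply: (measurableT_comp (measurable_powR _)).
  by apply: measurableT_comp => //; exact: measurable_sparse.
have f0 x : (0 <= (`|sparse x| `^ p)%:E)%E by rewrite lee_fin powR_ge0.
apply: (@le_trans _ _ (\int[leb3 R]_(x in \big[setU/set0]_(k <- index_iota 0 n) M k) (`|sparse x| `^ p)%:E)%E); last first.
  by apply: ge0_subset_integral => //; exact: bigsetU_measurable.
rewrite ge0_integral_bigsetU ?iota_uniq//; last exact: measurable_funTS.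
rewrite -sumEFin; apply: lee_sum => k _.
have vk : leb3 R (M k) = ((l k / 2) ^+ 3)%:E by rewrite leb3_cube// divr_ge0// ltW.
have e8 : 0 <= 8^-1 * height k by rewrite mulr_ge0// ltW.
rewrite EFinM -vk -(integral_cst (leb3 R) (mM k)).
apply: ge0_le_integral => //.
- by move=> x _; rewrite /= lee_fin powR_ge0.
- exact: measurable_funTS.
move=> x Mx; rewrite lee_fin; have sx := Msub k x Mx.
have bx : 8^-1 * height k <= sparse x.
  have [j [nj -> _]] := sparse_at x.
  have <- : k = j by apply/eqP; apply: contrapT => /negP kj; exact: (nj k kj sx).
  by rewrite mulrC /site_bump ler_wpM2l ?(ltW (h0 k))//; exact: cubebump_mid.
have sp0 : 0 <= sparse x := le_trans e8 bx.
by rewrite ger0_norm//; apply: ge0_ler_powR; rewrite ?nnegrE.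
Qed.

End sparse_bumps.

(** * The inclusion fails below the exponent 3 *)

Section harmonic_sides.
Variables (R : realType) (p : R).
Hypotheses (p1 : 1 <= p) (p3 : p < 3).

Let side (k : nat) : R := k.+1%:R `^ p^-1.

Let p0 : 0 < p. Proof. exact: lt_le_trans ltr01 p1. Qed.
Let N1 k : 1 <= (k.+1%:R : R). Proof. by rewrite ler1n. Qed.

Let side_ge1 k : 1 <= side k.
Proof. by rewrite -[leLHS](powRr0 k.+1%:R) ler_powR// invr_ge0 ltW. Qed.

Let side_le k : side k <= k.+1%:R.
Proof. by rewrite -[leRHS]powRr1// ler_powR// invf_le1. Qed.

Let side_powR k : side k `^ p = k.+1%:R.
Proof. by rewrite -powRrM mulVf ?gt_eqF// powRr1. Qed.

Let sum_side n : \sum_(k < n) (side k ^+ 3)^-1 <= 1 + (3 / p - 1)^-1.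
Proof.
have a1 : 1 < 3 / p by rewrite ltr_pdivlMr// mul1r.
apply: le_trans (sum_powRN n a1); rewrite le_eqVlt; apply/orP; left; apply/eqP.
apply: eq_bigr => k _; rewrite powRN -powR_mulrn ?powR_ge0// -powRrM.
by congr (_ `^ _)^-1; rewrite mulrC.
Qed.

Lemma Espace_sparse : Espace R (sparse side).
Proof. by split; [exact: sparse_D12 sum_side|exact: sparse_coulomb sum_side]. Qed.

Lemma sparse_not_Lp : ~ Lp3 p (sparse side).
Proof.
move=> /Lp3P[]// _ fin; apply: (@dvg_harmonic R).
pose c : R := 8^-1 `^ p / 8; have c0 : 0 < c by rewrite divr_gt0// powR_gt0 ?invr_gt0.
apply: nondecreasing_is_cvgn.
  by apply: nondecreasing_series => k _ _; rewrite invr_ge0.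
have I0 : (0 <= \int[leb3 R]_x (`|sparse side x| `^ p)%:E)%E.
  by apply: integral_ge0 => x _; rewrite lee_fin powR_ge0.
have fI : (\int[leb3 R]_x (`|sparse side x| `^ p)%:E)%E \is a fin_num by rewrite ge0_fin_numE.
exists (fine (\int[leb3 R]_x (`|sparse side x| `^ p)%:E)%E / c) => _ [n _ <-].
rewrite ler_pdivlMr// -lee_fin (fineK fI).
apply: le_trans (sparse_Lp_ge side_ge1 side_le n (ltW p0)).
rewrite lee_fin /series /= mulr_suml; apply: ler_sum => k _.
have s0 : 0 < side k := lt_le_trans ltr01 (side_ge1 k).
have N0 : 0 < (k.+1%:R : R) by rewrite ltr0Sn.
have -> : (8^-1 * height side k) `^ p = 8^-1 `^ p * (k.+1%:R ^+ 2)^-1.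
  rewrite powRM ?invr_ge0 ?exprn_ge0 ?ltW//; congr (_ * _).
  rewrite /height -powR_inv1 ?exprn_ge0 ?ltW// -powR_mulrn ?ltW// -!powRrM.
  rewrite (_ : p^-1 * (2 * (-1 * p)) = - 2%:R); last by field; rewrite gt_eqF.
  by rewrite powRN powR_mulrn.
have s3 : k.+1%:R <= side k ^+ 3.
  by rewrite -{1}side_powR -powR_mulrn ?(ltW s0)// ler_powR// ltW.
rewrite expr_div_n /harmonic /= /c mulrCA -[leRHS]mulrA; apply: ler_wpM2l; first exact: powR_ge0.
apply: (@le_trans _ _ ((k.+1%:R ^+ 2)^-1 * (k.+1%:R * 8^-1))).
  by move: (k.+1%:R : R) N0 => N N0; rewrite le_eqVlt; apply/orP; left; apply/eqP; field; rewrite gt_eqF.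
rewrite ler_wpM2l ?invr_ge0 ?exprn_ge0// (_ : (2:R) ^+ 3 = 8); last by ring.
by rewrite ler_wpM2r// invr_ge0.
Qed.

End harmonic_sides.

Theorem theorem1p5 (R : realType) :
  (forall p : R, 3 <= p -> p < 6 -> Espace R `<=` Lp3 p) /\
  (forall p : R, 1 <= p -> p < 3 -> ~ (Espace R `<=` Lp3 p)).
Proof.
split=> p p1 p2; first exact: Espace_sub_Lp.
by move=> /(_ _ (Espace_sparse p1 p2)); exact: sparse_not_Lp.
Qed.
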